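(* Let $\tilde G=\mathbb{R}$ with the Euclidean norm, $G=\mathbb{S}^1=\mathbb{R}/\mathbb{Z}$ with the quotient norm, and let $\phi:\mathbb{R}\to\mathbb{R}/\mathbb{Z}$ be the quotient projection. Let $K\subset\mathbb{R}^d$ be a convex, compact set with nonempty interior and let $\pi:\mathscr{F}_{d-1}^{\mathbb{R}}(K)\to\mathscr{F}_{d-1}^{\mathbb{S}^1}(K)$ be the map induced by $\phi$. Then the restriction of $\pi$ is surjective between $\{\tilde T\in\mathscr{F}_{d-1}^{\mathbb{R}}(K):\mathbb{M}(\tilde T)<\infty\}$ and $\{T\in\mathscr{F}_{d-1}^{\mathbb{S}^1}(K):\mathbb{M}(T)<\infty\}$.
   Context: Quotient norm on $\mathbb{R}/\mathbb{Z}$: $\|\phi(x)\|:=\min\{\mathrm{frac}(x),1-\mathrm{frac}(x)\}$ with $\mathrm{frac}(x)=x-\lfloor x\rfloor$. For a complete normed Abelian group $G$: $\mathscr{P}_k^G(K)$ is the group of polyhedral chains, i.e. finite formal sums $P=\sum_{\ell=1}^N g_\ell\llbracket\sigma_\ell\rrbracket$, with $g_\ell\in G$ and $\sigma_\ell\subset K$ non-overlapping oriented $k$-simplexes, identified when they have a common refinement (reversing orientation changes $g_\ell$ to $-g_\ell$). Mass: $\mathbb{M}(P)=\sum_\ell\|g_\ell\|\mathcal{H}^k(\sigma_\ell)$. Boundary: $\partial P=\sum_\ell g_\ell\,\partial\llbracket\sigma_\ell\rrbracket$. Flat norm: $\mathbb{F}(P)=\inf\{\mathbb{M}(Q)+\mathbb{M}(P-\partial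 Q): Q\in\mathscr{P}_{k+1}^G(K)\}$. $\mathscr{F}_k^G(K)$ (flat chains) is the $\mathbb{F}$-completion of $\mathscr{P}_k^G(K)$; mass extends by relaxation, $\mathbb{M}(T)=\inf\{\liminf_n\mathbb{M}(P_n): P_n\in\mathscr{P}_k^G(K),\ \mathbb{F}(P_n-T)\to0\}$. Induced map: on polyhedral chains $\pi(\sum_i\tilde g_i\llbracket\sigma_i\rrbracket):=\sum_i\phi(\tilde g_i)\llbracket\sigma_i\rrbracket$; it is Lipschitz for the flat norms and extends by continuity to $\pi:\mathscr{F}_k^{\mathbb{R}}(K)\to\mathscr{F}_k^{\mathbb{S}^1}(K)$. *)

(* Defs.v *)
From HB Require Import structures.
From mathcomp Require Import all_boot all_order all_algebra perm generic_quotient ring_quotient.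
From mathcomp Require Import all_classical all_reals all_analysis.
From mathcomp Require Import lra.

Set Implicit Arguments.
Unset Strict Implicit.
Unset Printing Implicit Defensive.

Import Order.TTheory GRing.Theory Num.Theory numFieldNormedType.Exports.

Local Open Scope classical_set_scope.
Local Open Scope ring_scope.

(* MathComp's [normedZmodType] requires |x *+ n| = |x| *+ n, which fails in
   R/Z, hence this weaker structure. *)
Record normedAbGroup (R : realType) := NormedAbGroup {
  ng_sort :> zmodType;
  ngnorm : ng_sort -> R;
  ngnorm_eq0 : forall x, ngnorm x = 0 -> x = 0;
  ngnorm0 : ngnorm 0 = 0;
  ngnormN : forall x, ngnorm (- x) = ngnorm x;
  ngnormD : forall x y, ngnorm (x + y) <= ngnorm x + ngnorm y }.

Definition realNG (R : realType) : normedAbGroup R :=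
  @NormedAbGroup R R (fun x : R => `|x|) (@normr0_eq0 _ _) (@normr0 _ _)
    (@normrN _ _) (@ler_normD _ _).

Section Circle.
Context {R : realType}.

Definition frac (x : R) : R := x - (Num.floor x)%:~R.

Definition dist_int (x : R) : R := Num.min (frac x) (1 - frac x).

Lemma dist_int_le (x : R) (m : int) : dist_int x <= `|x - m%:~R|.
Proof.
have /andP[f1 f2] := floor_itv x; rewrite intrD in f2.
rewrite /dist_int /frac.
have [mx|xm] := leP m (Num.floor x).
  have : m%:~R <= (Num.floor x)%:~R :> R by rewrite ler_int.
  move=> h; rewrite ge_min ger0_norm; last by lra.
  by apply/orP; left; lra.
have : (Num.floor x + 1)%:~R <= m%:~R :> R by rewrite ler_int lezD1.
rewrite intrD => h; rewrite ge_min ler0_norm; last by lra.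
by apply/orP; right; lra.
Qed.

Lemma dist_int_attained (x : R) : exists m : int, dist_int x = `|x - m%:~R|.
Proof.
have /andP[f1 f2] := floor_itv x; rewrite intrD in f2.
rewrite /dist_int /frac minElt; case: ifP => _.
  by exists (Num.floor x); rewrite ger0_norm //; lra.
by exists (Num.floor x + 1); rewrite intrD ler0_norm; lra.
Qed.

Lemma dist_intD (x y : R) : dist_int (x + y) <= dist_int x + dist_int y.
Proof.
have [m ->] := dist_int_attained x; have [p ->] := dist_int_attained y.
apply: le_trans (dist_int_le _ (m + p)) _.
by rewrite intrD opprD addrACA ler_normD.
Qed.

Lemma dist_int_int (x : R) : x \is a Num.int -> dist_int x = 0.
Proof.
rewrite intrEfloor => /eqP xi; rewrite /dist_int /frac xi subrr.
by rewrite minElt subr0 ltr01.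
Qed.

Lemma dist_intN (x : R) : dist_int (- x) = dist_int x.
Proof.
apply/eqP; rewrite eq_le; apply/andP; split.
  have [m ->] := dist_int_attained x.
  by apply: le_trans (dist_int_le _ (- m)) _; rewrite intrN -opprD normrN.
have [m ->] := dist_int_attained (- x).
apply: le_trans (dist_int_le _ (- m)) _.
by rewrite -[leRHS]normrN intrN opprD !opprK.
Qed.

End Circle.

Definition int_subgroup (R : realType) : zmodClosed R :=
  GRing.ZmodClosed.clone R (@Num.int_num_subdef R) _.

Definition circle (R : realType) : zmodType := Quotient.quot (int_subgroup R).

Definition circle_proj {R : realType} : {additive R -> circle R} :=
  \pi_(Quotient.quot (int_subgroup R))%qT.

Definition circle_norm {R : realType} (g : circle R) : R :=
  dist_int (repr (g : Quotient.quot (int_subgroup R))).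

Lemma circle_projE (R : realType) (x y : R) :
  circle_proj x = circle_proj y <-> x - y \is a Num.int.
Proof.
split=> [/eqP|h]; first by rewrite /circle_proj -Quotient.idealrBE.
by apply/eqP; rewrite -Quotient.idealrBE.
Qed.

Lemma circle_normE (R : realType) (x : R) :
  circle_norm (circle_proj x) = Num.min (frac x) (1 - frac x).
Proof.
have h : repr (circle_proj x : Quotient.quot (int_subgroup R)) - x \is a Num.int.
  by apply/circle_projE; exact: reprK.
rewrite -/(dist_int x) /circle_norm; move: (repr _) h => y h.
apply/eqP; rewrite eq_le; apply/andP; split.
  have := dist_intD (y - x) x.
  by rewrite subrK (dist_int_int h) add0r.
have := dist_intD (x - y) y.
by rewrite subrK -opprB dist_intN (dist_int_int h) add0r.
Qed.

Lemma circle_surj (R : realType) (g : circle R) : exists x : R, g = circle_proj x.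
Proof.
exists (repr (g : Quotient.quot (int_subgroup R))); apply: esym; exact: reprK.
Qed.

Lemma circle_norm_eq0 (R : realType) (g : circle R) : circle_norm g = 0 -> g = 0.
Proof.
have [x ->] := circle_surj g; rewrite circle_normE -/(dist_int x).
have [m ->] := dist_int_attained x => /normr0_eq0 /eqP; rewrite subr_eq0 => /eqP xm.
by rewrite -[RHS](raddf0 circle_proj); apply/circle_projE; rewrite subr0 xm intr_int.
Qed.

Lemma circle_norm0 (R : realType) : circle_norm (0 : circle R) = 0.
Proof. by rewrite -(raddf0 circle_proj) circle_normE -/(dist_int 0) dist_int_int. Qed.

Lemma circle_normN (R : realType) (g : circle R) : circle_norm (- g) = circle_norm g.
Proof.
have [x ->] := circle_surj g.
by rewrite -raddfN !circle_normE; exact: dist_intN.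
Qed.

Lemma circle_normD (R : realType) (g h : circle R) :
  circle_norm (g + h) <= circle_norm g + circle_norm h.
Proof.
have [x ->] := circle_surj g; have [y ->] := circle_surj h.
by rewrite -raddfD !circle_normE; exact: dist_intD.
Qed.

Definition circleNG (R : realType) : normedAbGroup R :=
  @NormedAbGroup R (circle R) circle_norm (@circle_norm_eq0 R) (@circle_norm0 R)
    (@circle_normN R) (@circle_normD R).

Lemma circle_norm_proj_le (R : realType) (x : R) : circle_norm (circle_proj x) <= `|x|.
Proof.
by rewrite circle_normE; apply: le_trans (dist_int_le x 0) _; rewrite subr0.
Qed.

(* The norm that MathComp-Analysis puts on ['rV_n] is the sup norm. *)
Definition enorm (R : realType) (n : nat) (x : 'rV[R]_n) : R :=
  Num.sqrt (\sum_i x 0 i ^+ 2).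

(* Lebesgue measure of the unit ball of R^k, by the recursion
   omega_(k+2) = 2 pi / (k+2) * omega_k *)
Fixpoint unit_ball_volume (R : realType) (k : nat) : R :=
  match k with
  | 0 => 1
  | 1 => 2
  | k'.+2 => 2 * pi / k'.+2%:R * unit_ball_volume R k'
  end.

Section Hausdorff.
Context {R : realType} {n : nat}.
Implicit Types A : set 'rV[R]_n.

(* only meaningful for bounded sets, as is the case in [hausdorff_pre] *)
Definition diam A : R := sup [set enorm (p.1 - p.2) | p in A `*` A].

Definition diam_weight (k : nat) A : \bar R :=
  if A == set0 then 0%E else (unit_ball_volume R k * (diam A / 2) ^+ k)%:E.

Definition hausdorff_pre (k : nat) (delta : R) A : \bar R :=
  ereal_inf [set (\sum_(0 <= i <oo) diam_weight k (F i))%E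
    | F in [set F : (set 'rV[R]_n)^nat | A `<=` \bigcup_i F i /\
        forall i x y, F i x -> F i y -> enorm (x - y) <= delta]].

Definition hausdorff (k : nat) A : \bar R :=
  ereal_sup [set hausdorff_pre k delta A | delta in [set delta : R | 0 < delta]].

Lemma hausdorff_ge0 k A : (0 <= hausdorff k A)%E.
Proof.
have vol_ge0 m : 0 <= unit_ball_volume R m /\ 0 <= unit_ball_volume R m.+1.
  elim: m => [|m [v0 v1]]; first by split; rewrite ?ler01 ?ler0n.
  by split => //=; rewrite !mulr_ge0 // ?invr_ge0 ?ler0n ?pi_ge0.
have diam_ge0 B : 0 <= diam B.
  have [[r ar]|a0] := pselect (exists r, [set enorm (p.1 - p.2) | p in B `*` B] r).
    have [b|nb] := pselect (has_ubound [set enorm (p.1 - p.2) | p in B `*` B]).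
      apply: le_trans (ub_le_sup b ar).
      by case: ar => p _ <-; exact: sqrtr_ge0.
    by rewrite /diam sup_out // => -[].
  by rewrite /diam sup_out // => -[[r ar] _]; apply: a0; exists r.
apply: (@le_trans _ _ (hausdorff_pre k 1 A)); last first.
  by apply: ereal_sup_ubound; exists 1 => //=; exact: ltr01.
apply: le_ereal_inf_tmp => _ [F _ <-]; apply: nneseries_ge0 => i _ _.
rewrite /diam_weight; case: ifP => // _.
by rewrite lee_fin mulr_ge0 ?(vol_ge0 k).1 // exprn_ge0 // divr_ge0.
Qed.

End Hausdorff.

Section Simplex.
Context {R : realType} {n : nat}.

(* The vertices of a k-simplex are the k+1 rows of a matrix, in the order that
   defines the orientation. *)
Definition affinely_independent (k : nat) (V : 'M[R]_(k.+1, n)) : Prop :=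
  forall t : 'rV[R]_k.+1, \sum_i t 0 i = 0 -> t *m V = 0 -> t = 0.

Definition conv_hull (k : nat) (V : 'M[R]_(k.+1, n)) : set 'rV[R]_n :=
  [set t *m V | t in
     [set t : 'rV[R]_k.+1 | (forall i, 0 <= t 0 i) /\ \sum_i t 0 i = 1]].

Definition open_hull (k : nat) (V : 'M[R]_(k.+1, n)) : set 'rV[R]_n :=
  [set t *m V | t in
     [set t : 'rV[R]_k.+1 | (forall i, 0 < t 0 i) /\ \sum_i t 0 i = 1]].

Record simplex (K : set 'rV[R]_n) (k : nat) := Simplex {
  vertices : 'M[R]_(k.+1, n);
  vertices_indep : affinely_independent vertices;
  vertices_sub : conv_hull vertices `<=` K }.

HB.instance Definition _ K k := gen_eqMixin (simplex K k).
HB.instance Definition _ K k := gen_choiceMixin (simplex K k).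

Definition support K k (s : simplex K k) : set 'rV[R]_n := conv_hull (vertices s).

Definition relint K k (s : simplex K k) : set 'rV[R]_n := open_hull (vertices s).

Definition nonoverlapping K k (l : seq (simplex K k)) : bool :=
  pairwise (fun s t => `[< relint s `&` relint t = set0 >]) l.

(* [t] lies in the affine span of [s], with the orientation of [s]: the rows of
   [B] are the barycentric coordinates of the vertices of [t]. *)
Definition cooriented K k (t s : simplex K k) : Prop :=
  exists B : 'M[R]_k.+1,
    [/\ forall i, \sum_j B i j = 1, vertices t = B *m vertices s & 0 < \det B].

Definition subdivides K k (l : seq (simplex K k)) (s : simplex K k) : Prop :=
  [/\ nonoverlapping l,
      forall t, t \in l -> cooriented t s
    & support s = \bigcup_(t in [set` l]) support t].

Lemma sum_lift0 k (i : 'I_k.+2) (t : 'rV[R]_k.+1) (f : 'I_k.+2 -> R) :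
  \sum_j odflt 0 (omap (fun h => t 0 h) (unlift i j)) * f j
  = \sum_j t 0 j * f (lift i j).
Proof.
rewrite (bigD1_ord i) //= unlift_none mul0r add0r.
by apply: eq_bigr => j _; rewrite liftK.
Qed.

Definition extend0 k (i : 'I_k.+2) (t : 'rV[R]_k.+1) : 'rV[R]_k.+2 :=
  \row_j odflt 0 (omap (fun h => t 0 h) (unlift i j)).

Lemma sum_extend0 k (i : 'I_k.+2) (t : 'rV[R]_k.+1) :
  \sum_j extend0 i t 0 j = \sum_j t 0 j.
Proof.
have := sum_lift0 i t (fun=> 1).
under eq_bigr do rewrite mulr1.
under [X in _ = X -> _]eq_bigr do rewrite mulr1.
by move=> <-; apply: eq_bigr => j _; rewrite mxE.
Qed.

Lemma mul_extend0 k (i : 'I_k.+2) (t : 'rV[R]_k.+1) (V : 'M[R]_(k.+2, n)) :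
  extend0 i t *m V = t *m row' i V.
Proof.
apply/rowP => j; rewrite !mxE.
under eq_bigr do rewrite mxE.
by rewrite sum_lift0; apply: eq_bigr => h _; rewrite !mxE.
Qed.

Lemma face_indep k (i : 'I_k.+2) (V : 'M[R]_(k.+2, n)) :
  affinely_independent V -> affinely_independent (row' i V : 'M[R]_(k.+1, n)).
Proof.
move=> Vi t t0 tV; have : extend0 i t = 0.
  by apply: Vi; rewrite ?sum_extend0 ?mul_extend0.
move=> /rowP e; apply/rowP => j; have := e (lift i j).
by rewrite !mxE liftK.
Qed.

Lemma face_sub k (i : 'I_k.+2) (V : 'M[R]_(k.+2, n)) :
  conv_hull (row' i V : 'M[R]_(k.+1, n)) `<=` conv_hull V.
Proof.
move=> _ [t [t0 t1] <-]; exists (extend0 i t); last exact: mul_extend0.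
split; last by rewrite sum_extend0.
by move=> j; rewrite mxE; case: unliftP => //= h _; exact: t0.
Qed.

Definition face K k (i : 'I_k.+2) (s : simplex K k.+1) : simplex K k :=
  @Simplex K k (row' i (vertices s)) (@face_indep _ i _ (@vertices_indep _ _ s))
    (subset_trans (@face_sub _ i _) (@vertices_sub _ _ s)).

End Simplex.

(* Formal sums, as lists of terms. They are compared with [chain_eq] below, never
   with [=]; the simplexes of a list may overlap, so that sums and boundaries
   are directly defined. *)
Definition formal_sum (R : realType) (n : nat) (K : set 'rV[R]_n)
  (G : zmodType) (k : nat) : Type := seq (G * simplex K k).

Section Chain.
Context {R : realType} {n : nat} {K : set 'rV[R]_n} {G : zmodType}.

Definition chain_opp k (P : formal_sum K G k) : formal_sum K G k :=
  [seq (- p.1, p.2) | p <- P].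

Definition chain_sub k (P Q : formal_sum K G k) : formal_sum K G k :=
  P ++ chain_opp Q.

Definition boundary k (P : formal_sum K G k.+1) : formal_sum K G k :=
  flatten [seq [seq ((if odd i then - p.1 else p.1), face i p.2)
                   | i : 'I_k.+2 <- enum 'I_k.+2] | p <- P].

(* Equality of polyhedral chains: the congruence on formal sums generated by
   reversal of orientation and refinement. Two sums of non-overlapping
   simplexes are thus identified iff, up to terms with coefficient 0 and to
   orientations, they have a common refinement. *)
Inductive chain_eq k : formal_sum K G k -> formal_sum K G k -> Prop :=
| chain_eq_refl P : chain_eq P P
| chain_eq_sym P Q : chain_eq P Q -> chain_eq Q P
| chain_eq_trans P Q S : chain_eq P Q -> chain_eq Q S -> chain_eq P S
| chain_eq_cat P P' Q Q' :
    chain_eq P P' -> chain_eq Q Q' -> chain_eq (P ++ Q) (P' ++ Q')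
| chain_eq_catC P Q : chain_eq (P ++ Q) (Q ++ P)
| chain_eq_zero s : chain_eq [:: (0, s)] [::]
| chain_eq_add g h s : chain_eq [:: (g, s); (h, s)] [:: (g + h, s)]
| chain_eq_orient g s t (u : 'S_k.+1) :
    vertices t = row_perm u (vertices s) ->
    chain_eq [:: (g, s)] [:: ((if odd_perm u then - g else g), t)]
| chain_eq_subdivide g s l :
    subdivides l s -> chain_eq [:: (g, s)] [seq (g, t) | t <- l].

Lemma chain_sub_self k (P : formal_sum K G k) : chain_eq (chain_sub P P) [::].
Proof.
rewrite /chain_sub; elim: P => [|[g s] P IH]; first exact: chain_eq_refl.
have -> : ((g, s) :: P) ++ chain_opp ((g, s) :: P)
        = [:: (g, s)] ++ (P ++ ([:: (- g, s)] ++ chain_opp P)) by [].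
apply: (@chain_eq_trans _ _ ([:: (g, s)] ++ ([:: (- g, s)] ++ (P ++ chain_opp P)))).
  apply: chain_eq_cat; first exact: chain_eq_refl.
  by rewrite !catA; apply: chain_eq_cat; [exact: chain_eq_catC|exact: chain_eq_refl].
rewrite catA -[X in chain_eq _ X]cats0; apply: chain_eq_cat => //.
apply: (chain_eq_trans (chain_eq_add _ _ _)); rewrite subrr.
exact: chain_eq_zero.
Qed.

End Chain.

Section Flat.
Context {R : realType} {n : nat} {K : set 'rV[R]_n} {G : normedAbGroup R}.
Local Open Scope ereal_scope.

(* The sum does not depend on the non-overlapping representative [Q]. *)
Definition mass k (P : formal_sum K G k) : \bar R :=
  ereal_inf [set \sum_(q <- Q) (ngnorm q.1)%:E * hausdorff k (support q.2)
    | Q in [set Q | chain_eq P Q /\ nonoverlapping (map snd Q)]].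

Definition flat_norm k (P : formal_sum K G k) : \bar R :=
  ereal_inf [set mass Q + mass (chain_sub P (boundary Q))
    | Q in [set: formal_sum K G k.+1]].

Lemma flat_norm_null k (P : formal_sum K G k) : chain_eq P [::] -> flat_norm P <= 0.
Proof.
have mass_null j (Q : formal_sum K G j) : chain_eq Q [::] -> mass Q <= 0.
  move=> Q0; apply: (@le_trans _ _ (\sum_(q <- ([::] : formal_sum K G j))
      (ngnorm q.1)%:E * hausdorff j (support q.2))); last by rewrite big_nil.
  by apply: ereal_inf_lbound; exists [::].
move=> P0; apply: (@le_trans _ _ (mass ([::] : formal_sum K G k.+1)
    + mass (chain_sub P (boundary [::])))).
  by apply: ereal_inf_lbound; exists [::].
apply: adde_le0; apply: mass_null; first exact: chain_eq_refl.
by rewrite /chain_sub cats0.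
Qed.

(* The completion: Cauchy sequences of polyhedral chains, with equality
   [flat_eq] below. *)
Record flat_chain k := FlatChain {
  approx :> nat -> formal_sum K G k;
  approx_cauchy : forall e : R, (0 < e)%R -> exists N : nat, forall i j : nat,
    (N <= i)%N -> (N <= j)%N -> flat_norm (chain_sub (approx i) (approx j)) < e%:E }.

(* F(S - T); the sequence converges, by the triangle inequality. *)
Definition flat_dist k (S T : flat_chain k) : \bar R :=
  limn_esup (fun i => flat_norm (chain_sub (S i) (T i))).

Definition flat_eq k (S T : flat_chain k) : Prop := flat_dist S T = 0.

Definition flat_of_polyhedral k (P : formal_sum K G k) : flat_chain k.
Proof.
exists (fun=> P) => e e0; exists 0%N => _ _ _ _.
by apply: (le_lt_trans (flat_norm_null (chain_sub_self P))); rewrite lte_fin.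
Defined.

Definition flat_mass k (T : flat_chain k) : \bar R :=
  ereal_inf [set limn_einf (fun m => mass (P m))
    | P in [set P : nat -> formal_sum K G k |
        flat_dist (flat_of_polyhedral (P m)) T @[m --> \oo] --> 0]].

End Flat.

Section Induced.
Context {R : realType} {n : nat} {K : set 'rV[R]_n}.
Local Notation rsum := (formal_sum K (realNG R)).
Local Notation csum := (formal_sum K (circleNG R)).

Definition proj_sum k (P : rsum k) : csum k :=
  [seq (circle_proj (p.1 : R) : circleNG R, p.2) | p <- P].

Lemma proj_chain_eq k (P Q : rsum k) :
  chain_eq P Q -> chain_eq (proj_sum P) (proj_sum Q).
Proof.
elim=> {P Q}.
- by move=> P; exact: chain_eq_refl.
- by move=> P Q _; exact: chain_eq_sym.
- by move=> P Q S _ + _; exact: chain_eq_trans.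
- by move=> P P' Q Q' _ h _ h'; rewrite /proj_sum !map_cat; exact: chain_eq_cat.
- by move=> P Q; rewrite /proj_sum !map_cat; exact: chain_eq_catC.
- by move=> s /=; rewrite raddf0; exact: chain_eq_zero.
- by move=> g h s /=; rewrite raddfD; exact: chain_eq_add.
- move=> g s t u e /=; rewrite (fun_if circle_proj) raddfN.
  exact: chain_eq_orient.
- by move=> g s l h /=; rewrite /proj_sum -map_comp; exact: chain_eq_subdivide.
Qed.

Lemma proj_sub k (P Q : rsum k) :
  proj_sum (chain_sub P Q) = chain_sub (proj_sum P) (proj_sum Q).
Proof.
rewrite /proj_sum /chain_sub /chain_opp map_cat -!map_comp; congr (_ ++ _).
by apply: eq_map => p /=; rewrite raddfN.
Qed.

Lemma proj_boundary k (P : rsum k.+1) :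
  proj_sum (boundary P) = boundary (proj_sum P).
Proof.
rewrite /proj_sum /boundary map_flatten -!map_comp; congr flatten.
apply: eq_map => p /=; rewrite -map_comp; apply: eq_map => i /=.
by rewrite (fun_if circle_proj) raddfN.
Qed.

Local Open Scope ereal_scope.

Lemma mass_proj k (P : rsum k) : mass (proj_sum P) <= mass P.
Proof.
apply: le_ereal_inf_tmp => _ [Q [PQ nQ] <-].
apply: (@le_trans _ _ (\sum_(q <- proj_sum Q) (ngnorm q.1)%:E * hausdorff k (support q.2))).
  apply: ereal_inf_lbound; exists (proj_sum Q) => //; split.
    exact: proj_chain_eq.
  by rewrite -map_comp.
rewrite big_map; apply: lee_sum => q _ /=; apply: lee_wpmul2r.
  exact: hausdorff_ge0.
by rewrite lee_fin; exact: circle_norm_proj_le.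
Qed.

Lemma flat_norm_proj k (P : rsum k) : flat_norm (proj_sum P) <= flat_norm P.
Proof.
apply: le_ereal_inf_tmp => _ [Q _ <-].
apply: (@le_trans _ _ (mass (proj_sum Q) + mass (chain_sub (proj_sum P) (boundary (proj_sum Q))))).
  by apply: ereal_inf_lbound; exists (proj_sum Q).
by rewrite leeD ?mass_proj// -proj_boundary -proj_sub mass_proj.
Qed.

(* The induced map on flat chains: the continuous extension of [proj_sum] is
   computed termwise on Cauchy sequences. *)
Definition flat_proj k (T : flat_chain (K := K) (G := realNG R) k) :
  flat_chain (K := K) (G := circleNG R) k.
Proof.
exists (fun i => proj_sum (T i)) => e e0.
have [N hN] := approx_cauchy T e0; exists N => i j Ni Nj.
by rewrite -proj_sub (le_lt_trans (flat_norm_proj _)) ?hN.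
Defined.

Lemma flat_dist_proj k (S T : flat_chain (K := K) (G := realNG R) k) :
  flat_dist (flat_proj S) (flat_proj T) <= flat_dist S T.
Proof.
rewrite /flat_dist !limn_esup_lim; apply: lee_lim; [exact: is_cvg_esups..|].
near=> m; apply: ge_ereal_sup => _ [i mi <-]; apply: le_ereal_sup_tmp.
exists (flat_norm (chain_sub (S i) (T i))); first by exists i.
by rewrite /= -proj_sub flat_norm_proj.
Unshelve. all: by end_near. Qed.

End Induced.

(* Main.v *)
(* The lift is obtained from a sequence of polyhedral chains [P m] -> [T] with
   bounded mass and [P m - P m.+1 = boundary (Q m) + S m], where the masses of
   [Q m] and [S m] decay geometrically. The top-dimensional chain
   [W m = Q 0 + ... + Q m.-1] is a circle-valued function, and
   [boundary (W m) = P 0 - P m - (S 0 + ... + S m.-1)] has bounded mass. Lifting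
   [W m] through the representatives in [th - 1, th) turns a jump of size
   [delta] in R/Z into a jump whose average over the cut [th] is at most
   [2 delta], as in the lifting of BV functions by Davila and Ignat. By Fatou's
   lemma one cut works for infinitely many [m] at once: it keeps the mass of the
   boundary of the lift of [W m] bounded and makes the lifts converge. The lift
   of [T] is the limit of [P 0 - boundary (W m) - (S 0 + ... + S m.-1)], computed
   with these lifts of [W m] and the shortest lifts of [P 0] and [S i].

   Equality of polyhedral chains is handled through multiplicities at generic
   points, which determine a chain because any finite family of simplexes has a
   common non-overlapping refinement. The multiplicity of a boundary is the
   difference of the multiplicities on the two sides of the hyperplane, so that
   [boundary] respects equality of chains and the mass of a boundary is
   controlled by the jumps. *)
From Pilot Require Import Defs.
From mathcomp Require Import all_boot all_order all_algebra perm.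
From mathcomp Require Import all_classical all_reals all_analysis.
From mathcomp Require Import measurable_realfun ring lra.
Import Order.TTheory GRing.Theory Num.Theory Pilot.Defs.
Import numFieldNormedType.Exports.

Set Implicit Arguments.
Unset Strict Implicit.
Unset Printing Implicit Defensive.

Local Open Scope classical_set_scope.
Local Open Scope ring_scope.

(** The shortest lifts of the [P m] have bounded mass but need not converge: lifting is not
    additive, so a filling of [P m - P m.+1] over R/Z says nothing about the difference of the
    lifts. Fillings are lifted instead. They have the dimension of the space, hence are functions,
    which can be composed with any section of R -> R/Z that vanishes at 0, with no compatibility to
    check. The section by shortest representatives would not do: a tiny jump across 1/2 becomes a
    jump of almost 1. For two circle values at distance delta, the bad cuts form an arc of length
    delta and add at most 1 to the jump; this gives the factor 2. The cut must be the same for all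
    [m], since convergence compares the lifts of [W m] and [W m.+1]. But Fatou's lemma controls only
    infinitely many [m], and these depend on the cut. So the list handled at stage [m] also contains
    the jumps of all earlier steps [l < m], with weight 2^l: one bound at some late stage then
    bounds step [l] by a multiple of 2^-l, for every [l]. *)

Lemma free_eqmx (F : fieldType) k m (M N : 'M[F]_(k, m)) :
  row_free M -> (M <= N)%MS -> (N <= M)%MS.
Proof.
by move=> Mf MN; rewrite -(geq_leqif (mxrank_leqif_sup MN)) (eqP Mf) rank_leq_row.
Qed.

Lemma perm_mx_sum (F : pzSemiRingType) k (u : 'S_k) i : \sum_j perm_mx u i j = 1 :> F.
Proof.
rewrite (bigD1 (u i)) //= !mxE eqxx big1 ?addr0 // => j.
by rewrite !mxE eq_sym => /negbTE ->.
Qed.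

(** * Homogeneous coordinates and hulls *)

Section HomogeneousCoordinates.
Context {R : realType} {n : nat}.
Implicit Types (c : 'cV[R]_(1 + n)) (x y : 'rV[R]_n).

(** A leading 1 turns affine notions into linear ones: affine independence is [row_free], membership
    in the affine span is inclusion of row spaces, barycentric coordinates are coefficients, and
    orientation is the sign of a determinant. *)
Definition homog k (V : 'M[R]_(k, n)) : 'M[R]_(k, 1 + n) := row_mx (const_mx 1) V.

Lemma homog_mul k m (B : 'M[R]_(m, k)) (V : 'M[R]_(k, n)) :
  (forall i, \sum_j B i j = 1) -> homog (B *m V) = B *m homog V.
Proof.
move=> B1; rewrite /homog mul_mx_row; congr row_mx.
apply/matrixP => i j; rewrite !mxE.
by under eq_bigr do rewrite mxE mulr1.
Qed.

Lemma homogE k m (B : 'M[R]_(m, k)) (V : 'M[R]_(k, n)) (W : 'M[R]_(m, n)) :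
  homog W = B *m homog V <-> (forall i, \sum_j B i j = 1) /\ W = B *m V.
Proof.
split=> [|[B1 ->]]; last exact: homog_mul.
rewrite /homog mul_mx_row => /eq_row_mx[B1 ->]; split=> // i.
have /matrixP/(_ i 0) := B1; rewrite !mxE => ->.
by apply: eq_bigr => l _; rewrite mxE mulr1.
Qed.

Lemma row_homog k (V : 'M[R]_(k, n)) i : row i (homog V) = homog (row i V).
Proof. by rewrite /homog row_row_mx; congr row_mx; apply/matrixP=> a b; rewrite !mxE. Qed.

Lemma row'_homog k (V : 'M[R]_(k, n)) i : row' i (homog V) = homog (row' i V).
Proof. by rewrite /homog row'_row_mx; congr row_mx; apply/matrixP=> a b; rewrite !mxE. Qed.

Lemma affinely_independentP k (V : 'M[R]_(k.+1, n)) :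
  affinely_independent V <-> row_free (homog V).
Proof.
have e (t : 'rV[R]_k.+1) : t *m homog V = 0 <-> \sum_i t 0 i = 0 /\ t *m V = 0.
  rewrite /homog mul_mx_row -[0 in X in X <-> _]row_mx0; split=> [/eq_row_mx[h ->]|[t1 ->]].
    split=> //; have /matrixP/(_ 0 0) := h; rewrite !mxE => h0.
    by rewrite -[RHS]h0; under [RHS]eq_bigr do rewrite mxE mulr1.
  congr row_mx; apply/matrixP=> i j; rewrite !mxE ord1.
  by under eq_bigr do rewrite mxE mulr1.
split=> [Vi|Vf t t0 tV]; first by apply: inj_row_free => t /e[]; exact: Vi.
by apply/eqP; rewrite -(mulmx_free_eq0 _ Vf); apply/eqP/e.
Qed.

(** A column [c] stands for an affine function, its constant term first; the hyperplanes and
    half-spaces below are given by such columns. *)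
Definition ev c x : R := (homog x *m c) 0 0.

Lemma ev_comb c (a : R) x y : ev c ((1 - a) *: x + a *: y) = (1 - a) * ev c x + a * ev c y.
Proof.
have -> : (1 - a) *: x + a *: y = row_mx (1 - a)%:M a%:M *m col_mx x y.
  by rewrite mul_row_col !mul_scalar_mx.
rewrite /ev homog_mul; last first.
  by move=> i; rewrite big_split_ord /= !big_ord1 row_mxEl row_mxEr !ord1 !mxE !eqxx subrK.
rewrite -mulmxA.
have -> : homog (col_mx x y) = col_mx (homog x) (homog y).
  by rewrite /homog -col_mx_const -block_mxEh block_mxEv.
by rewrite mul_col_mx mul_row_col !mul_scalar_mx !mxE.
Qed.

Lemma ev_add c x (e : R) (v : 'rV[R]_n) :
  ev c (x + e *: v) = ev c x + e * (row_mx 0 v *m c) 0 0.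
Proof.
rewrite /ev; have -> : homog (x + e *: v) = homog x + e *: row_mx 0 v.
  by rewrite /homog scale_row_mx scaler0 add_row_mx addr0.
by rewrite mulmxDl -scalemxAl !mxE.
Qed.

Lemma ev_row k (V : 'M[R]_(k, n)) c i : ev c (row i V) = (homog V *m c) i 0.
Proof. by rewrite /ev -row_homog -row_mul mxE. Qed.

Definition aff_span k (V : 'M[R]_(k, n)) : set 'rV[R]_n := [set x | (homog x <= homog V)%MS].

(** Barycentric coordinates when [homog V] is free and [x] is in the affine span; elsewhere the
    value is an artefact of [pinvmx]. *)
Definition bary k (V : 'M[R]_(k, n)) x : 'rV[R]_k := homog x *m pinvmx (homog V).

(** For free [homog V], an affine function that is 1 at vertex [i] and vanishes on the opposite
    facet. *)
Definition facet_form k (V : 'M[R]_(k, n)) i : 'cV[R]_(1 + n) := col i (pinvmx (homog V)).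

Lemma ev_facet k (V : 'M[R]_(k, n)) i x : ev (facet_form V i) x = bary V x 0 i.
Proof. by rewrite /ev /bary /facet_form colE mulmxA -colE mxE. Qed.

Lemma bary_sum k (V : 'M[R]_(k, n)) x : aff_span V x ->
  bary V x *m V = x /\ \sum_i bary V x 0 i = 1.
Proof.
move=> /mulmxKpV /esym /homogE [s1 sV]; split; first by rewrite -sV.
exact: s1.
Qed.

Lemma bary_comb k (V : 'M[R]_(k, n)) (t : 'rV[R]_k) : row_free (homog V) ->
  \sum_i t 0 i = 1 -> bary V (t *m V) = t /\ aff_span V (t *m V).
Proof.
move=> Vf t1; have e : homog (t *m V) = t *m homog V.
  by apply: homog_mul => i; rewrite ord1.
by rewrite /bary /aff_span /= e mulmxKp // submxMl.
Qed.

Lemma conv_hullP k (V : 'M[R]_(k.+1, n)) x : row_free (homog V) ->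
  conv_hull V x <-> aff_span V x /\ forall i, 0 <= bary V x 0 i.
Proof.
move=> Vf; split=> [[t [t0 t1] <-]|[xV x0]].
  by have [-> ?] := bary_comb Vf t1.
by have [xE x1] := bary_sum xV; exists (bary V x).
Qed.

Lemma open_hullP k (V : 'M[R]_(k.+1, n)) x : row_free (homog V) ->
  open_hull V x <-> aff_span V x /\ forall i, 0 < bary V x 0 i.
Proof.
move=> Vf; split=> [[t [t0 t1] <-]|[xV x0]].
  by have [-> ?] := bary_comb Vf t1.
by have [xE x1] := bary_sum xV; exists (bary V x).
Qed.

Lemma conv_hull_row k (V : 'M[R]_(k.+1, n)) i : conv_hull V (row i V).
Proof.
exists (delta_mx 0 i); last by rewrite -rowE.
split=> [j|]; first by rewrite mxE; case: andP.
rewrite (bigD1 i) //= mxE !eqxx big1 ?addr0 // => j ji.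
by rewrite mxE (negbTE ji) andbF.
Qed.

Lemma open_hull_conv k (V : 'M[R]_(k.+1, n)) : open_hull V `<=` conv_hull V.
Proof. by move=> x [t [t0 t1] <-]; exists t => //; split=> // i; exact: ltW. Qed.

Lemma conv_hull_subP k m (W : 'M[R]_(m.+1, n)) (V : 'M[R]_(k.+1, n)) :
  conv_hull W `<=` conv_hull V <->
  exists B : 'M[R]_(m.+1, k.+1),
    [/\ forall i j, 0 <= B i j, forall i, \sum_j B i j = 1 & W = B *m V].
Proof.
split=> [WV|[B [B0 B1 ->]] x [t [t0 t1] <-]].
  have /choice[f fP] : forall i, exists t : 'rV[R]_k.+1,
      [/\ forall j, 0 <= t 0 j, \sum_j t 0 j = 1 & t *m V = row i W].
    by move=> i; have [t [t0 t1] tE] := WV _ (conv_hull_row W i); exists t.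
  exists (\matrix_i f i); split=> [i j|i|].
  - by rewrite mxE; case: (fP i).
  - by under eq_bigr do rewrite mxE; case: (fP i).
  - by apply/row_matrixP => i; rewrite row_mul rowK; case: (fP i).
exists (t *m B); last by rewrite mulmxA.
split=> [j|]; first by rewrite mxE sumr_ge0 // => i _; rewrite mulr_ge0.
under eq_bigr do rewrite mxE; rewrite exchange_big /= -[RHS]t1.
by apply: eq_bigr => i _; rewrite -mulr_sumr B1 mulr1.
Qed.

Lemma conv_hull_row_perm k (u : 'S_k.+1) (V : 'M[R]_(k.+1, n)) :
  conv_hull (row_perm u V) = conv_hull V.
Proof.
rewrite row_permE; apply/seteqP; split; apply/conv_hull_subP.
  by exists (perm_mx u); split=> // [i j|i]; [rewrite !mxE ler0n|exact: perm_mx_sum].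
exists (perm_mx u^-1); split=> // [i j|i|]; first by rewrite !mxE ler0n.
  exact: perm_mx_sum.
by rewrite mulmxA -perm_mxM mulVg perm_mx1 mul1mx.
Qed.

Lemma homog_row_perm k (u : 'S_k) (V : 'M[R]_(k, n)) :
  homog (row_perm u V) = row_perm u (homog V).
Proof. by rewrite !row_permE homog_mul // => i; exact: perm_mx_sum. Qed.

Lemma conv_hull_span k m (W : 'M[R]_(m.+1, n)) (V : 'M[R]_(k.+1, n)) :
  conv_hull W `<=` conv_hull V -> (homog W <= homog V)%MS.
Proof. by move=> /conv_hull_subP[B [_ B1 ->]]; rewrite homog_mul // submxMl. Qed.

(** [W = B *m V] with [B] nonnegative and, as [W] is free and both matrices have k+1 rows,
    invertible. So no column of [B] vanishes, and positive coordinates stay positive. *)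
Lemma open_hull_sub k (W V : 'M[R]_(k.+1, n)) : row_free (homog W) ->
  conv_hull W `<=` conv_hull V -> open_hull W `<=` open_hull V.
Proof.
move=> Wf /conv_hull_subP[B [B0 B1 WE]] _ [t [t0 t1] <-].
have Bf : row_free B.
  rewrite /row_free eqn_leq rank_leq_row /= -[leqLHS](eqP Wf) WE homog_mul //.
  exact: mxrankM_maxl.
have Bu : B \in unitmx by rewrite -row_free_unit.
exists (t *m B); last by rewrite WE mulmxA.
split=> [j|]; last first.
  under eq_bigr do rewrite mxE; rewrite exchange_big /= -[RHS]t1.
  by apply: eq_bigr => i _; rewrite -mulr_sumr B1 mulr1.
rewrite mxE lt_neqAle sumr_ge0 ?andbT => [|i _]; last by rewrite mulr_ge0 // ltW.
apply/eqP => /esym /psumr_eq0P h.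
have cB : col j B = 0.
  apply/matrixP => i l; rewrite !mxE.
  have /eqP := h (fun i _ => mulr_ge0 (ltW (t0 i)) (B0 i j)) i isT.
  by rewrite mulf_eq0 (gt_eqF (t0 i)) => /eqP.
have /matrixP/(_ j 0)/eqP : col j (invmx B *m B) = 0.
  by rewrite colE -mulmxA -colE cB mulmx0.
by rewrite mulVmx // !mxE eqxx oner_eq0.
Qed.

Lemma homog_facet k (V : 'M[R]_(k, n)) i : row_free (homog V) ->
  homog V *m facet_form V i = delta_mx i 0.
Proof.
by move=> Vf; rewrite /facet_form colE mulmxA mulmxVp // mul1mx.
Qed.

(** The form takes the value 1 at vertex [i] of [V], a point of the affine span of [W]. *)
Lemma facet_neq0 k m (W : 'M[R]_(m, n)) (V : 'M[R]_(k, n)) i : row_free (homog V) ->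
  (homog V <= homog W)%MS -> homog W *m facet_form V i != 0.
Proof.
move=> Vf /submxP[D VE]; apply/eqP => h; have := homog_facet i Vf.
rewrite {1}VE -mulmxA h mulmx0 => /matrixP/(_ i 0)/eqP.
by rewrite !mxE !eqxx eq_sym oner_eq0.
Qed.

End HomogeneousCoordinates.

(** * Cutting simplexes by hyperplanes *)

Section Subdivision.
Context {R : realType} {n : nat} {K : set 'rV[R]_n}.
Implicit Types (c : 'cV[R]_(1 + n)) (x y : 'rV[R]_n).

Lemma simplex_free k (s : simplex K k) : row_free (homog (vertices s)).
Proof. by apply/affinely_independentP; exact: vertices_indep. Qed.
#[local] Hint Resolve simplex_free : core.

Lemma ev_conv k (V : 'M[R]_(k.+1, n)) c (t : 'rV[R]_k.+1) : \sum_i t 0 i = 1 ->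
  ev c (t *m V) = \sum_i t 0 i * (homog V *m c) i 0.
Proof.
move=> t1; rewrite /ev homog_mul => [|i]; last by rewrite ord1.
by rewrite -mulmxA mxE.
Qed.

Definition sided c k (V : 'M[R]_(k, n)) :=
  (forall i, 0 <= (homog V *m c) i 0) \/ (forall i, (homog V *m c) i 0 <= 0).

(** In the nonpositive case, a sum with positive weights can be nonnegative only if the form
    vanishes at every vertex, hence on the whole hull. *)
Lemma sided_ge0 c k (V : 'M[R]_(k.+1, n)) x y : sided c V ->
  open_hull V x -> 0 <= ev c x -> conv_hull V y -> 0 <= ev c y.
Proof.
move=> sV [t [t0 t1] <-] + [u [u0 u1] <-]; rewrite !ev_conv //.
case: sV => h tV; first by rewrite sumr_ge0 // => i _; rewrite mulr_ge0.
have h0 i : (homog V *m c) i 0 = 0.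
  have hi j : true -> 0 <= - (t 0 j * (homog V *m c) j 0).
    by move=> _; rewrite oppr_ge0 mulr_ge0_le0 // ltW.
  have /(psumr_eq0P hi)/(_ i isT)/eqP : \sum_j - (t 0 j * (homog V *m c) j 0) = 0.
    by apply/eqP; rewrite eq_le sumr_ge0 ?andbT // sumrN oppr_le0.
  by rewrite oppr_eq0 mulf_eq0 (gt_eqF (t0 i)) => /eqP.
by rewrite big1 // => i _; rewrite h0 mulr0.
Qed.

(** A row lies in the row space of [homog V] iff multiplication by [pinvmx (homog V) *m homog V]
    fixes it; these columns are the resulting equations. In [halfspaces] each of them appears as two
    opposite inequalities. *)
Definition span_form k (V : 'M[R]_(k, n)) i : 'cV[R]_(1 + n) :=
  col i (pinvmx (homog V) *m homog V - 1%:M).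

Definition halfspaces k (V : 'M[R]_(k, n)) : seq 'cV[R]_(1 + n) :=
  [seq facet_form V i | i <- enum 'I_k] ++
  ([seq span_form V i | i <- enum 'I_(1 + n)] ++
   [seq - span_form V i | i <- enum 'I_(1 + n)]).

Lemma halfspacesP k (V : 'M[R]_(k.+1, n)) x : row_free (homog V) ->
  conv_hull V x <-> forall c, c \in halfspaces V -> 0 <= ev c x.
Proof.
move=> Vf; rewrite conv_hullP //; set D := pinvmx (homog V) *m homog V - 1%:M.
have eD i : ev (span_form V i) x = (homog x *m D) 0 i by rewrite /ev /span_form colE mulmxA -colE mxE.
have eND i : ev (- span_form V i) x = - (homog x *m D) 0 i.
  by rewrite -eD /ev mulmxN [LHS]mxE.
have spanD : aff_span V x <-> homog x *m D = 0.
  rewrite /D mulmxBr mulmx1 mulmxA; split=> [/mulmxKpV ->|/subr0_eq h]; first by rewrite subrr.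
  by rewrite /aff_span /= -h submxMl.
split=> [[xV x0] c|h].
  rewrite !mem_cat => /or3P[] /mapP[i _ ->].
  - by rewrite ev_facet.
  - by rewrite eD (spanD.1 xV) mxE.
  - by rewrite eND (spanD.1 xV) mxE oppr0.
split=> [|i]; last first.
  by rewrite -ev_facet h // mem_cat map_f // mem_enum.
apply/spanD/rowP => i; rewrite [RHS]mxE; apply/eqP.
rewrite eq_le -oppr_ge0 -eND -eD !h // !mem_cat; apply/or3P.
  by apply: Or32; apply: map_f; rewrite mem_enum.
by apply: Or33; apply/mapP; exists i; rewrite ?mem_enum.
Qed.

(** A simplex on one side of every hyperplane bounding [V] cannot straddle [V]: one point of its
    relative interior decides for all. *)
Lemma sided_sub k m (V : 'M[R]_(k.+1, n)) (W : 'M[R]_(m.+1, n)) x : row_free (homog V) ->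
  (forall c, c \in halfspaces V -> sided c W) ->
  open_hull W x -> conv_hull V x -> conv_hull W `<=` conv_hull V.
Proof.
move=> Vf sW xW /(halfspacesP _ Vf) xV y yW; apply/(halfspacesP _ Vf) => c cV.
exact: sided_ge0 (sW _ cV) xW (xV _ cV) yW.
Qed.

Lemma sided_conv_sub c k m (W : 'M[R]_(m.+1, n)) (V : 'M[R]_(k.+1, n)) :
  conv_hull W `<=` conv_hull V -> sided c V -> sided c W.
Proof.
move=> /conv_hull_subP[B [B0 B1 ->]]; rewrite /sided homog_mul // -mulmxA.
case=> h; [left|right] => i; rewrite mxE.
  by rewrite sumr_ge0 // => j _; rewrite mulr_ge0.
by rewrite -oppr_ge0 -sumrN sumr_ge0 // => j _; rewrite -mulrN mulr_ge0 // oppr_ge0.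
Qed.

Lemma nonoverlapping_cons k (s : simplex K k) l : nonoverlapping (s :: l) <->
  (forall t, t \in l -> relint s `&` relint t = set0) /\ nonoverlapping l.
Proof.
rewrite /nonoverlapping /=; split=> [/andP[/allP h ->]|[h ->]].
  by split=> // t /h /asboolP.
by rewrite andbT; apply/allP => t /h ?; apply/asboolP.
Qed.

Lemma nonoverlapping_cat k (l1 l2 : seq (simplex K k)) : nonoverlapping (l1 ++ l2) <->
  [/\ forall s t, s \in l1 -> t \in l2 -> relint s `&` relint t = set0,
      nonoverlapping l1 & nonoverlapping l2].
Proof.
rewrite /nonoverlapping pairwise_cat; split=> [/and3P[/allrelP h -> ->]|[h -> ->]].
  by split=> // s t sl tl; apply/asboolP/h.
by rewrite !andbT; apply/allrelP => s t sl tl; apply/asboolP/h.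
Qed.

Lemma nonoverlapping_filter k (p : pred (simplex K k)) l :
  nonoverlapping l -> nonoverlapping [seq s <- l | p s].
Proof. by apply: subseq_pairwise; exact: filter_subseq. Qed.

Lemma cooriented_trans k (r s t : simplex K k) :
  cooriented r s -> cooriented s t -> cooriented r t.
Proof.
move=> [B [B1 rs B0]] [C [C1 st C0]]; exists (B *m C); split.
- move=> i; under eq_bigr do rewrite mxE; rewrite exchange_big /= -[RHS](B1 i).
  by apply: eq_bigr => j _; rewrite -mulr_sumr C1 mulr1.
- by rewrite rs st mulmxA.
- by rewrite det_mulmx mulr_gt0.
Qed.

Lemma cooriented_refl k (s : simplex K k) : cooriented s s.
Proof.
exists 1%:M; split; rewrite ?mul1mx ?det1 // => i.
by rewrite (bigD1 i) //= mxE eqxx big1 ?addr0 // => j ji; rewrite mxE eq_sym (negbTE ji).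
Qed.

Lemma subdivides_refl k (s : simplex K k) : subdivides [:: s] s.
Proof.
split=> [|t|]; first by [].
- by rewrite inE => /eqP ->; exact: cooriented_refl.
- by rewrite set_cons1 bigcup_set1.
Qed.

Lemma subdivides_sub k l (s t : simplex K k) :
  subdivides l s -> t \in l -> support t `<=` support s.
Proof. by move=> [_ _ ->] tl x xt; exists t. Qed.

Lemma relint_sub k (s t : simplex K k) :
  support t `<=` support s -> relint t `<=` relint s.
Proof. exact: open_hull_sub. Qed.

Lemma nonoverlapping_flatten k (f : simplex K k -> seq (simplex K k)) l :
  nonoverlapping l -> (forall t, t \in l -> subdivides (f t) t) ->
  nonoverlapping (flatten (map f l)).
Proof.
elim: l => //= s l IH /nonoverlapping_cons[sl nl] fl; apply/nonoverlapping_cat; split.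
- move=> t u ts /flatten_mapP[v vl uv].
  apply/seteqP; split=> // x [xt xu]; rewrite -(sl v vl); split.
    exact: relint_sub (subdivides_sub (fl s (mem_head _ _)) ts) _ xt.
  have fv : subdivides (f v) v by apply: fl; rewrite inE vl orbT.
  exact: relint_sub (subdivides_sub fv uv) _ xu.
- by have [] := fl s (mem_head _ _).
- by apply: IH => // t tl; apply: fl; rewrite inE tl orbT.
Qed.

Lemma subdivides_flatten k (f : simplex K k -> seq (simplex K k)) l s :
  subdivides l s -> (forall t, t \in l -> subdivides (f t) t) ->
  subdivides (flatten (map f l)) s.
Proof.
move=> sl fl; have [nl ol sE] := sl; split.
- exact: nonoverlapping_flatten.
- move=> u /flatten_mapP[t tl ut]; have [_ /(_ u ut) ot _] := fl t tl.
  exact: cooriented_trans ot (ol t tl).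
- rewrite sE; apply/seteqP; split=> x [t /= tl xt].
    have [_ _ tE] := fl t tl; move: xt; rewrite tE => -[u /= ut xu].
    by exists u => //=; apply/flatten_mapP; exists t.
  have [u ul tu] := flatten_mapP tl; exists u => //.
  exact: subdivides_sub (fl u ul) tu _ xt.
Qed.

(** Multiplication by this matrix moves vertex [i] to the point a v_i + (1 - a) v_j of an edge and
    keeps the other vertices. *)
Definition edge_mx k (i j : 'I_k) (a : R) : 'M[R]_k :=
  \matrix_(l, m) if l == i then a * (m == i)%:R + (1 - a) * (m == j)%:R else (l == m)%:R.

Lemma edge_mx_sum k (i j : 'I_k) a l : \sum_m edge_mx i j a l m = 1.
Proof.
have delta (p : 'I_k) : \sum_m (m == p)%:R = 1 :> R.
  by rewrite (bigD1 p) //= eqxx big1 ?addr0 // => m /negbTE ->.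
under eq_bigr do rewrite mxE; case: eqP => _; last first.
  by rewrite -[RHS](delta l); apply: eq_bigr => m _; rewrite eq_sym.
by rewrite big_split /= -!mulr_sumr !delta !mulr1; lra.
Qed.

(** The determinant is linear in row [i], which combines rows [i] and [j] of the identity; the
    second contribution has two equal rows. *)
Lemma det_edge_mx k (i j : 'I_k) a : i != j -> \det (edge_mx i j a) = a.
Proof.
move=> ij.
have e0 : \det (edge_mx i j 0) = 0.
  apply: (determinant_alternate ij) => m; rewrite !mxE eqxx [j == i]eq_sym (negbTE ij).
  by rewrite mul0r add0r subr0 mul1r eq_sym.
rewrite (determinant_multilinear (B := 1%:M) (C := edge_mx i j 0) (i0 := i) (b := a) (c := 1 - a)).
- by rewrite det1 e0 mulr1 mulr0 addr0.
- by apply/rowP => m; rewrite !mxE eqxx mul0r add0r subr0 mul1r ![_ == m]eq_sym.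
- by apply/matrixP => p m; rewrite !mxE [lift _ _ == i]eq_sym !(negbTE (neq_lift _ _)).
- by apply/matrixP => p m; rewrite !mxE [lift _ _ == i]eq_sym !(negbTE (neq_lift _ _)).
Qed.

Lemma mul_edge_mx k (i j : 'I_k) a m (C : 'M[R]_(k, m)) l p :
  (edge_mx i j a *m C) l p = if l == i then a * C i p + (1 - a) * C j p else C l p.
Proof.
have delta (q : 'I_k) (F : 'I_k -> R) : \sum_m (m == q)%:R * F m = F q.
  by rewrite (bigD1 q) //= eqxx mul1r big1 ?addr0 // => o /negbTE ->; rewrite mul0r.
rewrite mxE; under eq_bigr do rewrite mxE; case: eqP => _.
  under eq_bigr do rewrite mulrDl -!mulrA.
  by rewrite big_split /= -!mulr_sumr !delta.
by under eq_bigr do rewrite eq_sym; rewrite delta.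
Qed.

Lemma row_mul_edge_mx k (i j : 'I_k) a (t : 'rV[R]_k) m : i != j ->
  (t *m edge_mx i j a) 0 m =
  if m == i then a * t 0 i else if m == j then t 0 j + (1 - a) * t 0 i else t 0 m.
Proof.
move=> ij; rewrite mxE (bigD1 i) //= !mxE eqxx.
have -> : \sum_(l < k | l != i) t 0 l * edge_mx i j a l m = if m == i then 0 else t 0 m.
  under eq_bigr => l li do rewrite mxE (negbTE li).
  case: eqP => [->|/eqP mi].
    by rewrite big1 // => l /negbTE ->; rewrite mulr0.
  rewrite (bigD1 m) //= eqxx mulr1 big1 ?addr0 // => l /andP[_ /negbTE ->].
  by rewrite mulr0.
case: eqP => [->|_]; first by rewrite (negbTE ij) /=; ring.
by case: eqP => [->|_] /=; ring.
Qed.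

Lemma edge_cover k (V : 'M[R]_(k.+1, n)) (i j : 'I_k.+1) a (t : 'rV[R]_k.+1) :
  i != j -> 0 < a -> (forall l, 0 <= t 0 l) -> \sum_l t 0 l = 1 ->
  (1 - a) * t 0 i <= a * t 0 j -> conv_hull (edge_mx i j a *m V) (t *m V).
Proof.
move=> ij a0 t0 t1 tij.
(* The barycentric coordinates of the same point in the simplex with the moved vertex; the one at
   [j] is nonnegative by the last hypothesis. *)
pose u : 'rV[R]_k.+1 := \row_m if m == i then t 0 i / a else
   if m == j then t 0 j - (1 - a) / a * t 0 i else t 0 m.
have uE : u *m edge_mx i j a = t.
  apply/rowP => m; rewrite row_mul_edge_mx // !mxE eqxx [j == i]eq_sym (negbTE ij) eqxx.
  case: eqP => [->|_]; first by rewrite mulrCA divff ?mulr1 ?gt_eqF.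
  by case: eqP => [->|_] //; field; rewrite gt_eqF.
exists u; last by rewrite mulmxA uE.
split=> [m|].
  rewrite mxE; case: eqP => _; first by rewrite divr_ge0 // ltW.
  case: eqP => _ //; rewrite subr_ge0 mulrAC ler_pdivrMr // mulrC.
  by rewrite [X in _ <= X]mulrC [X in X <= _]mulrC.
have := t1; rewrite -uE; under eq_bigr do rewrite mxE; rewrite exchange_big /= => <-.
by apply: eq_bigr => l _; rewrite -mulr_sumr edge_mx_sum mulr1.
Qed.

Lemma edge_sub k (V : 'M[R]_(k.+1, n)) (i j : 'I_k.+1) a :
  0 <= a <= 1 -> conv_hull (edge_mx i j a *m V) `<=` conv_hull V.
Proof.
move=> /andP[a0 a1]; apply/conv_hull_subP; exists (edge_mx i j a); split=> //.
  move=> l m; rewrite mxE; case: eqP => _ //.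
  by rewrite addr_ge0 ?mulr_ge0 ?subr_ge0.
exact: edge_mx_sum.
Qed.

Lemma edge_free k (V : 'M[R]_(k.+1, n)) (i j : 'I_k.+1) a :
  i != j -> 0 < a -> row_free (homog V) -> row_free (homog (edge_mx i j a *m V)).
Proof.
move=> ij a0 Vf; rewrite homog_mul; last exact: edge_mx_sum.
rewrite /row_free mxrankMfree // mxrank_unit // unitmxE det_edge_mx //.
by rewrite unitfE gt_eqF.
Qed.

Lemma edge_open k (V : 'M[R]_(k.+1, n)) (i j : 'I_k.+1) a x :
  i != j -> 0 < a -> row_free (homog V) -> open_hull (edge_mx i j a *m V) x ->
  (1 - a) * bary V x 0 i < a * bary V x 0 j.
Proof.
move=> ij a0 Vf [t [t0 t1] <-]; rewrite mulmxA.
have [|-> _] := bary_comb (t := t *m edge_mx i j a) Vf.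
  under eq_bigr do rewrite mxE; rewrite exchange_big /= -[RHS]t1.
  by apply: eq_bigr => l _; rewrite -mulr_sumr edge_mx_sum mulr1.
rewrite !row_mul_edge_mx // eqxx [j == i]eq_sym (negbTE ij) eqxx mulrDr.
by rewrite mulrCA ltrDr mulr_gt0.
Qed.

Definition edge_simplex k (s : simplex K k) (i j : 'I_k.+1) (a : R) (ij : i != j)
    (a0 : 0 < a) (a1 : a <= 1) : simplex K k.
Proof.
exists (edge_mx i j a *m vertices s).
  by apply/affinely_independentP; apply: edge_free.
by apply: subset_trans (@vertices_sub _ _ _ _ s); apply: edge_sub; rewrite a1 ltW.
Defined.

(** The two pieces replace [i] and [j] by the same point of the edge. In barycentric coordinates [t]
    they are separated by the hyperplane (1 - a) t_i = a t_j, and the determinants [a] and [1 - a]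
    are positive, so the orientation is kept. *)
Lemma edge_subdivides k (s : simplex K k) (i j : 'I_k.+1) (a : R) (ij : i != j) (ji : j != i)
    (a0 : 0 < a) (a1 : a <= 1) (b0 : 0 < 1 - a) (b1 : 1 - a <= 1) :
  subdivides [:: edge_simplex s ij a0 a1; edge_simplex s ji b0 b1] s.
Proof.
split.
- apply/nonoverlapping_cons; split=> // t; rewrite inE => /eqP ->.
  apply/seteqP; split=> // x [/edge_open h1 /edge_open h2].
  have {}h1 := h1 ij a0 (simplex_free s); have := h2 ji b0 (simplex_free s).
  by rewrite subKr => /(lt_trans h1); rewrite ltxx.
- move=> t; rewrite !inE => /orP[] /eqP ->.
    by exists (edge_mx i j a); split=> //; [exact: edge_mx_sum|rewrite det_edge_mx].
  by exists (edge_mx j i (1 - a)); split=> //; [exact: edge_mx_sum|rewrite det_edge_mx].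
- apply/seteqP; split=> [x [t [t0 t1] <-]|x [t /=]].
    have [h|h] := leP ((1 - a) * t 0 i) (a * t 0 j).
      exists (edge_simplex s ij a0 a1); first by rewrite /= inE eqxx.
      exact: edge_cover.
    exists (edge_simplex s ji b0 b1); first by rewrite /= !inE eqxx orbT.
    by apply: edge_cover => //; rewrite subKr ltW.
  rewrite !inE => /orP[] /eqP ->; apply: edge_sub; rewrite ?(ltW a0) ?a1 //.
  by rewrite (ltW b0) b1.
Qed.

(** While [c] takes both signs at the vertices, an edge from a negative vertex to a positive one is
    cut at the zero of [c]. In each piece a vertex with nonzero value gives way to one with value 0,
    so the number of the former decreases. *)
Lemma cut_simplex c k (s : simplex K k) :
  exists2 l, subdivides l s & forall t, t \in l -> sided c (vertices t).
Proof.
have [N] := ubnP #|[pred i | (homog (vertices s) *m c) i 0 != 0]|.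
elim: N s => // N IH s sN; set h := homog (vertices s) *m c in sN *.
have [sid|nsid] := pselect (sided c (vertices s)).
  exists [:: s]; first exact: subdivides_refl.
  by move=> t; rewrite inE => /eqP ->.
have [i hi] : exists i, h i 0 < 0.
  apply: contrapT => /forallNP ni; apply: nsid; left=> i.
  by rewrite leNgt; apply/negP; exact: ni.
have [j hj] : exists j, 0 < h j 0.
  apply: contrapT => /forallNP ni; apply: nsid; right=> j.
  by rewrite leNgt; apply/negP; exact: ni.
have ij : i != j by apply: contraTneq hi => ->; rewrite -leNgt ltW.
have ji : j != i by rewrite eq_sym.
have hji : 0 < h j 0 - h i 0 by rewrite subr_gt0 (lt_trans hi).
pose a := h j 0 / (h j 0 - h i 0).
have a0 : 0 < a by rewrite divr_gt0.
have b0 : 0 < 1 - a by rewrite subr_gt0 ltr_pdivrMr // mul1r ltrBrDl gtrDr.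
have b1 : 1 - a <= 1 by rewrite gerBl ltW.
have a1 : a <= 1 by rewrite -subr_ge0 ltW.
have ha : a * h i 0 + (1 - a) * h j 0 = 0.
  by rewrite /a; field; rewrite gt_eqF.
have card i' j' b (ij' : i' != j') (c0 : 0 < b) (c1 : b <= 1) :
    b * h i' 0 + (1 - b) * h j' 0 = 0 -> h i' 0 != 0 ->
    (#|[pred l | (homog (vertices (edge_simplex s ij' c0 c1)) *m c)%R l 0%R != 0%R]| < N)%N.
  move=> hb hi'; rewrite ltnS in sN; apply: leq_trans sN; apply: proper_card; apply/properP; split.
    apply/fintype.subsetP => l; rewrite !inE /= homog_mul; last exact: edge_mx_sum.
    by rewrite -mulmxA -/h mul_edge_mx; case: (l =P i') => // _; rewrite hb eqxx.
  exists i'; rewrite !inE //= negbK homog_mul; last exact: edge_mx_sum.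
  by rewrite -mulmxA -/h mul_edge_mx eqxx hb eqxx.
have sub := edge_subdivides s ij ji a0 a1 b0 b1.
have /choice[f fP] : forall t : simplex K k, exists l : seq (simplex K k), t \in [:: edge_simplex s ij a0 a1; edge_simplex s ji b0 b1] ->
    subdivides l t /\ forall u, u \in l -> sided c (vertices u).
  move=> t; have [|nt] := boolP (t \in _); last by exists [::].
  rewrite !inE => /orP[] /eqP ->.
    have [|l l1 l2] := IH (edge_simplex s ij a0 a1); last by exists l.
    by apply: card; rewrite ?lt_eqF.
  have [|l l1 l2] := IH (edge_simplex s ji b0 b1); last by exists l.
  by apply: card; rewrite ?gt_eqF // subKr addrC.
exists (flatten (map f [:: edge_simplex s ij a0 a1; edge_simplex s ji b0 b1])).
  by apply: subdivides_flatten => // t /fP[].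
by move=> u /flatten_mapP[t /fP[_ ]]; exact.
Qed.

Lemma cut_simplex_seq (A : seq 'cV[R]_(1 + n)) k (s : simplex K k) :
  exists2 l, subdivides l s &
    forall t c, t \in l -> c \in A -> sided c (vertices t).
Proof.
elim: A => [|c A [l sl lA]]; first by exists [:: s] => //; exact: subdivides_refl.
have /choice[f fP] : forall t : simplex K k, exists l, subdivides l t /\ forall u, u \in l -> sided c (vertices u).
  by move=> t; have [l' ? ?] := cut_simplex c t; exists l'.
exists (flatten (map f l)); first by apply: subdivides_flatten => // t _; case: (fP t).
move=> u c' /flatten_mapP[t tl ut]; have [st tc] := fP t; rewrite inE => /orP[/eqP ->|c'A].
  exact: tc.
exact: sided_conv_sub (subdivides_sub st ut) (lA _ _ tl c'A).
Qed.

End Subdivision.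
#[local] Hint Resolve simplex_free : core.

(** * Generic points of a simplex *)

Section Genericity.
Context {R : realType} {n : nat}.
Implicit Types (c : 'cV[R]_(1 + n)) (x y : 'rV[R]_n).

(** For small positive [e] the sign is decided lexicographically by [a], then [b]. Small
    displacements of a point are thus handled through signs of affine forms. *)
Lemma near_sgD (a b : R) :
  \forall e \near 0^'+, Num.sg (a + e * b) = if a == 0 then Num.sg b else Num.sg a.
Proof.
have [->|a0] := eqVneq a 0.
  near=> e; have e0 : 0 < e by near: e; exact: nbhs_right_gt.
  by rewrite add0r sgrM gtr0_sg // mul1r.
have q0 : 0 < `|a| / (`|b| + 1) by rewrite divr_gt0 ?normr_gt0 // ltr_wpDl.
near=> e; have e0 : 0 < e by near: e; exact: nbhs_right_gt.
have : e < `|a| / (`|b| + 1) by near: e; exact: nbhs_right_lt.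
rewrite ltr_pdivlMr ?ltr_wpDl // => eb.
have h : `|e * b| < `|a|.
  by rewrite normrM gtr0_norm // (le_lt_trans _ eb) // ler_pM2l // lerDl.
move: h; rewrite ltr_norml; case: (ltrgt0P a) a0 => // sa _ /andP[h1 h2].
  by rewrite !gtr0_sg //; lra.
by rewrite !ltr0_sg //; lra.
Unshelve. all: by end_near. Qed.

Lemma near_seq (T : eqType) (A : seq T) (P : T -> R -> Prop) :
  (forall z, z \in A -> \forall e \near 0^'+, P z e) ->
  \forall e \near 0^'+, forall z, z \in A -> P z e.
Proof.
elim: A => [|z A IH] h; first by apply: nearW.
have hz := h z (mem_head _ _).
have {}IH : \forall e \near 0^'+, forall z, z \in A -> P z e.
  by apply: IH => z' z'A; apply: h; rewrite inE z'A orbT.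
near=> e => z'; rewrite inE => /orP[/eqP ->|].
  by near: e.
by move: z'; near: e.
Unshelve. all: by end_near. Qed.

Lemma open_hull_comb k (V : 'M[R]_(k.+1, n)) x y (e : R) : 0 < e <= 1 ->
  conv_hull V x -> open_hull V y -> open_hull V ((1 - e) *: x + e *: y).
Proof.
move=> /andP[e0 e1] [t [t0 t1] <-] [u [u0 u1] <-].
exists ((1 - e) *: t + e *: u); last by rewrite mulmxDl !scalemxAl.
split=> [i|].
  by rewrite !mxE ltr_wpDl ?mulr_gt0 // mulr_ge0 // subr_ge0.
under eq_bigr do rewrite !mxE.
by rewrite big_split /= -!mulr_sumr t1 u1; ring.
Qed.

Lemma open_hull_neq0 k (V : 'M[R]_(k.+1, n)) : open_hull V !=set0.
Proof.
exists (const_mx (k.+1%:R^-1) *m V); exists (const_mx (k.+1%:R^-1)) => //.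
split=> [i|]; first by rewrite mxE invr_gt0 ltr0n.
under eq_bigr do rewrite mxE.
by rewrite sumr_const card_ord -[LHS]mulr_natr mulVf // pnatr_eq0.
Qed.

(** If a point that avoids the previous hyperplanes lies on the new one, it is moved slightly
    towards a vertex where the new form is nonzero; the old conditions are open and survive. *)
Lemma open_hull_generic k (V : 'M[R]_(k.+1, n)) (A : seq 'cV[R]_(1 + n)) :
  (forall c, c \in A -> homog V *m c != 0) ->
  exists2 y, open_hull V y & forall c, c \in A -> ev c y != 0.
Proof.
elim: A => [|c A IH] hA.
  by have [y Vy] := open_hull_neq0 V; exists y.
have [c' c'A|y0 Vy0 Ay0] := IH; first by apply: hA; rewrite inE c'A orbT.
have [y0c|y0c] := eqVneq (ev c y0) 0; last first.
  by exists y0 => // c'; rewrite inE => /orP[/eqP ->|/Ay0].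
have [i ci] : exists i, (homog V *m c) i 0 != 0.
  apply: contrapT => /forallNP h; have /negP := hA c (mem_head _ _); apply.
  apply/eqP/matrixP => i j; rewrite ord1 [RHS]mxE; apply/eqP/negPn/negP; exact: h.
have ce : \forall e \near 0^'+, forall c', c' \in c :: A ->
    ev c' ((1 - e) *: y0 + e *: row i V) != 0.
  apply: near_seq => c' c'A.
  have := near_sgD (ev c' y0) (ev c' (row i V) - ev c' y0); apply: filterS => e he.
  have -> : ev c' ((1 - e) *: y0 + e *: row i V) =
      ev c' y0 + e * (ev c' (row i V) - ev c' y0) by rewrite ev_comb; ring.
  rewrite -sgr_eq0 he; move: c'A; rewrite inE => /orP[/eqP ->|/Ay0 c'y0].
    by rewrite y0c eqxx sgr_eq0 subr0 ev_row.
  by rewrite (negbTE c'y0) sgr_eq0.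
have : \forall e \near 0^'+, [/\ 0 < e, e < 1 & forall c', c' \in c :: A ->
    ev c' ((1 - e) *: y0 + e *: row i V) != 0].
  by near=> e; split; near: e => //; [exact: nbhs_right_gt|exact: nbhs_right_lt].
move=> /filter_ex[e [e0 e1 he]]; exists ((1 - e) *: y0 + e *: row i V) => //.
have e1' : 0 < 1 - e <= 1 by rewrite subr_gt0 e1 gerBl ltW.
by have := open_hull_comb e1' (conv_hull_row V i) Vy0; rewrite subKr addrC.
Unshelve. all: by end_near. Qed.

(* Sign conditions satisfied by [y] pass, in weak form, to [x]: [y] stands for
   a generic point arbitrarily close to [x]. *)
Lemma open_hull_generic_near k (V : 'M[R]_(k.+1, n)) (A : seq 'cV[R]_(1 + n)) x :
  (forall c, c \in A -> homog V *m c != 0) -> conv_hull V x ->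
  exists2 y, open_hull V y & forall c, c \in A ->
    ev c y != 0 /\ (0 <= ev c y -> 0 <= ev c x).
Proof.
move=> hA Vx; have [y0 Vy0 Ay0] := open_hull_generic hA.
have ce : \forall e \near 0^'+, forall c, c \in A ->
    ev c ((1 - e) *: x + e *: y0) != 0 /\
    (0 <= ev c ((1 - e) *: x + e *: y0) -> 0 <= ev c x).
  apply: near_seq => c cA.
  have := near_sgD (ev c x) (ev c y0 - ev c x); apply: filterS => e he.
  have -> : ev c ((1 - e) *: x + e *: y0) =
      ev c x + e * (ev c y0 - ev c x) by rewrite ev_comb; ring.
  rewrite -sgr_eq0 -sgr_ge0 he; have [->|cx] := eqVneq (ev c x) 0.
    by rewrite subr0 sgr_eq0 Ay0.
  by rewrite sgr_eq0 sgr_ge0.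
have : \forall e \near 0^'+, [/\ 0 < e, e < 1 & forall c, c \in A ->
    ev c ((1 - e) *: x + e *: y0) != 0 /\
    (0 <= ev c ((1 - e) *: x + e *: y0) -> 0 <= ev c x)].
  by near=> e; split; near: e => //; [exact: nbhs_right_gt|exact: nbhs_right_lt].
move=> /filter_ex[e [e0 e1 he]]; exists ((1 - e) *: x + e *: y0) => //.
by apply: open_hull_comb => //; rewrite e0 ltW.
Unshelve. all: by end_near. Qed.

End Genericity.

(** * Common refinements *)

Section Refinement.
Context {R : realType} {n : nat} {K : set 'rV[R]_n}.
Implicit Types (c : 'cV[R]_(1 + n)) (x y : 'rV[R]_n).

Lemma support_baryP k (s : simplex K k) x : support s x <->
  aff_span (vertices s) x /\ forall i, 0 <= bary (vertices s) x 0 i.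
Proof. exact: conv_hullP. Qed.

Lemma relint_baryP k (s : simplex K k) x : relint s x <->
  aff_span (vertices s) x /\ forall i, 0 < bary (vertices s) x 0 i.
Proof. exact: open_hullP. Qed.

Lemma relint_support k (s : simplex K k) : relint s `<=` support s.
Proof. exact: open_hull_conv. Qed.

(* The walls on which a point of the span of [V] can hit the boundary of a
   simplex of [l] with the same span. *)
Definition walls k m (l : seq (simplex K k)) (V : 'M[R]_(m, n)) : seq 'cV[R]_(1 + n) :=
  [seq c <- flatten [seq [seq facet_form (vertices s) i | i <- enum 'I_k.+1] | s <- l]
     | homog V *m c != 0].

Lemma wallsP k m (l : seq (simplex K k)) (V : 'M[R]_(m, n)) c :
  c \in walls l V -> homog V *m c != 0.
Proof. by rewrite mem_filter => /andP[]. Qed.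

Lemma mem_walls k m (l : seq (simplex K k)) (V : 'M[R]_(m, n)) s i : s \in l ->
  homog V *m facet_form (vertices s) i != 0 -> facet_form (vertices s) i \in walls l V.
Proof.
move=> sl h; rewrite mem_filter h; apply/flatten_mapP; exists s => //.
by rewrite map_f // mem_enum.
Qed.

Lemma walls_cat k m (l l' : seq (simplex K k)) (V : 'M[R]_(m, n)) :
  walls (l ++ l') V = walls l V ++ walls l' V.
Proof. by rewrite /walls map_cat flatten_cat filter_cat. Qed.

Definition off_walls (A : seq 'cV[R]_(1 + n)) x := forall c, c \in A -> ev c x != 0.

Lemma off_walls_cat A B x : off_walls (A ++ B) x <-> off_walls A x /\ off_walls B x.
Proof.
split=> [h|[hA hB] c]; last by rewrite mem_cat => /orP[/hA|/hB].
by split=> c cA; apply: h; rewrite mem_cat cA ?orbT.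
Qed.

(** Off the walls no facet form of [s] vanishes at [x], so the weak inequalities that define the
    support are strict. *)
Lemma off_walls_relint k m (l : seq (simplex K k)) (V : 'M[R]_(m, n)) s x :
  (homog (vertices s) <= homog V)%MS -> s \in l -> off_walls (walls l V) x ->
  support s x -> relint s x.
Proof.
move=> sV sl gx /support_baryP[xs x0]; apply/relint_baryP; split=> // i.
rewrite lt_neqAle x0 andbT eq_sym -ev_facet; apply: gx.
by apply: mem_walls => //; exact: facet_neq0.
Qed.

(** A condition on supports only; orientations are adjusted afterwards by [reorient]. *)
Definition refines k (F : seq (simplex K k)) (s : simplex K k) :=
  forall x, support s x -> exists t, [/\ t \in F, support t `<=` support s & support t x].

(** Induction on the family. The cells of [F] are cut along the half-spaces of the new [s], and [s]
    along those of all cells of [F]. The pieces of [s] that lie in some cell of [F] are dropped,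
    being covered by pieces of that cell. *)
Lemma refinement k (l : seq (simplex K k)) :
  exists2 F, nonoverlapping F & forall s, s \in l -> refines F s.
Proof.
elim: l => [|s l [F nF Fl]]; first by exists [::].
have /choice[f fP] : forall t : simplex K k, exists l', subdivides l' t /\
    forall u c, u \in l' -> c \in halfspaces (vertices s) -> sided c (vertices u).
  by move=> t; have [l' ? ?] := cut_simplex_seq (halfspaces (vertices s)) t; exists l'.
have [ls [nls ols sE] lsF] :=
  cut_simplex_seq (flatten [seq halfspaces (vertices t) | t <- F]) s.
have fin u t x : t \in F -> u \in f t -> relint u x -> support s x -> support u `<=` support s.
  move=> tF ut xu xs; apply: (sided_sub (x := x)) => // c cs.
  exact: (fP t).2 ut cs.
have lsin u t x : u \in ls -> t \in F -> relint u x -> support t x -> support u `<=` support t.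
  move=> uls tF xu xt; apply: (sided_sub (x := x)) => // c ct.
  by apply: lsF uls _; apply/flatten_mapP; exists t.
pose out (u : simplex K k) : bool := `[< forall t, t \in F -> ~ support u `<=` support t >].
exists (flatten (map f F) ++ [seq u <- ls | out u]).
  apply/nonoverlapping_cat; split.
  - move=> u v /flatten_mapP[t tF ut]; rewrite mem_filter => /andP[/asboolP ov vls].
    apply/seteqP; split=> // x [xu xv]; apply: (ov t tF).
    apply: lsin xv _ => //; apply: (subdivides_sub (fP t).1 ut).
    exact: relint_support.
  - by apply: nonoverlapping_flatten => // t _; exact: (fP t).1.
  - exact: nonoverlapping_filter.
move=> s'; rewrite inE => /orP[/eqP -> {s'} x|s'l x /(Fl s' s'l)[t [tF ts xt]]]; last first.
  have [_ _ tE] := (fP t).1; move: (xt); rewrite tE => -[u /= ut xu].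
  exists u; split=> //; first by rewrite mem_cat; apply/orP; left; apply/flatten_mapP; exists t.
  exact: subset_trans (subdivides_sub (fP t).1 ut) ts.
rewrite sE => -[u /= uls xu].
have [uout|/asboolPn/existsNP[t /not_implyP[tF /contrapT ut]]] := boolP (out u).
  exists u; split=> //; first by rewrite mem_cat mem_filter uout uls orbT.
  by rewrite -sE; apply: subdivides_sub uls; split.
have [_ _ tE] := (fP t).1.
(* Here [u] is a dropped piece, inside the cell [t]. A generic point [y] of [u] near [x] selects a
   piece [v] of [t] with the same span; the facet inequalities of [v] hold at [y] and pass to
   [x]. *)
have [y yu yA] := open_hull_generic_near (V := vertices u) (@wallsP _ _ (f t) (vertices u)) xu.
have yt : support t y by apply: ut; exact: relint_support.
move: (yt); rewrite tE => -[v /= vt yv].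
have tu : (homog (vertices t) <= homog (vertices u))%MS.
  by apply: free_eqmx => //; exact: conv_hull_span.
have vu : (homog (vertices v) <= homog (vertices u))%MS.
  by apply: submx_trans tu; apply: conv_hull_span; exact: subdivides_sub (fP t).1 vt.
have uv : (homog (vertices u) <= homog (vertices v))%MS by exact: free_eqmx vu.
have yv' : relint v y by apply: (off_walls_relint vu vt) yv => c /yA[].
have ys : support s y by rewrite sE; exists u => //; exact: relint_support.
exists v; split; first by rewrite mem_cat; apply/orP; left; apply/flatten_mapP; exists t.
- by rewrite -sE; exact: fin tF vt yv' ys.
apply/support_baryP; split=> [|i]; first by have /support_baryP[xu' _] := xu; exact: submx_trans xu' uv.
have /yA[_ +] : facet_form (vertices v) i \in walls (f t) (vertices u).
  by apply: mem_walls => //; exact: facet_neq0.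
rewrite !ev_facet; apply; have /support_baryP[_] := yv; exact.
Qed.

End Refinement.

(** * Multiplicities *)

Section Orientation.
Context {R : realType} {m : nat}.
Implicit Types (k : nat).

(** Relative orientation of two bases. The value 0 when [M] is not in the row space of [N] makes
    [mult] ignore the simplexes in other directions. *)
Definition orient k (M N : 'M[R]_(k, m)) : int :=
  if (M <= N)%MS then sgz (\det (M *m pinvmx N)) else 0.

Lemma orient_refl k (M : 'M[R]_(k, m)) : row_free M -> orient M M = 1.
Proof. by move=> Mf; rewrite /orient submx_refl mulmxVp // det1 sgz1. Qed.

Lemma orient_trans k (L M N : 'M[R]_(k, m)) : (L <= M)%MS -> (M <= N)%MS ->
  orient L N = orient L M * orient M N.
Proof.
move=> LM MN; rewrite /orient LM MN (submx_trans LM MN) -sgzM -det_mulmx.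
by rewrite (mulmxA _ M) mulmxKpV.
Qed.

Lemma orient0 k (M N : 'M[R]_(k, m)) : ~~ (M <= N)%MS -> orient M N = 0.
Proof. by rewrite /orient => /negbTE ->. Qed.

Lemma orient_cases k (M N : 'M[R]_(k, m)) :
  [\/ orient M N = 0, orient M N = 1 | orient M N = -1].
Proof.
rewrite /orient; case: ifP => _; last exact: Or31.
by case: sgzP => _; [apply: Or31|apply: Or32|apply: Or33].
Qed.

Lemma orient_sqr k (M N : 'M[R]_(k, m)) : row_free M -> (M <= N)%MS ->
  orient M N * orient M N = 1 /\ orient N M = orient M N.
Proof.
move=> Mf MN; have := orient_trans MN (free_eqmx Mf MN); rewrite orient_refl //.
by case: (orient_cases M N) => ->; case: (orient_cases N M) => ->; rewrite ?mulr0 ?mul0r.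
Qed.

Lemma orient_sym k (M N : 'M[R]_(k, m)) : row_free M -> row_free N ->
  orient M N = orient N M.
Proof.
move=> Mf Nf; have [MN|MN] := boolP (M <= N)%MS.
  by have [_ ->] := orient_sqr Mf MN.
have [NM|NM] := boolP (N <= M)%MS; last by rewrite !orient0.
by have [_ ->] := orient_sqr Nf NM.
Qed.

Lemma orient_perm k (u : 'S_k) (M N : 'M[R]_(k, m)) :
  orient (row_perm u M) N = (-1) ^+ u * orient M N.
Proof.
have sub : (row_perm u M <= N)%MS = (M <= N)%MS.
  rewrite row_permE; apply/idP/idP; last exact: submx_trans (submxMl _ _).
  apply: submx_trans; rewrite -{1}[M]mul1mx -(perm_mx1 _ k) -(mulVg u) perm_mxM -mulmxA.
  exact: submxMl.
rewrite /orient sub; case: ifP => _; last by rewrite mulr0.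
rewrite row_permE -mulmxA det_mulmx sgzM det_perm.
by case: (odd_perm u); rewrite ?expr1 ?expr0 ?sgz1 // sgzN sgz1.
Qed.

End Orientation.

Section Multiplicity.
Context {R : realType} {n : nat} {K : set 'rV[R]_n}.
Implicit Types (c : 'cV[R]_(1 + n)) (x y : 'rV[R]_n).

Section Group.
Context {G : zmodType}.

(* Multiplicity at [x] of the part of [P] that is parallel to the row space of
   [N], counted with the orientation of [N]. *)
Definition mult k (N : 'M[R]_(k.+1, 1 + n)) (P : formal_sum K G k) x : G :=
  \sum_(p <- P) if `[< support p.2 x >]
                then p.1 *~ orient (homog (vertices p.2)) N else 0.

Lemma mult_cat k (N : 'M[R]_(k.+1, 1 + n)) (P Q : formal_sum K G k) x :
  mult N (P ++ Q) x = mult N P x + mult N Q x.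
Proof. exact: big_cat. Qed.

Lemma mult_opp k (N : 'M[R]_(k.+1, 1 + n)) (P : formal_sum K G k) x :
  mult N (chain_opp P) x = - mult N P x.
Proof.
rewrite /mult big_map -sumrN; apply: eq_bigr => p _ /=.
by case: ifP => _; rewrite ?oppr0 // mulNrz.
Qed.

Lemma mult_sub k (N : 'M[R]_(k.+1, 1 + n)) (P Q : formal_sum K G k) x :
  mult N (chain_sub P Q) x = mult N P x - mult N Q x.
Proof. by rewrite mult_cat mult_opp. Qed.

Lemma mult_nil k (N : 'M[R]_(k.+1, 1 + n)) x : mult N ([::] : formal_sum K G k) x = 0.
Proof. exact: big_nil. Qed.

Lemma mult_cons k (N : 'M[R]_(k.+1, 1 + n)) p (P : formal_sum K G k) x :
  mult N (p :: P) x = mult N [:: p] x + mult N P x.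
Proof. by rewrite -mult_cat. Qed.

Lemma mult1 k (N : 'M[R]_(k.+1, 1 + n)) g (s : simplex K k) x :
  mult N [:: (g, s)] x =
  if `[< support s x >] then g *~ orient (homog (vertices s)) N else 0.
Proof. exact: big_seq1. Qed.

(** Agreement on the affine span of [V] outside finitely many proper affine subspaces. Simplexes are
    closed, so on common faces the multiplicities of equal chains may differ. *)
Definition generic_eq k (V : 'M[R]_(k.+1, n)) (P Q : formal_sum K G k) :=
  exists2 A, (forall c, c \in A -> homog V *m c != 0) &
    forall x, aff_span V x -> off_walls A x -> mult (homog V) P x = mult (homog V) Q x.

Lemma sum_nonoverlapping k (l : seq (simplex K k)) (f : simplex K k -> G) t x :
  nonoverlapping l -> t \in l -> relint t x ->
  (forall u, u \in l -> support u x -> relint u x) ->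
  \sum_(u <- l) (if `[< support u x >] then f u else 0) = f t.
Proof.
elim: l => // s l IH /nonoverlapping_cons[sl nl]; rewrite inE big_cons => tl tx lx.
case/predU1P: tl => [ts|tl].
  subst t; rewrite (asboolT (relint_support tx)) big_seq big1 ?addr0 // => u ul.
  case: asboolP => // ux; have : (relint s `&` relint u) x.
    by split=> //; apply: lx => //; rewrite inE ul orbT.
  by rewrite sl.
case: asboolP => [sx|_].
  have : (relint s `&` relint t) x by split=> //; apply: lx; rewrite ?mem_head.
  by rewrite sl.
by rewrite add0r IH // => u ul; apply: lx; rewrite inE ul orbT.
Qed.

Lemma subdivides_span k (l : seq (simplex K k)) s t : subdivides l s -> t \in l ->
  (homog (vertices t) <= homog (vertices s))%MS.
Proof. by move=> sl tl; apply: conv_hull_span; exact: subdivides_sub sl tl. Qed.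

Lemma orient_cooriented k (s t : simplex K k) : cooriented t s ->
  orient (homog (vertices t)) (homog (vertices s)) = 1.
Proof.
move=> [B [B1 ts B0]]; rewrite /orient ts homog_mul // submxMl mulmxKp //.
by rewrite gtr0_sgz.
Qed.

(** Induction on the generators. Only subdivision introduces exceptional points: those on the facets
    of the pieces, where several closed pieces may contain [x]. *)
Lemma chain_eq_generic k (P Q : formal_sum K G k) (V : 'M[R]_(k.+1, n)) :
  row_free (homog V) -> chain_eq P Q -> generic_eq V P Q.
Proof.
move=> Vf; elim=> {P Q}.
- by move=> P; exists [::].
- by move=> P Q _ [A hA PQ]; exists A => // x xV xA; rewrite PQ.
- move=> P Q S _ [A hA PQ] _ [B hB QS]; exists (A ++ B).
    by move=> c; rewrite mem_cat => /orP[/hA|/hB].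
  by move=> x xV /off_walls_cat[xA xB]; rewrite PQ // QS.
- move=> P P' Q Q' _ [A hA PQ] _ [B hB QS]; exists (A ++ B).
    by move=> c; rewrite mem_cat => /orP[/hA|/hB].
  by move=> x xV /off_walls_cat[xA xB]; rewrite !mult_cat PQ // QS.
- by move=> P Q; exists [::] => // x _ _; rewrite !mult_cat addrC.
- by move=> s; exists [::] => // x _ _; rewrite mult1 mult_nil mul0rz if_same.
- move=> g h s; exists [::] => // x _ _.
  by rewrite mult_cons !mult1; case: ifP => _; rewrite ?addr0 // mulrzDl.
- move=> g s t u ts; exists [::] => // x _ _; rewrite !mult1.
  have -> : support t = support s by rewrite /support ts conv_hull_row_perm.
  case: ifP => // _; rewrite ts homog_row_perm.
  rewrite orient_perm; case: (odd_perm u); rewrite ?expr1 ?expr0 ?mul1r //.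
  by rewrite mulN1r mulrNz mulNrz opprK.
- move=> g s l sl; exists (walls l V); first exact: wallsP.
  move=> x xV xA; rewrite mult1 /mult big_map /=.
  have [nl ol sE] := sl.
  have [sV|sV] := boolP (homog (vertices s) <= homog V)%MS; last first.
    rewrite orient0 // mulr0z if_same big_seq big1 // => t tl; rewrite orient0 ?mulr0z ?if_same //.
    apply: contra sV => tV; apply: submx_trans tV; apply: free_eqmx => //.
    exact: subdivides_span tl.
  have [xs|xs] := asboolP; last first.
    rewrite big_seq big1 // => t tl; case: asboolP => // xt; exfalso; apply: xs.
    exact: subdivides_sub sl tl _ xt.
  have lx u : u \in l -> support u x -> relint u x.
    move=> ul; apply: (off_walls_relint _ ul xA).
    by apply: submx_trans sV; exact: subdivides_span ul.
  move: xs; rewrite sE => -[t /= tl xt].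
  have tx := lx _ tl xt.
  rewrite (sum_nonoverlapping (fun u => g *~ orient (homog (vertices u)) (homog V)) nl tl tx lx).
  rewrite (orient_trans (subdivides_span sl tl) sV) orient_cooriented ?mul1r //.
  exact: ol.
Qed.

Lemma permuted_simplex k (s : simplex K k) (u : 'S_k.+1) :
  exists t : simplex K k, [/\ vertices t = row_perm u (vertices s),
    support t = support s & relint t = relint s].
Proof.
have sE : conv_hull (row_perm u (vertices s)) = support s by exact: conv_hull_row_perm.
have ui : affinely_independent (row_perm u (vertices s)).
  apply/affinely_independentP; rewrite homog_row_perm row_permE.
  by rewrite /row_free mxrankMfree ?simplex_free // mxrank_unit // unitmx_perm.
have uK : conv_hull (row_perm u (vertices s)) `<=` K.
  by rewrite sE; exact: vertices_sub.
exists (Simplex ui uK); split=> //; apply/seteqP; split.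
  by apply: relint_sub; rewrite {1}/support /= sE.
by apply: relint_sub; rewrite {2}/support /= sE.
Qed.

(** The subdivision rule wants pieces oriented like [s]. A piece of opposite orientation is replaced
    by the simplex with two vertices exchanged, at the price of a sign. *)
Lemma reorient k (s t : simplex K k) : support t `<=` support s ->
  exists t' : simplex K k, [/\ support t' = support t, relint t' = relint t,
    cooriented t' s & forall g : G, chain_eq [:: (g, t')]
      [:: (g *~ orient (homog (vertices s)) (homog (vertices t)), t)]].
Proof.
move=> ts; have [B [B0 B1 tE]] := (conv_hull_subP _ _).1 ts.
have tsE : homog (vertices t) = B *m homog (vertices s) by rewrite tE homog_mul.
have o : orient (homog (vertices s)) (homog (vertices t)) = sgz (\det B).
  by rewrite orient_sym // /orient tsE submxMl mulmxKp.
have Bu : \det B != 0.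
  rewrite -unitfE -unitmxE -row_free_unit /row_free -(mxrankMfree B (simplex_free s)) -tsE.
  exact: simplex_free.
rewrite o; case: (sgzP (\det B)) => [h|h|h].
- by rewrite h eqxx in Bu.
- exists t; split=> // [|g]; last by rewrite mulr1z; exact: chain_eq_refl.
  by exists B.
(* In dimension 0 there are no two vertices to exchange, but [B] is then the matrix 1, whose
   determinant is positive. *)
- case: k => [|k] in s t ts B B0 B1 tE tsE o Bu h *.
    have := B1 0; rewrite big_ord1 => B00.
    by move: h; rewrite [B]mx11_scalar det_scalar expr1 B00 ltr10.
  pose u : 'S_k.+2 := tperm 0 (lift 0 0).
  have [t' [t'E st' rt']] := permuted_simplex t u.
  have ut : vertices t = row_perm u (vertices t').
    by rewrite t'E; apply/matrixP => i j; rewrite !mxE /u tpermK.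
  exists t'; split=> //.
    exists (perm_mx u *m B); split.
    + by move=> i; under eq_bigr do rewrite -row_permE mxE; exact: B1.
    + by rewrite t'E row_permE tE mulmxA.
    + by rewrite det_mulmx det_perm odd_tperm /= mulN1r oppr_gt0.
  by move=> g; rewrite mulrN1z; have := chain_eq_orient g ut; rewrite odd_tperm.
Qed.

Lemma chain_eq_flatten (T : eqType) k (F : seq T) (a b : T -> formal_sum K G k) :
  (forall f, f \in F -> chain_eq (a f) (b f)) ->
  chain_eq (flatten (map a F)) (flatten (map b F)).
Proof.
elim: F => [|f F IH] h /=; first exact: chain_eq_refl.
apply: chain_eq_cat; first by apply: h; rewrite mem_head.
by apply: IH => f' f'F; apply: h; rewrite inE f'F orbT.
Qed.

Lemma chain_eq_addmap k (F : seq (simplex K k)) (a b : simplex K k -> G) :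
  chain_eq ([seq (a f, f) | f <- F] ++ [seq (b f, f) | f <- F])
           [seq (a f + b f, f) | f <- F].
Proof.
elim: F => [|f F IH] /=; first exact: chain_eq_refl.
set la := map _ _ in IH *; set lb := map _ _ in IH *.
apply: (@chain_eq_trans _ _ _ _ _ _ ([:: (a f, f); (b f, f)] ++ (la ++ lb))).
  apply: (@chain_eq_cat _ _ _ _ _ [:: (a f, f)] [:: (a f, f)] (la ++ [:: (b f, f)] ++ lb)
    ([:: (b f, f)] ++ (la ++ lb))); first exact: chain_eq_refl.
  rewrite !catA; apply: chain_eq_cat; last exact: chain_eq_refl.
  exact: chain_eq_catC.
rewrite -(cat1s (a f + b f, f)).
apply: chain_eq_cat => //; exact: chain_eq_add.
Qed.

Lemma chain_eq_drop0 k (F : seq (simplex K k)) (p : pred (simplex K k)) (a : simplex K k -> G) :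
  chain_eq [seq (a f, f) | f <- [seq f <- F | p f]]
           [seq (if p f then a f else 0, f) | f <- F].
Proof.
elim: F => [|f F IH] /=; first exact: chain_eq_refl.
case: (p f) => /=.
  rewrite -(cat1s (a f, f)) -[X in chain_eq _ X](cat1s (a f, f)).
  by apply: chain_eq_cat => //; exact: chain_eq_refl.
rewrite -[X in chain_eq X _]cat0s -[X in chain_eq _ X](cat1s (0, f)).
apply: chain_eq_cat => //; apply: chain_eq_sym; exact: chain_eq_zero.
Qed.

(** The multiplicity of [P] on the cell [f], expressed by inclusions of supports instead of points;
    [coef_mult] gives the agreement at generic points. *)
Definition coef k (f : simplex K k) (P : formal_sum K G k) : G :=
  \sum_(p <- P) if `[< support f `<=` support p.2 >]
                then p.1 *~ orient (homog (vertices p.2)) (homog (vertices f)) else 0.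

Lemma chain_eq_refines1 k (F : seq (simplex K k)) g s : nonoverlapping F -> refines F s ->
  chain_eq [:: (g, s)] [seq (coef f [:: (g, s)], f) | f <- F].
Proof.
move=> nF Fs; pose p (f : simplex K k) := `[< support f `<=` support s >].
pose a (f : simplex K k) := g *~ orient (homog (vertices s)) (homog (vertices f)).
have -> : [seq (coef f [:: (g, s)], f) | f <- F] = [seq (if p f then a f else 0, f) | f <- F].
  by apply: eq_map => f; rewrite /coef big_seq1.
apply: chain_eq_trans (chain_eq_drop0 _ _ _).
have /choice[r rP] : forall f : simplex K k, exists f' : simplex K k, p f ->
    [/\ support f' = support f, relint f' = relint f, cooriented f' s &
      chain_eq [:: (g, f')] [:: (a f, f)]].
  move=> f; have [/asboolP/reorient[f' [h1 h2 h3 h4]]|_] := boolP (p f); last by exists f.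
  by exists f'.
have sub : subdivides (map r [seq f <- F | p f]) s.
  split.
  - elim: F nF {Fs} => //= f F IH /nonoverlapping_cons[fF nF]; case: ifP => pf; last exact: IH.
    rewrite map_cons; apply/nonoverlapping_cons; split; last exact: IH.
    move=> _ /mapP[f' + ->]; rewrite mem_filter => /andP[pf' f'F].
    by have [_ -> _ _] := rP f pf; have [_ -> _ _] := rP f' pf'; exact: fF.
  - by move=> _ /mapP[f + ->]; rewrite mem_filter => /andP[/rP[]].
  - apply/seteqP; split=> [x /Fs[t [tF ts xt]]|x [_ /= /mapP[f + ->]]].
      have pt : p t by exact/asboolP.
      exists (r t); last by have [-> _ _ _] := rP t pt.
      by apply: map_f; rewrite mem_filter pt.
    rewrite mem_filter => /andP[pf fF]; have [-> _ _ _] := rP f pf.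
    by move: pf => /asboolP; exact.
apply: chain_eq_trans (chain_eq_subdivide g sub) _.
rewrite -map_comp; set F' := [seq f <- F | p f].
have -> : [seq (g, r f) | f <- F'] = flatten [seq [:: (g, r f)] | f <- F'].
  by elim: F' => //= f F' ->.
have -> : [seq (a f, f) | f <- F'] = flatten [seq [:: (a f, f)] | f <- F'].
  by elim: F' => //= f F' ->.
apply: chain_eq_flatten => f; rewrite mem_filter => /andP[/rP[_ _ _ h] _].
exact: h.
Qed.

Lemma chain_eq_refines k (F : seq (simplex K k)) (P : formal_sum K G k) : nonoverlapping F ->
  (forall s, s \in map snd P -> refines F s) ->
  chain_eq P [seq (coef f P, f) | f <- F].
Proof.
move=> nF; elim: P => [|[g s] P IH] FP.
  apply: chain_eq_trans (_ : chain_eq _ [seq (if false then 0 else 0, f) | f <- F]) _.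
    have := chain_eq_drop0 F pred0 (fun=> 0 : G).
    by rewrite (eq_filter (a2 := pred0)) // filter_pred0.
  rewrite (_ : map _ _ = [seq (coef f [::], f) | f <- F]); first exact: chain_eq_refl.
  by apply: eq_map => f; rewrite /coef big_nil.
apply: (@chain_eq_trans _ _ _ _ _ _ ([seq (coef f [:: (g, s)], f) | f <- F] ++
   [seq (coef f P, f) | f <- F])).
  rewrite -(cat1s (g, s)); apply: chain_eq_cat.
    by apply: chain_eq_refines1 => //; apply: FP; rewrite mem_head.
  by apply: IH => t tP; apply: FP; rewrite inE tP orbT.
rewrite (_ : [seq (coef f ((g, s) :: P), f) | f <- F] =
  [seq (coef f [:: (g, s)] + coef f P, f) | f <- F]); first exact: chain_eq_addmap.
by apply: eq_map => f; rewrite /coef big_cons big_seq1.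
Qed.

Lemma refines_mem k (F : seq (simplex K k)) f s x : nonoverlapping F -> f \in F -> refines F s ->
  (homog (vertices s) <= homog (vertices f))%MS ->
  off_walls (walls F (vertices f)) x -> relint f x ->
  support s x -> support f `<=` support s.
Proof.
move=> nF fF Fs sf xA xf xs; have [t [tF ts xt]] := Fs x xs.
have tx : relint t x.
  apply: off_walls_relint tF xA xt; apply: submx_trans sf; exact: conv_hull_span.
suff tf : t = f by rewrite -tf.
move: nF fF tF; rewrite /nonoverlapping => /(pairwiseP f) nF /(nthP f)[i iF fi] /(nthP f)[j jF tj].
suff ij : i = j by rewrite -tj -ij fi.
apply: contrapT => ij.
have : (relint t `&` relint f) x by split.
have [h|h|h] := ltngtP i j; last by [].
  by have /asboolP := nF i j iF jF h; rewrite fi tj setIC => ->.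
by have /asboolP := nF j i jF iF h; rewrite fi tj => ->.
Qed.

Lemma coef_mult k (F : seq (simplex K k)) (P : formal_sum K G k) f x : nonoverlapping F ->
  (forall s, s \in map snd P -> refines F s) -> f \in F ->
  relint f x -> off_walls (walls F (vertices f)) x ->
  mult (homog (vertices f)) P x = coef f P.
Proof.
move=> nF FP fF xf xA; rewrite /mult /coef big_seq [RHS]big_seq; apply: eq_bigr => p pP.
have Fp : refines F p.2 by apply: FP; exact: map_f.
have [sf|/orient0 ->] := boolP (homog (vertices p.2) <= homog (vertices f))%MS; last first.
  by rewrite mulr0z !if_same.
congr (if _ then _ else _); apply/asboolP/asboolP => [|h].
  exact: refines_mem xA xf.
by apply: h; exact: relint_support.
Qed.

Lemma generic_coef k (F : seq (simplex K k)) (P Q : formal_sum K G k) f : nonoverlapping F ->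
  (forall s, s \in map snd P -> refines F s) ->
  (forall s, s \in map snd Q -> refines F s) -> f \in F ->
  generic_eq (vertices f) P Q -> coef f P = coef f Q.
Proof.
move=> nF FP FQ fF [A hA PQ].
have [c cA|x xf /off_walls_cat[xF xA]] :=
    @open_hull_generic _ _ _ (vertices f) (walls F (vertices f) ++ A).
  by move: cA; rewrite mem_cat => /orP[/wallsP|/hA].
rewrite -(coef_mult nF FP fF xf xF) -(coef_mult nF FQ fF xf xF) PQ //.
by have /relint_baryP[] := xf.
Qed.

(** For the converse both chains are written on a common refinement, where each coefficient is read
    at one generic point of its cell. Identities between chains thereby reduce to identities in
    [G]. *)
Lemma chain_eqP k (P Q : formal_sum K G k) :
  chain_eq P Q <-> forall s : simplex K k, generic_eq (vertices s) P Q.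
Proof.
split=> [PQ s|PQ]; first exact: chain_eq_generic.
have [F nF hF] := refinement (map snd P ++ map snd Q).
have FP s : s \in map snd P -> refines F s by move=> sP; apply: hF; rewrite mem_cat sP.
have FQ s : s \in map snd Q -> refines F s by move=> sQ; apply: hF; rewrite mem_cat sQ orbT.
apply: chain_eq_trans (chain_eq_refines nF FP) _.
apply: chain_eq_trans (chain_eq_sym (chain_eq_refines nF FQ)).
suff -> : [seq (coef f P, f) | f <- F] = [seq (coef f Q, f) | f <- F] by exact: chain_eq_refl.
by apply/eq_in_map => f fF; rewrite (generic_coef nF FP FQ fF (PQ f)).
Qed.

End Group.
End Multiplicity.

(** * Multiplicity of a boundary *)

Section Boundary.
Context {R : realType} {d : nat} {K : set 'rV[R]_d.+1}.
Implicit Types (c : 'cV[R]_(1 + d.+1)) (x y p : 'rV[R]_d.+1) (V : 'M[R]_d.+1).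

Lemma homog_col_mx p V : homog (col_mx p V) = col_mx (homog p) (homog V).
Proof. by rewrite /homog -col_mx_const -block_mxEh block_mxEv. Qed.

(** A vertex of [V] is moved along the normal [w], the linear part of a nonzero affine form that
    vanishes on [V]; [w] is nonzero because a constant form that vanishes on [V] is 0. *)
Lemma exists_apex V : row_free (homog V) ->
  exists p, row_free (homog (col_mx p V)).
Proof.
move=> Vf.
have [c [c0 Vc]] : exists c, c != 0 /\ homog V *m c = 0.
  have : cokermx (homog V) != 0.
    by rewrite -mxrank_eq0 mxrank_coker (eqP Vf) subn_eq0 -ltnNge.
  move=> /eqP h; have [j hj] : exists j, col j (cokermx (homog V)) != 0.
    apply: contrapT => /forallNP nh; apply: h; apply/matrixP => i j.
    have /negP/negPn/eqP/matrixP/(_ i 0) := nh j; by rewrite !mxE.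
  exists (col j (cokermx (homog V))); split=> //.
  by rewrite colE mulmxA mulmx_coker mul0mx.
pose w : 'rV[R]_d.+1 := (dsubmx c)^T.
have w0 : (w *m dsubmx c) 0 0 != 0.
  apply/negP => /eqP w0; have dc : dsubmx c = 0.
    apply/matrixP => i j; rewrite ord1 [RHS]mxE; apply/eqP; rewrite -sqrf_eq0; apply/eqP.
    move: w0; rewrite mxE; under eq_bigr do rewrite mxE -expr2.
    by move=> /psumr_eq0P; apply=> // l _; exact: sqr_ge0.
  have uc : usubmx c = 0.
    move: Vc; rewrite -{1}[c]vsubmxK /homog mul_row_col dc mulmx0 addr0.
    move=> /matrixP/(_ 0 0); rewrite !mxE big_ord1 !mxE mul1r => h.
    by apply/matrixP => i j; rewrite !ord1 [RHS]mxE -h mxE.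
  by move: c0; rewrite -[c]vsubmxK dc uc col_mx0 eqxx.
exists (row 0 V + w); apply: inj_row_free => u; rewrite homog_col_mx => uN.
have evp : homog (row 0 V + w) *m c = w *m dsubmx c.
  have -> : homog (row 0 V + w) = homog (row 0 V) + row_mx 0 w.
    by rewrite /homog add_row_mx addr0.
  rewrite mulmxDl -row_homog -row_mul Vc -{1}[c]vsubmxK mul_row_col mul0mx add0r.
  by rewrite row0 add0r.
move: uN; rewrite -[u]hsubmxK mul_row_col => uN.
have lu : lsubmx u = 0.
  have /(congr1 (mulmx^~ c)) := uN; rewrite mulmxDl -!mulmxA Vc mulmx0 addr0 mul0mx evp.
  move=> /matrixP/(_ 0 0)/eqP; rewrite mxE big_ord1 [X in _ == X]mxE.
  rewrite mulf_eq0 (negbTE w0) orbF => /eqP u0.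
  by rewrite [lsubmx u]mx11_scalar u0 raddf0.
move: uN; rewrite lu mul0mx add0r => /eqP.
by rewrite mulmx_free_eq0 // => /eqP ->; rewrite row_mx0.
Qed.

Lemma face_supportP (s : simplex K d.+1) i x :
  support (face i s) x <-> support s x /\ ev (facet_form (vertices s) i) x = 0.
Proof.
rewrite ev_facet; split=> [xf|[/support_baryP[xs x0] xi]].
  split; first exact: face_sub xf.
  case: xf => t [t0 t1] <-; rewrite -mul_extend0.
  have [|-> _] := bary_comb (t := extend0 i t) (simplex_free s).
    by rewrite sum_extend0.
  by rewrite mxE unlift_none.
have [xE x1] := bary_sum xs; set b := bary _ x in xE x1 x0 xi.
have bE : extend0 i (\row_j b 0 (lift i j)) = b.
  apply/rowP => j; rewrite mxE; case: unliftP => [h ->|->] /=.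
    by rewrite mxE.
  by rewrite xi.
rewrite /support /conv_hull /=; exists (\row_j b 0 (lift i j)); last by rewrite -mul_extend0 bE.
split=> [j|]; first by rewrite mxE.
by rewrite -(sum_extend0 i) bE.
Qed.

(** [D] expresses the vertices of [s] in the frame formed by the apex and [V]. The facet form kills
    [V], so column 0 of [D] has a single nonzero entry, in row [i]: the inverse of the value of the
    form at [p]. Expanding the determinant along this column produces the sign (-1)^i of the
    boundary operator. *)
Lemma face_orient (s : simplex K d.+1) V p i : row_free (homog V) ->
  row_free (homog (col_mx p V)) ->
  homog V *m facet_form (vertices s) i = 0 ->
  orient (homog (vertices s)) (homog (col_mx p V)) =
    sgz (ev (facet_form (vertices s) i) p) * (-1) ^+ i *
    orient (homog (vertices (face i s))) (homog V) /\
  ev (facet_form (vertices s) i) p != 0.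
Proof.
move=> Vf Wf Vi; set M : 'M[R]_(1 + d.+1) := homog (vertices s).
set N : 'M[R]_(1 + d.+1) := homog (col_mx p V); set b := ev _ p.
have Mu : M \in unitmx by rewrite -row_free_unit; exact: simplex_free.
have Nu : N \in unitmx by rewrite -row_free_unit; exact: Wf.
have [D DN] : exists D, D *m N = M by exists (M *m invmx N); rewrite mulmxKV.
have Nb : N *m facet_form (vertices s) i = col_mx b%:M 0.
  by rewrite /N homog_col_mx mul_col_mx Vi; congr col_mx; rewrite [LHS]mx11_scalar.
have Db j : D j 0 * b = (j == i)%:R.
  have : (D *m (N *m facet_form (vertices s) i)) j 0 = (j == i)%:R.
    rewrite mulmxA DN homog_facet; last exact: simplex_free.
    by rewrite mxE eqxx andbT.
  rewrite Nb mxE => <-; rewrite big_split_ord /= big_ord1 big1 ?addr0 => [|l _].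
    by rewrite col_mxEu mxE eqxx mulr1n; congr (D j _ * _); apply/val_inj.
  by rewrite col_mxEd mxE mulr0.
have b0 : b != 0.
  by apply/eqP => b0; have /eqP := Db i; rewrite b0 mulr0 eqxx eq_sym oner_eq0.
have D0 j : j != i -> D j 0 = 0.
  by move=> ji; have /eqP := Db j; rewrite (negbTE ji) mulf_eq0 (negbTE b0) orbF => /eqP.
split=> //.
pose B : 'M[R]_d.+1 := row' i (col' 0 D).
have faceE : homog (vertices (face i s)) = B *m homog V.
  have -> : homog (vertices (face i s)) = row' i M by exact: (esym (row'_homog (vertices s) i)).
  rewrite -DN.
  have -> : row' i (D *m N) = row' i D *m N.
    apply/matrixP => a l; rewrite 2![LHS]mxE [RHS]mxE; apply: eq_bigr => q _.
    by congr (_ * _); rewrite mxE.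
  rewrite /N homog_col_mx -[row' i D]hsubmxK mul_row_col.
  have -> : lsubmx (row' i D) = 0.
    apply/matrixP => a l; rewrite !mxE ord1.
    by rewrite -[RHS](D0 (lift i a)) 1?eq_sym ?neq_lift //; congr (D _ _); apply/val_inj.
  rewrite mul0mx add0r; congr (_ *m _).
  by apply/matrixP => a l; rewrite !mxE; congr (D _ _); apply/val_inj.
have -> : orient (homog (vertices (face i s))) (homog V) = sgz (\det B).
  by rewrite /orient faceE submxMl mulmxKp.
have -> : orient M N = sgz (\det D).
  by rewrite /orient submx_full ?row_full_unit // pinvmxE // -DN mulmxK.
have -> : \det D = D i 0 * ((-1) ^+ i * \det B).
  rewrite (expand_det_col D 0) (bigD1 i) //= big1 ?addr0 => [|j /D0 ->]; last by rewrite mul0r.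
  by rewrite /cofactor addn0.
have sD : sgz (D i 0) = sgz b.
  have := congr1 (@sgz R) (Db i); rewrite eqxx sgzM sgz1.
  case: (sgzP b) => h; rewrite ?mulr0 ?mulr1 ?mulrN1 // => e.
  by rewrite -[LHS]opprK e.
rewrite !sgzM sD mulrA; congr (_ * _ * _).
by rewrite -signr_odd -[RHS]signr_odd; case: odd; rewrite ?expr1 ?expr0 ?sgzN sgz1.
Qed.

End Boundary.

Section BoundaryMultiplicity.
Context {R : realType} {d : nat} {K : set 'rV[R]_d.+1} {G : zmodType}.
Implicit Types (c : 'cV[R]_(1 + d.+1)) (x y p : 'rV[R]_d.+1) (V : 'M[R]_d.+1).

Lemma ev_span0 V c x : aff_span V x -> homog V *m c = 0 -> ev c x = 0.
Proof. by move=> /submxP[D xD] Vc; rewrite /ev xD -mulmxA Vc mulmx0 mxE. Qed.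

Lemma ev_apex V c p x (e : R) : 
  ev c (x + e *: (p - row 0 V)) = ev c x + e * (ev c p - ev c (row 0 V)).
Proof.
rewrite ev_add; congr (_ + _ * _).
have := ev_add c (row 0 V) 1 (p - row 0 V); rewrite scale1r addrC subrK mul1r => ->.
by rewrite addrAC subrr add0r.
Qed.

Lemma near_ev_apex V c p x :
  \forall e \near 0^'+,
    Num.sg (ev c (x + e *: (p - row 0 V))) =
      (if ev c x == 0 then Num.sg (ev c p - ev c (row 0 V)) else Num.sg (ev c x)) /\
    Num.sg (ev c (x + (- e) *: (p - row 0 V))) =
      (if ev c x == 0 then - Num.sg (ev c p - ev c (row 0 V)) else Num.sg (ev c x)).
Proof.
have h1 := near_sgD (ev c x) (ev c p - ev c (row 0 V)).
have h2 := near_sgD (ev c x) (- (ev c p - ev c (row 0 V))).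
near=> e; rewrite !ev_apex -sgrN mulNr -mulrN; split; near: e; assumption.
Unshelve. all: by end_near. Qed.

Lemma ev_row0 V c : homog V *m c = 0 -> ev c (row 0 V) = 0.
Proof. by move=> Vc; rewrite ev_row Vc mxE. Qed.

Lemma near_off_walls V p (A : seq 'cV[R]_(1 + d.+1)) x :
  (forall c, c \in A -> homog (col_mx p V) *m c != 0) -> aff_span V x ->
  off_walls [seq c <- A | homog V *m c != 0] x ->
  \forall e \near 0^'+, off_walls A (x + e *: (p - row 0 V)) /\
    off_walls A (x + (- e) *: (p - row 0 V)).
Proof.
move=> hA xV xA.
have : \forall e \near 0^'+, forall c, c \in A ->
    ev c (x + e *: (p - row 0 V)) != 0 /\ ev c (x + (- e) *: (p - row 0 V)) != 0.
  apply: near_seq => c cA; apply: filterS (near_ev_apex V c p x) => e [h1 h2].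
  rewrite -sgr_eq0 h1 -[in X in _ /\ X]sgr_eq0 h2.
  have [Vc|Vc] := eqVneq (homog V *m c) 0.
    rewrite (ev_span0 xV Vc) eqxx ev_row0 // subr0 oppr_eq0 sgr_eq0.
    suff : ev c p != 0 by [].
    apply: contraNneq (hA c cA) => pc; rewrite homog_col_mx mul_col_mx Vc.
    by rewrite [homog p *m c]mx11_scalar -/(ev c p) pc raddf0 col_mx0.
  have cx : ev c x != 0 by apply: xA; rewrite mem_filter Vc.
  by rewrite (negbTE cx) sgr_eq0.
by apply: filterS => e h; split=> c /h[].
Qed.

Lemma support_facets (s : simplex K d.+1) x :
  support s x <-> forall i, 0 <= ev (facet_form (vertices s) i) x.
Proof.
have full : row_full (homog (vertices s) : 'M[R]_(1 + d.+1)).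
  by rewrite row_full_unit -row_free_unit; exact: simplex_free.
split=> [/support_baryP[_ h] i|h]; first by rewrite ev_facet.
apply/support_baryP; split=> [|i]; first exact: submx_full.
by rewrite -ev_facet.
Qed.

(** An affine form that vanishes on a hyperplane is unique up to a factor, whereas the forms of two
    different facets are independent. *)
Lemma facet_unique (s : simplex K d.+1) V p i j : row_free (homog V) ->
  row_free (homog (col_mx p V)) ->
  homog V *m facet_form (vertices s) i = 0 -> homog V *m facet_form (vertices s) j = 0 ->
  i = j.
Proof.
move=> Vf Wf Vi Vj; apply: contrapT => ij.
set bi := facet_form _ i in Vi; set bj := facet_form _ j in Vj.
have [_ pj0] := face_orient Vf Wf Vj.
have Wu : (homog (col_mx p V) : 'M[R]_(1 + d.+1)) \in unitmx by rewrite -row_free_unit.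
have z : ev bj p *: bi - ev bi p *: bj = 0.
  apply: (can_inj (mulKmx Wu)); rewrite mulmx0 homog_col_mx mul_col_mx.
  rewrite !mulmxBr -!scalemxAr Vi Vj !scaler0 subrr.
  rewrite [homog p *m bi]mx11_scalar [homog p *m bj]mx11_scalar -/(ev bi p) -/(ev bj p).
  by rewrite !scale_scalar_mx mulrC subrr col_mx0.
have := congr1 (fun A => homog (vertices s) *m A) z.
rewrite mulmx0 mulmxBr -!scalemxAr !homog_facet ?simplex_free // => /matrixP/(_ i 0)/eqP.
by rewrite !mxE !eqxx (introF eqP ij) /= mulr1 mulr0 subr0 (negbTE pj0).
Qed.

Lemma mult_boundary1 (s : simplex K d.+1) (g : G) V x :
  mult (homog V) (boundary [:: (g, s)]) x =
  \sum_i if `[< support (face i s) x >]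
    then (if odd i then - g else g) *~ orient (homog (vertices (face i s))) (homog V) else 0.
Proof. by rewrite /mult /boundary /= cats0 big_map big_enum. Qed.

(** If no facet lies in the hyperplane of [V], the two nearby points are on the same side of every
    facet and the jump is 0. Otherwise exactly one facet does, the simplex is on one side of the
    hyperplane only, and [face_orient] matches the sign of the jump with the orientation of that
    face. *)
Lemma mult_boundary_simplex (s : simplex K d.+1) V p x : row_free (homog V) ->
  row_free (homog (col_mx p V)) -> aff_span V x -> off_walls (walls [:: s] V) x ->
  \forall e \near 0^'+, forall g : G,
    mult (homog (col_mx p V)) [:: (g, s)] (x + e *: (p - row 0 V)) -
    mult (homog (col_mx p V)) [:: (g, s)] (x + (- e) *: (p - row 0 V)) =
    mult (homog V) (boundary [:: (g, s)]) x.
Proof.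
move=> Vf Wf xV xA; pose b i := facet_form (vertices s) i.
have : \forall e \near 0^'+, forall i, i \in enum 'I_d.+2 ->
    Num.sg (ev (b i) (x + e *: (p - row 0 V))) =
      (if ev (b i) x == 0 then Num.sg (ev (b i) p - ev (b i) (row 0 V)) else Num.sg (ev (b i) x)) /\
    Num.sg (ev (b i) (x + (- e) *: (p - row 0 V))) =
      (if ev (b i) x == 0 then - Num.sg (ev (b i) p - ev (b i) (row 0 V)) else Num.sg (ev (b i) x)).
  by apply: near_seq => i _; exact: near_ev_apex.
apply: filterS => e he g; rewrite mult_boundary1 !mult1.
have bx i : homog V *m b i != 0 -> ev (b i) x != 0.
  by move=> Vi; apply: xA; apply: mem_walls => //; rewrite mem_head.
have face0 i : homog V *m b i != 0 -> ~ support (face i s) x.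
  by move=> /bx + /face_supportP[_]; rewrite -/(b i) => /eqP.
have [[i0 Vi0]|nv] := pselect (exists i, homog V *m b i = 0); last first.
  have nz i : ev (b i) x != 0 by apply: bx; apply/eqP => Vi; apply: nv; exists i.
  rewrite big1 => [|i _]; last first.
    by case: asboolP => // /face0; case; apply/eqP => Vi; apply: nv; exists i.
  suff -> : support s (x + e *: (p - row 0 V)) = support s (x + - e *: (p - row 0 V)).
    by rewrite subrr.
  apply/propext; rewrite !support_facets; split=> h i; have [h1 h2] := he i (mem_enum _ _).
    by rewrite -sgr_ge0 h2; have := h i; rewrite -sgr_ge0 h1 (negbTE (nz i)).
  by rewrite -sgr_ge0 h1; have := h i; rewrite -sgr_ge0 h2 (negbTE (nz i)).
have nz j : j != i0 -> homog V *m b j != 0.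
  by apply: contra_neq => Vj; exact: (facet_unique Vf Wf Vj Vi0).
have [oE bp] := face_orient Vf Wf Vi0; rewrite -/(b i0) in oE bp.
have x0 := ev_span0 xV Vi0.
(* The forms of the other facets do not vanish at [x], so their inequalities hold at each of the two
   nearby points exactly when they hold at [x]. *)
pose Pos := forall j, j != i0 -> 0 <= ev (b j) x.
have faceP : support (face i0 s) x <-> Pos.
  rewrite face_supportP support_facets; split=> [[h _] j _|h]; first exact: h.
  split=> // i; have [->|/h //] := eqVneq i i0.
  by rewrite [leRHS]x0.
have plusP : support s (x + e *: (p - row 0 V)) <-> Pos /\ 0 <= ev (b i0) p.
  rewrite support_facets; split=> [h|[h hp] i].
    split=> [j ji|]; last first.
      have := h i0; rewrite -sgr_ge0 (he i0 (mem_enum _ _)).1 x0 eqxx.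
      by rewrite (ev_row0 Vi0) subr0 sgr_ge0.
    by have := h j; rewrite -sgr_ge0 (he j (mem_enum _ _)).1 (negbTE (bx _ (nz j ji))) sgr_ge0.
  rewrite -sgr_ge0 (he i (mem_enum _ _)).1; have [->|ii] := eqVneq i i0.
    by rewrite x0 eqxx (ev_row0 Vi0) subr0 sgr_ge0.
  by rewrite (negbTE (bx _ (nz i ii))) sgr_ge0; exact: h.
have minusP : support s (x + - e *: (p - row 0 V)) <-> Pos /\ ev (b i0) p <= 0.
  rewrite support_facets; split=> [h|[h hp] i].
    split=> [j ji|]; last first.
      have := h i0; rewrite -sgr_ge0 (he i0 (mem_enum _ _)).2 x0 eqxx.
      by rewrite (ev_row0 Vi0) subr0 oppr_ge0 sgr_le0.
    by have := h j; rewrite -sgr_ge0 (he j (mem_enum _ _)).2 (negbTE (bx _ (nz j ji))) sgr_ge0.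
  rewrite -sgr_ge0 (he i (mem_enum _ _)).2; have [->|ii] := eqVneq i i0.
    by rewrite x0 eqxx (ev_row0 Vi0) subr0 oppr_ge0 sgr_le0.
  by rewrite (negbTE (bx _ (nz i ii))) sgr_ge0; exact: h.
rewrite (bigD1 i0) //= big1 ?addr0 => [|j /nz/face0 nf]; last by case: asboolP.
rewrite oE (propext plusP) (propext minusP) (propext faceP).
have oddE (z : int) : g *~ ((-1) ^+ i0 * z) = (if odd i0 then - g else g) *~ z.
  rewrite -signr_odd; case: odd; rewrite ?expr1 ?expr0 ?mul1r // mulN1r mulrNz.
  by rewrite mulNrz.
have [pos|npos] := pselect Pos; last first.
  rewrite asboolF; last by case.
  rewrite asboolF; last by case.
  by rewrite asboolF // subrr.
rewrite (asboolT pos).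
have [bp0|bp0|bp0] := ltgtP (ev (b i0) p) 0; last by rewrite bp0 eqxx in bp.
- rewrite asboolF; last by case.
  rewrite (asboolT (conj pos isT)).
  by rewrite ltr0_sgz // -mulrA mulN1r mulrNz sub0r opprK oddE.
- rewrite (asboolT (conj pos isT)) asboolF; last by case.
  by rewrite gtr0_sgz // -mulrA mul1r subr0 oddE.
Qed.

(** The number [e] is chosen from the simplexes alone, before the coefficients: one pair of nearby
    points serves all lifts of a chain at once. *)
Lemma mult_boundary (l : seq (simplex K d.+1)) V p x : row_free (homog V) ->
  row_free (homog (col_mx p V)) -> aff_span V x -> off_walls (walls l V) x ->
  \forall e \near 0^'+, forall Q : formal_sum K G d.+1, map snd Q = l ->
    mult (homog (col_mx p V)) Q (x + e *: (p - row 0 V)) -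
    mult (homog (col_mx p V)) Q (x + (- e) *: (p - row 0 V)) =
    mult (homog V) (boundary Q) x.
Proof.
move=> Vf Wf xV; elim: l => [|s l IH].
  move=> _; apply: nearW => e [|//] _.
  by rewrite (_ : boundary [::] = [::]) // !mult_nil subrr.
rewrite -cat1s walls_cat => /off_walls_cat[xs /IH h].
have := mult_boundary_simplex Vf Wf xV xs; move: h.
apply: filterS2 => e hl hs [//|[g _] Q] [-> Ql].
have -> : boundary ((g, s) :: Q) = boundary [:: (g, s)] ++ boundary Q.
  by rewrite /boundary /= cats0.
rewrite mult_cat -(hl Q Ql) -hs.
by rewrite mult_cons [X in _ - X]mult_cons opprD addrACA.
Qed.

Lemma boundary_eq (Q Q' : formal_sum K G d.+1) :
  chain_eq Q Q' -> chain_eq (boundary Q) (boundary Q').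
Proof.
move=> QQ; apply/chain_eqP => s; set V := vertices s.
have Vf : row_free (homog V) := simplex_free s.
have [p Wf] := exists_apex Vf.
have [A hA AQ] := chain_eq_generic Wf QQ.
exists (walls (map snd Q) V ++ walls (map snd Q') V ++ [seq c <- A | homog V *m c != 0]).
  move=> c; rewrite !mem_cat => /or3P[/wallsP|/wallsP|] //.
  by rewrite mem_filter => /andP[].
move=> x xV /off_walls_cat[xQ /off_walls_cat[xQ' xA]].
have [e [hQ hQ' [e1 e2]]] : exists e, [/\
    mult (homog (col_mx p V)) Q (x + e *: (p - row 0 V)) -
      mult (homog (col_mx p V)) Q (x + (- e) *: (p - row 0 V)) =
      mult (homog V) (boundary Q) x,
    mult (homog (col_mx p V)) Q' (x + e *: (p - row 0 V)) -
      mult (homog (col_mx p V)) Q' (x + (- e) *: (p - row 0 V)) =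
      mult (homog V) (boundary Q') x &
    off_walls A (x + e *: (p - row 0 V)) /\ off_walls A (x + (- e) *: (p - row 0 V))].
  apply: (@filter_ex _ 0^'+); near=> e; split; near: e.
  - by apply: filterS (mult_boundary Vf Wf xV xQ) => e; exact.
  - by apply: filterS (mult_boundary Vf Wf xV xQ') => e; exact.
  - exact: near_off_walls.
have full y : aff_span (col_mx p V) y.
  apply: submx_full; have := row_full_unit (homog (col_mx p V) : 'M[R]_(1 + d.+1)).
  by rewrite -row_free_unit Wf.
by rewrite -hQ -hQ' !AQ.
Unshelve. all: by end_near. Qed.

End BoundaryMultiplicity.

(** * Superadditivity of the Hausdorff measure *)

Section EuclideanNorm.
Context {R : realType} {n : nat}.
Implicit Types (x y : 'rV[R]_n).

Lemma enormZ (a : R) x : enorm (a *: x) = `|a| * enorm x.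
Proof.
rewrite /enorm; under eq_bigr do rewrite mxE exprMn.
by rewrite -mulr_sumr sqrtrM ?sqr_ge0 // sqrtr_sqr.
Qed.

Lemma norm_le_enorm x : `|x| <= enorm x.
Proof.
rewrite [leLHS]mx_normrE; apply/bigmax_leP; split=> [|[i j] _ /=]; first exact: sqrtr_ge0.
rewrite ord1 -sqrtr_sqr ler_wsqrtr // (bigD1 j) //= lerDl sumr_ge0 // => l _.
exact: sqr_ge0.
Qed.

Lemma continuous_ev c : continuous (@ev R n c).
Proof.
have -> : @ev R n c = fun x => c (lshift _ 0) 0 + \sum_j x 0 j * c (rshift 1 j) 0.
  apply/funext => x; rewrite /ev mxE big_split_ord /= big_ord1; congr (_ + _).
    by rewrite row_mxEl mxE mul1r.
  by apply: eq_bigr => j _; rewrite row_mxEr.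
move=> x; apply: (@continuousD R R 'rV[R]_n); first exact: cst_continuous.
apply: continuous_big => [|j _ y]; first exact: add_continuous.
apply: continuousM; last exact: cst_continuous.
exact: coord_continuous.
Qed.

Lemma closed_conv_hull k (V : 'M[R]_(k.+1, n)) : row_free (homog V) -> closed (conv_hull V).
Proof.
move=> Vf; have -> : conv_hull V = \bigcap_(c in [set` halfspaces V]) [set x | 0 <= ev c x].
  by apply/seteqP; split=> x; rewrite halfspacesP.
apply: closed_bigI => c _; apply: (preimage_closed (f := ev c) (D := [set a | 0 <= a])).
  by move=> x _; exact: continuous_ev.
exact: closed_ge.
Qed.

Lemma compact_separation (A B : set 'rV[R]_n) : compact A -> compact B ->
  A `&` B = set0 -> exists2 e : R, 0 < e & forall x y, A x -> B y -> e <= enorm (x - y).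
Proof.
move=> cA cB AB0.
have [AB|AB] := pselect (A `*` B !=set0); last first.
  by exists 1 => // x y Ax By; exfalso; apply: AB; exists (x, y).
have [|p] := compact_EVT_min (f := fun p : 'rV[R]_n * 'rV[R]_n => `|p.1 - p.2|) AB (compact_setX cA cB).
  apply: continuous_subspaceT => p; apply: cvg_norm; apply: cvgB; first exact: cvg_fst.
  exact: cvg_snd.
rewrite inE => -[Ap Bp] pmin; exists `|p.1 - p.2|.
  rewrite normr_gt0 subr_eq0; apply/eqP => p12.
  by have : (A `&` B) p.1 by [split=> //; rewrite p12]; rewrite AB0.
move=> x y Ax By; apply: le_trans (norm_le_enorm _).
by apply: (pmin (x, y)); rewrite inE.
Qed.

End EuclideanNorm.

Section HausdorffMeasure.
Context {R : realType} {n : nat}.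
Implicit Types (A B : set 'rV[R]_n) (x y : 'rV[R]_n).
Local Open Scope ereal_scope.

Lemma unit_ball_volume_ge0 k : (0 <= unit_ball_volume R k)%R.
Proof.
suff : (0 <= unit_ball_volume R k)%R /\ (0 <= unit_ball_volume R k.+1)%R by case.
elim: k => [|k [v0 v1]]; first by rewrite /= ler01 ler0n.
by split=> //=; rewrite !mulr_ge0 // ?invr_ge0 ?ler0n ?pi_ge0.
Qed.

Lemma diam_ge0 A : (0 <= diam A)%R.
Proof.
rewrite /diam; set E := [set _ | _ in _]; have [hs|hs] := pselect (has_sup E); last first.
  by rewrite sup_out.
have [[r Er] ub] := hs; apply: le_trans (ub_le_sup ub Er).
by case: Er => p _ <-; exact: sqrtr_ge0.
Qed.

Lemma diam_weight_ge0 k A : 0 <= diam_weight k A.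
Proof.
rewrite /diam_weight; case: ifP => // _; rewrite lee_fin mulr_ge0 ?unit_ball_volume_ge0 //.
by rewrite exprn_ge0 // divr_ge0 ?diam_ge0.
Qed.

Lemma diam_weight0 k : diam_weight k (set0 : set 'rV[R]_n) = 0.
Proof. by rewrite /diam_weight eqxx. Qed.

Lemma le_hausdorff k A B : A `<=` B -> hausdorff k A <= hausdorff k B.
Proof.
move=> AB; apply: ge_ereal_sup => _ [e /= e0 <-].
apply: (@le_trans _ _ (hausdorff_pre k e B)); last by apply: ereal_sup_ubound; exists e.
apply: le_ereal_inf_tmp => _ [F [BF Fe] <-]; apply: ereal_inf_lbound.
by exists F => //; split=> //; exact: subset_trans AB BF.
Qed.

Lemma le_hausdorff_pre k (e e' : R) A : (e <= e')%R ->
  hausdorff_pre k e' A <= hausdorff_pre k e A.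
Proof.
move=> ee; apply: le_ereal_inf_tmp => _ [F [AF Fe] <-]; apply: ereal_inf_lbound.
by exists F => //; split=> // i x y Fx Fy; apply: le_trans ee; exact: (Fe i x y).
Qed.

Lemma hausdorff_pre_ge0 k (e : R) A : 0 <= hausdorff_pre k e A.
Proof.
apply: le_ereal_inf_tmp => _ [F _ <-]; apply: nneseries_ge0 => i _ _.
exact: diam_weight_ge0.
Qed.

Lemma ereal_supD_le (S T : set \bar R) C : 
  (forall s t, S s -> T t -> s + t <= C) -> S !=set0 -> T !=set0 ->
  (forall s, S s -> 0 <= s) -> (forall t, T t -> 0 <= t) ->
  ereal_sup S + ereal_sup T <= C.
Proof.
move=> ST [s0 Ss0] [t0 Tt0] S0 T0.
case: C ST => [c| |] ST; last 2 first.
- exact: leey.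
- have := ST _ _ Ss0 Tt0; rewrite leeNy_eq => /eqP h.
  by have := adde_ge0 (S0 _ Ss0) (T0 _ Tt0); rewrite h leeNy_eq.
have Sfin s : S s -> s \is a fin_num.
  move=> Ss; rewrite ge0_fin_numE ?S0 //; apply: (@le_lt_trans _ _ c%:E); last exact: ltry.
  by apply: le_trans (ST _ _ Ss Tt0); rewrite leeDl // T0.
have supT s : S s -> ereal_sup T <= c%:E - s.
  move=> Ss; apply: ge_ereal_sup => t Tt; rewrite leeBrDr ?Sfin // addeC.
  exact: ST.
have supTfin : ereal_sup T \is a fin_num.
  rewrite ge0_fin_numE; last by apply: le_trans (T0 _ Tt0) _; exact: ereal_sup_ubound.
  apply: le_lt_trans (supT _ Ss0) _; apply: (@le_lt_trans _ _ c%:E); last exact: ltry.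
  by rewrite leeBlDr ?Sfin // leeDl // S0.
rewrite -leeBrDr //; apply: ge_ereal_sup => s Ss; rewrite leeBrDr // addeC -leeBrDr ?Sfin //.
exact: supT.
Qed.

(** Carathéodory's argument: a set of diameter at most e/2 cannot meet both [A] and [B], so a fine
    cover of the union splits into a cover of [A] and a cover of [B] with no term counted twice. *)
Lemma hausdorff_separated k A B (e : R) : (0 < e)%R ->
  (forall x y, A x -> B y -> (e <= enorm (x - y))%R) ->
  hausdorff k A + hausdorff k B <= hausdorff k (A `|` B).
Proof.
move=> e0 AB; apply: ereal_supD_le; last 4 first.
- by exists (hausdorff_pre k 1 A); exists 1%R => //=.
- by exists (hausdorff_pre k 1 B); exists 1%R => //=.
- by move=> _ [? _ <-]; exact: hausdorff_pre_ge0.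
- by move=> _ [? _ <-]; exact: hausdorff_pre_ge0.
move=> _ _ [a /= a0 <-] [b /= b0 <-].
pose m : R := (Num.min (Num.min a b) (e / 2))%R; have m0 : (0 < m)%R by rewrite !lt_min a0 b0 divr_gt0.
apply: (@le_trans _ _ (hausdorff_pre k m (A `|` B))); last first.
  by apply: ereal_sup_ubound; exists m.
apply: (@le_trans _ _ (hausdorff_pre k m A + hausdorff_pre k m B)).
  by apply: leeD; apply: le_hausdorff_pre; rewrite !ge_min lexx ?orbT.
apply: le_ereal_inf_tmp => _ [F [ABF Fm] <-].
pose meetA i := `[< F i `&` A !=set0 >].
pose FA i := if meetA i then F i else set0; pose FB i := if meetA i then set0 else F i.
have FAB i : diam_weight k (F i) = diam_weight k (FA i) + diam_weight k (FB i).
  rewrite /FA /FB; case: ifP => _; rewrite diam_weight0 ?adde0 //.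
  by rewrite add0e.
under eq_eseriesr do rewrite FAB.
rewrite nneseriesD; [|by move=> i _ _; exact: diam_weight_ge0..].
apply: leeD; apply: ereal_inf_lbound.
- exists FA => //; split=> [x Ax|i x y].
    have [i _ Fx] := ABF x (or_introl Ax); exists i => //; rewrite /FA ifT //.
    by apply/asboolP; exists x.
  by rewrite /FA; case: ifP => // _; exact: Fm.
- exists FB => //; split=> [x Bx|i x y].
    have [i _ Fx] := ABF x (or_intror Bx); exists i => //; rewrite /FB ifF //.
    apply/asboolP => -[y [Fy Ay]]; have := Fm i y x Fy Fx; apply/negP; rewrite -ltNge.
    apply: lt_le_trans (AB _ _ Ay Bx); rewrite gt_min; apply/orP; right.
    by rewrite ltr_pdivrMr // ltr_pMr // ltr1n.
  by rewrite /FB; case: ifP => // _; exact: Fm.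
Qed.

(** The supremum of an empty or unbounded set is 0 by convention; the point in the preimage and the
    bound [e] make the suprema in [diam] genuine. *)
Lemma diam_weight_scale k (f : 'rV[R]_n -> 'rV[R]_n) (a e : R) A : (0 < a)%R ->
  (forall x y, enorm (f x - f y) = a * enorm (x - y))%R ->
  (exists x, A (f x)) -> (forall x y, A x -> A y -> enorm (x - y) <= e)%R ->
  (a ^+ k)%:E * diam_weight k (f @^-1` A) <= diam_weight k A.
Proof.
move=> a0 fa [x0 Ax0] Ae.
rewrite /diam_weight ifF; last by apply/eqP => /seteqP[/(_ x0 Ax0)].
rewrite ifF; last by apply/eqP => /seteqP[/(_ _ Ax0)].
rewrite -EFinM lee_fin mulrCA ler_wpM2l ?unit_ball_volume_ge0 // -exprMn.
rewrite lerXn2r ?nnegrE ?mulr_ge0 ?divr_ge0 ?diam_ge0 ?(ltW a0) // mulrA ler_wpM2r //.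
rewrite mulrC -ler_pdivlMr //; apply: ge_sup.
  by exists (enorm (x0 - x0)); exists (x0, x0).
move=> _ [[x y] /= [Ax Ay] <-]; rewrite ler_pdivlMr // mulrC -fa.
apply: ub_le_sup; last by exists (f x, f y).
by exists e => _ [[u v] /= [Au Av] <-]; exact: Ae.
Qed.

Lemma hausdorff_scale k (f : 'rV[R]_n -> 'rV[R]_n) (a : R) A : (0 < a)%R ->
  (forall x y, enorm (f x - f y) = a * enorm (x - y))%R ->
  (a ^+ k)%:E * hausdorff k A <= hausdorff k (f @` A).
Proof.
move=> a0 fa; have ak0 : (0 < a ^+ k)%R by rewrite exprn_gt0.
rewrite -lee_pdivlMl //; apply: ge_ereal_sup => _ [e /= e0 <-].
rewrite lee_pdivlMl //.
apply: (@le_trans _ _ (hausdorff_pre k (a * e) (f @` A))); last first.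
  by apply: ereal_sup_ubound; exists (a * e)%R => //=; rewrite mulr_gt0.
apply: le_ereal_inf_tmp => _ [F [AF Fe] <-].
apply: (@le_trans _ _ ((a ^+ k)%:E * \sum_(0 <= i <oo) diam_weight k (f @^-1` F i))).
  apply: lee_wpmul2l; first by rewrite lee_fin ltW.
  apply: ereal_inf_lbound.
  exists (fun i => f @^-1` F i) => //; split=> [x Ax|i x y Fx Fy].
    by have [i _ Fi] := AF (f x) (imageP f Ax); exists i.
  by rewrite -(ler_pM2l a0) -fa; exact: Fe Fx Fy.
rewrite -nneseriesZl; last by move=> i _; exact: diam_weight_ge0.
apply: lee_nneseries => [i _ _|i _].
  by rewrite mule_ge0 ?diam_weight_ge0 // lee_fin ltW.
have [Fi|Fi] := pselect (exists x, F i (f x)).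
  by apply: diam_weight_scale Fi _ => // x y; exact: Fe.
rewrite (_ : f @^-1` F i = set0); last first.
  by apply/seteqP; split=> // x Fx; apply: Fi; exists x.
by rewrite diam_weight0 mule0 diam_weight_ge0.
Qed.

End HausdorffMeasure.

Section Superadditivity.
Context {R : realType} {n : nat} {K : set 'rV[R]_n}.
Local Open Scope ereal_scope.

Lemma bernoulli_ge (e : R) k : (0 <= e <= 1)%R -> (1 - k%:R * e <= (1 - e) ^+ k)%R.
Proof.
move=> /andP[e0 e1]; elim: k => [|k IH]; first by rewrite mul0r subr0 expr0.
rewrite exprS; apply: le_trans (ler_wpM2l _ IH); last by rewrite subr_ge0.
rewrite -natr1 mulrDl mul1r -subr_ge0.
have -> : ((1 - e) * (1 - k%:R * e) - (1 - (k%:R * e + e)) = k%:R * e ^+ 2)%R by ring.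
by rewrite mulr_ge0 // sqr_ge0.
Qed.

(* Shrinking each simplex towards a point of its relative interior makes the
   family pairwise separated, and costs only a factor tending to 1. *)
Lemma hausdorff_nonoverlapping k (l : seq (simplex K k)) A : compact K ->
  nonoverlapping l -> (forall t, t \in l -> support t `<=` A) ->
  \sum_(t <- l) hausdorff k (support t) <= hausdorff k A.
Proof.
move=> Kc nl lA; set S := \sum_(t <- l) _.
have S0 : 0 <= S by apply: sume_ge0 => t _; exact: hausdorff_ge0.
have /choice[b bP] : forall t : simplex K k, exists b, relint t b.
  by move=> t; exact: open_hull_neq0.
pose f (e : R) t (x : 'rV[R]_n) := ((1 - e) *: x + e *: b t)%R.
have shrink e : (0 < e < 1)%R -> ((1 - e) ^+ k)%:E * S <= hausdorff k A.
  move=> /andP[e0 e1]; have e10 : (0 < 1 - e)%R by rewrite subr_gt0.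
  have fe t x y : (enorm (f e t x - f e t y) = (1 - e) * enorm (x - y))%R.
    by rewrite /f opprD addrACA subrr addr0 -scalerBr enormZ gtr0_norm.
  have frel t : f e t @` support t `<=` relint t.
    by move=> _ [x xt <-]; apply: open_hull_comb; [rewrite e0 ltW| |exact: bP].
  have fc t : compact (f e t @` support t).
    apply: continuous_compact.
      apply: continuous_subspaceT => x.
      apply: (@continuousD R 'rV[R]_n 'rV[R]_n (fun x => (1 - e) *: x)%R (fun=> e *: b t)%R).
        exact: scaler_continuous.
      exact: cst_continuous.
    apply: subclosed_compact Kc (@vertices_sub _ _ _ _ t).
    by apply: closed_conv_hull; exact: simplex_free.
  suff [_ h] : compact (\bigcup_(t in [set` l]) f e t @` support t) /\
      \sum_(t <- l) hausdorff k (f e t @` support t) <=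
      hausdorff k (\bigcup_(t in [set` l]) f e t @` support t).
    apply: (@le_trans _ _ (hausdorff k (\bigcup_(t in [set` l]) f e t @` support t))).
      apply: le_trans h; rewrite ge0_sume_distrr => [|t _]; last exact: hausdorff_ge0.
      by apply: lee_sum => t _; apply: hausdorff_scale.
    apply: le_hausdorff => x [t /= tl /frel xt]; apply: (lA t tl).
    exact: relint_support.
  elim: l nl {lA S S0} => [|t l IH] /=.
    move=> _; rewrite set_nil bigcup_set0 big_nil; split; last exact: hausdorff_ge0.
    exact: compact0.
  move=> /nonoverlapping_cons[tl /IH[cl hl]].
  have -> : \bigcup_(u in [set` t :: l]) f e u @` support u =
     f e t @` support t `|` \bigcup_(u in [set` l]) f e u @` support u.
    apply/seteqP; split=> x.
      by move=> [u /=]; rewrite inE => /predU1P[->|ul] ux; [left|right; exists u].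
    by case=> [tx|[u /= ul ux]]; [exists t|exists u] => //=; rewrite inE ?eqxx ?ul ?orbT.
  split; first exact: compactU.
  rewrite big_cons; have [|m m0 hm] := compact_separation (fc t) cl.
    apply/seteqP; split=> // x [/frel xt [u /= ul /frel xu]].
    have : (relint t `&` relint u) x by split.
    by rewrite tl.
  by apply: le_trans (hausdorff_separated _ m0 hm); rewrite leeD2l.
case: (hausdorff k A) shrink => [h| |] shrink; last 2 first.
- exact: leey.
- have h2 : (0 < (2^-1 : R) < 1)%R by rewrite invr_gt0 ltr0n /= invf_lt1 // ltr1n.
  have := shrink (2^-1)%R h2; rewrite leeNy_eq => /eqP h; exfalso.
  suff : 0 <= ((1 - 2^-1) ^+ k)%:E * S by rewrite h.
  by rewrite mule_ge0 // lee_fin exprn_ge0 // subr_ge0 invf_le1 // ler1n.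
have half : (0 < (2^-1 : R) < 1)%R by rewrite invr_gt0 ltr0n /= invf_lt1 // ltr1n.
have half0 : (0 < (1 - 2^-1 : R) ^+ k)%R by rewrite exprn_gt0 // subr_gt0; case/andP: half.
have Sfin : S \is a fin_num.
  rewrite ge0_fin_numE //; have := shrink (2^-1)%R half; rewrite -lee_pdivlMl // => /le_lt_trans; apply.
  by rewrite -EFinM ltry.
rewrite -(fineK Sfin) lee_fin; set s := fine S.
have s0 : (0 <= s)%R by exact: fine_ge0.
apply/ler_addgt0Pr => e e0.
(* By Bernoulli's inequality the factor [(1 - a) ^+ k] costs at most k a s, which this choice keeps
   below [e]; the summand 1 avoids a zero denominator. *)
pose a : R := (Num.min 2^-1 (e / (k%:R * s + 1)))%R.
have q0 : (0 < k%:R * s + 1)%R by rewrite ltr_wpDl // mulr_ge0.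
have a01 : (0 < a < 1)%R.
  by case/andP: half => h0 h1; rewrite lt_min h0 divr_gt0 //= gt_min h1.
have := shrink a a01; rewrite -(fineK Sfin) -EFinM lee_fin -/s => hs.
have ha : (a * (k%:R * s + 1) <= e)%R.
  by rewrite -ler_pdivlMr // ge_min lexx orbT.
have hb : (1 - k%:R * a <= (1 - a) ^+ k)%R.
  by apply: bernoulli_ge; case/andP: a01 => a0 a1; rewrite !ltW.
have : ((1 - k%:R * a) * s <= h)%R by apply: le_trans hs; rewrite ler_wpM2r.
nra.
Qed.

End Superadditivity.

(** * Mass and flat norm *)

Section ChainAlgebra.
Context {R : realType} {n : nat} {K : set 'rV[R]_n} {G : zmodType}.

(** Turns rearrangements of formal sums into computations in the abelian group [G]. *)
Lemma chain_eq_mult k (P Q : formal_sum K G k) :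
  (forall N x, mult N P x = mult N Q x) -> chain_eq P Q.
Proof. by move=> PQ; apply/chain_eqP => s; exists [::]. Qed.

Lemma chain_eq_opp k (P Q : formal_sum K G k) :
  chain_eq P Q -> chain_eq (chain_opp P) (chain_opp Q).
Proof.
move=> /chain_eqP PQ; apply/chain_eqP => s; have [A hA AE] := PQ s.
by exists A => // x xs xA; rewrite !mult_opp AE.
Qed.

Lemma chain_eq_sub k (P P' Q Q' : formal_sum K G k) :
  chain_eq P P' -> chain_eq Q Q' -> chain_eq (chain_sub P Q) (chain_sub P' Q').
Proof. by move=> PP QQ; apply: chain_eq_cat => //; exact: chain_eq_opp. Qed.

Lemma boundary_cat k (P Q : formal_sum K G k.+1) :
  boundary (P ++ Q) = boundary P ++ boundary Q.
Proof. by rewrite /boundary map_cat flatten_cat. Qed.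

Lemma boundary_opp k (P : formal_sum K G k.+1) :
  boundary (chain_opp P) = chain_opp (boundary P).
Proof.
rewrite /boundary /chain_opp map_flatten -!map_comp; congr flatten.
apply: eq_map => p /=; rewrite -map_comp; apply: eq_map => i /=.
by case: odd.
Qed.

Lemma chain_oppK k (P : formal_sum K G k) : chain_opp (chain_opp P) = P.
Proof.
by rewrite /chain_opp -map_comp map_id_in // => -[g s] _ /=; rewrite opprK.
Qed.

End ChainAlgebra.

Section Mass.
Context {R : realType} {n : nat} {K : set 'rV[R]_n} {G : normedAbGroup R}.
Hypothesis K_compact : compact K.
Local Open Scope ereal_scope.

Lemma ngnorm_ge0 (g : G) : (0 <= ngnorm g)%R.
Proof.
have := ngnormD g (- g); rewrite subrr ngnorm0 ngnormN => h; lra.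
Qed.

Lemma ngnorm_sum (I : Type) (r : seq I) (F : I -> G) :
  (ngnorm (\sum_(i <- r) F i) <= \sum_(i <- r) ngnorm (F i))%R.
Proof.
elim: r => [|i r IH]; first by rewrite !big_nil ngnorm0.
by rewrite !big_cons; apply: le_trans (ngnormD _ _) _; rewrite lerD2l.
Qed.

Lemma ngnorm_orient m k (g : G) (M N : 'M[R]_(k, m)) : (ngnorm (g *~ orient M N) <= ngnorm g)%R.
Proof.
case: (orient_cases M N) => ->; rewrite ?mulr1z ?mulr0z ?ngnorm0 ?ngnorm_ge0 //.
by rewrite mulrN1z ngnormN.
Qed.

Definition weight k (P : formal_sum K G k) : \bar R :=
  \sum_(q <- P) (ngnorm q.1)%:E * hausdorff k (support q.2).

Lemma weight_ge0 k (P : formal_sum K G k) : 0 <= weight P.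
Proof.
by apply: sume_ge0 => q _; rewrite mule_ge0 ?hausdorff_ge0 // lee_fin ngnorm_ge0.
Qed.

Lemma weight_cat k (P Q : formal_sum K G k) : weight (P ++ Q) = weight P + weight Q.
Proof. exact: big_cat. Qed.

Lemma weight_opp k (P : formal_sum K G k) : weight (chain_opp P) = weight P.
Proof. by rewrite /weight big_map; apply: eq_bigr => p _ /=; rewrite ngnormN. Qed.

Lemma mass_ge0 k (P : formal_sum K G k) : 0 <= mass P.
Proof. by apply: le_ereal_inf_tmp => _ [Q _ <-]; exact: weight_ge0. Qed.

Lemma mass_lt k (P : formal_sum K G k) r : mass P < r ->
  exists Q, [/\ chain_eq P Q, nonoverlapping (map snd Q) & weight Q < r].
Proof. by move=> /ereal_inf_lt[_ [Q [PQ nQ] <-] Qr]; exists Q. Qed.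

Lemma le_mass k (P Q : formal_sum K G k) : chain_eq P Q -> mass P <= mass Q.
Proof.
move=> PQ; apply: le_ereal_inf_tmp => _ [S [QS nS] <-]; apply: ereal_inf_lbound.
by exists S => //; split=> //; exact: chain_eq_trans QS.
Qed.

Lemma mass_eq k (P Q : formal_sum K G k) : chain_eq P Q -> mass P = mass Q.
Proof. by move=> PQ; apply/eqP; rewrite eq_le !le_mass //; exact: chain_eq_sym. Qed.

Lemma mass_le_coef k (F : seq (simplex K k)) (P : formal_sum K G k) : nonoverlapping F ->
  (forall s, s \in map snd P -> refines F s) ->
  mass P <= \sum_(f <- F) (ngnorm (coef f P))%:E * hausdorff k (support f).
Proof.
move=> nF FP; apply: ereal_inf_lbound; exists [seq (coef f P, f) | f <- F].
  split; first exact: chain_eq_refines.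
  by rewrite -map_comp map_id.
by rewrite big_map.
Qed.

(** Superadditivity of the Hausdorff measure enters here: the cells of [F] inside one simplex of [P]
    have total measure at most that of the simplex. The simplexes of [P] may overlap. *)
Lemma coef_le_weight k (F : seq (simplex K k)) (P : formal_sum K G k) : nonoverlapping F ->
  \sum_(f <- F) (ngnorm (coef f P))%:E * hausdorff k (support f) <= weight P.
Proof.
move=> nF; pose sub (f : simplex K k) (p : G * simplex K k) : bool := `[< support f `<=` support p.2 >].
apply: (@le_trans _ _ (\sum_(f <- F) \sum_(p <- P)
    if sub f p then (ngnorm p.1)%:E * hausdorff k (support f) else 0)).
  apply: lee_sum => f _.
  have h : (ngnorm (coef f P) <= \sum_(p <- P) if sub f p then ngnorm p.1 else 0)%R.
    apply: le_trans (ngnorm_sum _ _) _; apply: ler_sum => p _.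
    by rewrite -/(sub f p); case: ifP => _; rewrite ?ngnorm0 // ngnorm_orient.
  apply: (@le_trans _ _ ((\sum_(p <- P) if sub f p then ngnorm p.1 else 0)%R%:E *
      hausdorff k (support f))).
    by apply: lee_wpmul2r; rewrite ?hausdorff_ge0 ?lee_fin.
  rewrite -sumEFin ge0_sume_distrl => [|p _]; last first.
    by case: ifP => _; rewrite lee_fin // ngnorm_ge0.
  by apply: lee_sum => p _; case: ifP => _; rewrite ?mul0e.
rewrite exchange_big /=; apply: lee_sum => p _.
rewrite -big_mkcond /= -big_filter -ge0_sume_distrr => [|f _]; last exact: hausdorff_ge0.
apply: lee_wpmul2l; first by rewrite lee_fin ngnorm_ge0.
apply: hausdorff_nonoverlapping => //; first exact: nonoverlapping_filter.
by move=> f; rewrite mem_filter => /andP[/asboolP].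
Qed.

Lemma mass_le_weight k (P : formal_sum K G k) : mass P <= weight P.
Proof.
have [F nF FP] := refinement (map snd P).
exact: le_trans (mass_le_coef nF FP) (coef_le_weight _ nF).
Qed.

(** Near-optimal representatives of [P] and [Q] may overlap after concatenation; [mass_le_weight]
    still bounds the mass by the total weight. *)
Lemma mass_cat k (P Q : formal_sum K G k) : mass (P ++ Q) <= mass P + mass Q.
Proof.
have [->|Pf] := eqVneq (mass P) +oo; first by rewrite addye ?leey // gt_eqF // (lt_le_trans _ (mass_ge0 Q)).
have [->|Qf] := eqVneq (mass Q) +oo; first by rewrite addey ?leey // gt_eqF // (lt_le_trans _ (mass_ge0 P)).
have fin k' (S : formal_sum K G k') : mass S != +oo -> mass S \is a fin_num.
  by move=> h; rewrite ge0_fin_numE ?mass_ge0 // ltey.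
apply/lee_addgt0Pr => e e0; have e20 : (0 < e / 2)%R by rewrite divr_gt0.
have [|P' [PP _ hP]] := @mass_lt _ P (mass P + (e / 2)%:E).
  by rewrite lteDl ?fin // lte_fin.
have [|Q' [QQ _ hQ]] := @mass_lt _ Q (mass Q + (e / 2)%:E).
  by rewrite lteDl ?fin // lte_fin.
rewrite (mass_eq (chain_eq_cat PP QQ)).
apply: le_trans (mass_le_weight _) _; rewrite weight_cat.
apply: le_trans (leeD (ltW hP) (ltW hQ)) _.
by rewrite addeACA -EFinD -splitr.
Qed.

Lemma mass_opp k (P : formal_sum K G k) : mass (chain_opp P) = mass P.
Proof.
suff h (Q : formal_sum K G k) : mass (chain_opp Q) <= mass Q.
  by apply/eqP; rewrite eq_le h -{1}[P]chain_oppK h.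
apply: le_ereal_inf_tmp => _ [S [QS nS] <-]; apply: ereal_inf_lbound.
exists (chain_opp S); last exact: weight_opp.
by split; [exact: chain_eq_opp|rewrite -map_comp].
Qed.

Lemma flat_norm_ge0 k (P : formal_sum K G k) : 0 <= flat_norm P.
Proof. by apply: le_ereal_inf_tmp => _ [Q _ <-]; rewrite adde_ge0 ?mass_ge0. Qed.

Lemma flat_norm_le k (P : formal_sum K G k) Q :
  flat_norm P <= mass Q + mass (chain_sub P (boundary Q)).
Proof. by apply: ereal_inf_lbound; exists Q. Qed.

Lemma flat_norm_eq k (P Q : formal_sum K G k) : chain_eq P Q -> flat_norm P = flat_norm Q.
Proof.
suff h (S T : formal_sum K G k) : chain_eq S T -> flat_norm S <= flat_norm T.
  by move=> PQ; apply/eqP; rewrite eq_le !h //; exact: chain_eq_sym.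
move=> ST; apply: le_ereal_inf_tmp => _ [A _ <-]; apply: le_trans (flat_norm_le _ A) _.
by rewrite leeD2l //; apply: le_mass; apply: chain_eq_sub => //; exact: chain_eq_refl.
Qed.

Lemma flat_norm_opp k (P : formal_sum K G k) : flat_norm (chain_opp P) = flat_norm P.
Proof.
suff h (S : formal_sum K G k) : flat_norm (chain_opp S) <= flat_norm S.
  by apply/eqP; rewrite eq_le h -{1}[P]chain_oppK h.
apply: le_ereal_inf_tmp => _ [Q _ <-]; apply: le_trans (flat_norm_le _ (chain_opp Q)) _.
rewrite mass_opp leeD2l // -[leRHS]mass_opp boundary_opp; apply: le_mass.
by apply: chain_eq_mult => N x; rewrite !(mult_opp, mult_sub) opprD.
Qed.

Lemma flat_norm_lt k (P : formal_sum K G k) r : flat_norm P < r ->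
  exists Q, mass Q + mass (chain_sub P (boundary Q)) < r.
Proof. by move=> /ereal_inf_lt[_ [Q _ <-] Qr]; exists Q. Qed.

Lemma flat_norm_cat k (P Q : formal_sum K G k) :
  flat_norm (P ++ Q) <= flat_norm P + flat_norm Q.
Proof.
have [->|Pf] := eqVneq (flat_norm P) +oo.
  by rewrite addye ?leey // gt_eqF // (lt_le_trans _ (flat_norm_ge0 Q)).
have [->|Qf] := eqVneq (flat_norm Q) +oo.
  by rewrite addey ?leey // gt_eqF // (lt_le_trans _ (flat_norm_ge0 P)).
have fin (S : formal_sum K G k) : flat_norm S != +oo -> flat_norm S \is a fin_num.
  by move=> h; rewrite ge0_fin_numE ?flat_norm_ge0 // ltey.
apply/lee_addgt0Pr => e e0; have e20 : (0 < e / 2)%R by rewrite divr_gt0.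
have [|A hA] := @flat_norm_lt _ P (flat_norm P + (e / 2)%:E).
  by rewrite lteDl ?fin // lte_fin.
have [|B hB] := @flat_norm_lt _ Q (flat_norm Q + (e / 2)%:E).
  by rewrite lteDl ?fin // lte_fin.
apply: le_trans (flat_norm_le _ (A ++ B)) _.
have -> : flat_norm P + flat_norm Q + e%:E =
    (flat_norm P + (e / 2)%:E) + (flat_norm Q + (e / 2)%:E).
  by rewrite [RHS]addeACA -EFinD -splitr.
apply: le_trans (leeD (ltW hA) (ltW hB)); rewrite addeACA leeD ?mass_cat //.
apply: le_trans (mass_cat _ _); apply: le_mass.
apply: chain_eq_mult => N x; rewrite boundary_cat !(mult_cat, mult_opp, mult_sub).
by rewrite opprD addrACA.
Qed.

Lemma flat_norm_triangle k (Q P S : formal_sum K G k) :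
  flat_norm (chain_sub P S) <= flat_norm (chain_sub P Q) + flat_norm (chain_sub Q S).
Proof.
apply: le_trans (flat_norm_cat _ _); rewrite (flat_norm_eq (Q := chain_sub P Q ++ chain_sub Q S)) //.
by apply: chain_eq_mult => N x; rewrite !(mult_cat, mult_sub) addrA subrK.
Qed.

Lemma flat_norm_sym k (P Q : formal_sum K G k) :
  flat_norm (chain_sub P Q) = flat_norm (chain_sub Q P).
Proof.
rewrite -flat_norm_opp; apply: flat_norm_eq; apply: chain_eq_mult => N x.
by rewrite !(mult_opp, mult_sub) opprB.
Qed.

End Mass.

(** * Choosing the cut of the circle *)

Section LimitInferior.
Context {R : realType}.
Implicit Types (u : nat -> \bar R) (r : \bar R).
Local Open Scope ereal_scope.

Lemma limn_einf_lt u r : limn_einf u < r ->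
  forall N, exists2 m, (N <= m)%N & u m < r.
Proof.
move=> ur N; have : einfs u N < r.
  apply: le_lt_trans ur; rewrite limn_einf_lim (cvg_lim _ (@cvg_einfs_sup _ u)) //.
  by apply: ereal_sup_ubound; exists N.
by move=> /ereal_inf_lt[_ [m Nm <-] umr]; exists m.
Qed.

Lemma limn_einf_le u r : (forall N, exists2 m, (N <= m)%N & u m <= r) -> limn_einf u <= r.
Proof.
move=> ur; rewrite limn_einf_lim (cvg_lim _ (@cvg_einfs_sup _ u)) //.
apply: ge_ereal_sup => _ [N _ <-]; have [m Nm umr] := ur N.
by apply: le_trans umr; apply: ereal_inf_lbound; exists m.
Qed.

Lemma limn_esup_lt u r : limn_esup u < r ->
  exists N, forall m, (N <= m)%N -> u m < r.
Proof.
rewrite limn_esup_lim (cvg_lim _ (@cvg_esups_inf _ u)) // => /ereal_inf_lt[_ [N _ <-] h].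
exists N => m Nm; apply: le_lt_trans h; apply: ereal_sup_ubound; by exists m.
Qed.

Lemma limn_esup_le u r N : (forall m, (N <= m)%N -> u m <= r) -> limn_esup u <= r.
Proof.
move=> ur; rewrite limn_esup_lim (cvg_lim _ (@cvg_esups_inf _ u)) //.
apply: le_trans (_ : esups u N <= r); first by apply: ereal_inf_lbound; exists N.
by apply: ge_ereal_sup => _ [m /= Nm <-]; exact: ur.
Qed.

End LimitInferior.

Section CircleLift.
Context {R : realType}.
Implicit Types (a b g : circle R) (th : R).

Definition circle_repr g : R := frac (repr g).

Lemma circle_repr_itv g : 0 <= circle_repr g < 1.
Proof.
rewrite /circle_repr /frac; have /andP[h1 h2] := floor_itv (repr g : R).
by rewrite intrD in h2; apply/andP; split; lra.
Qed.

Lemma circle_reprK g : circle_proj (circle_repr g) = g.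
Proof.
have -> : circle_proj (circle_repr g) = circle_proj (repr g : R).
  apply/circle_projE; rewrite /circle_repr /frac addrAC subrr add0r.
  by rewrite rpredN intr_int.
exact: reprK.
Qed.

Lemma frac_id (x : R) : 0 <= x < 1 -> frac x = x.
Proof.
move=> /andP[x0 x1]; rewrite /frac (_ : Num.floor x = 0) ?subr0 //.
by apply/eqP; rewrite floor_eq // add0r x0 x1.
Qed.

Lemma circle_norm_repr g : circle_norm g = Num.min (circle_repr g) (1 - circle_repr g).
Proof. by rewrite -{1}[g]circle_reprK circle_normE frac_id // circle_repr_itv. Qed.

Lemma circle_norm_dist a b : circle_repr b <= circle_repr a ->
  circle_norm (a - b) = Num.min (circle_repr a - circle_repr b)
                               (1 - (circle_repr a - circle_repr b)).
Proof.
move=> ba; rewrite -{1}[a]circle_reprK -{1}[b]circle_reprK -raddfB circle_normE frac_id //.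
have /andP[a0 a1] := circle_repr_itv a; have /andP[b0 b1] := circle_repr_itv b.
by apply/andP; split; lra.
Qed.

Lemma circle_repr0 : circle_repr 0 = 0.
Proof.
have := circle_norm0 R; rewrite circle_norm_repr.
have /andP[h0 h1] := circle_repr_itv 0.
by rewrite minElt; case: ifP => _ h //; lra.
Qed.

Definition circle_lift th g : R :=
  if circle_repr g < th then circle_repr g else circle_repr g - 1.

Lemma circle_liftK th g : circle_proj (circle_lift th g) = g.
Proof.
rewrite /circle_lift; case: ifP => _; first exact: circle_reprK.
rewrite -{2}[g]circle_reprK; apply/circle_projE.
by rewrite addrAC subrr add0r rpredN rpred1.
Qed.

(** A positive cut keeps 0 in the window [th - 1, th), so that regions where a chain vanishes
    acquire no mass by lifting. *)
Lemma circle_lift0 th : 0 < th -> circle_lift th 0 = 0.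
Proof. by move=> th0; rewrite /circle_lift circle_repr0 th0. Qed.

(* The cuts [th] that separate [a] from [b] along a shortest arc. *)
Lemma lift_cut a b : exists I : set R, [/\ measurable I,
  (lebesgue_measure (I `&` `]0%R, 1%R]) <= (circle_norm (a - b))%:E)%E &
  forall th, 0 < th <= 1 -> `|circle_lift th a - circle_lift th b| <= circle_norm (a - b) + \1_I th].
Proof.
wlog ba : a b / circle_repr b <= circle_repr a => [W|].
  have [/W //|/ltW/W[I [mI hI bI]]] := leP (circle_repr b) (circle_repr a).
  exists I; have -> : circle_norm (a - b) = circle_norm (b - a).
    by rewrite -circle_normN opprB.
  by split=> // th th01; rewrite distrC; exact: bI.
have /andP[a0 a1] := circle_repr_itv a; have /andP[b0 b1] := circle_repr_itv b.
rewrite circle_norm_dist //; set ra := circle_repr a in ba a0 a1 *.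
set rb := circle_repr b in ba b0 b1 *.
(* The shortest arc is either the interval from [rb] to [ra] or its complement, which passes through
   0. A cut on it adds at most 1 to the difference of the lifts; any other cut adds nothing. *)
have [h|h] := leP (ra - rb) (1 - (ra - rb)).
- exists `]rb, ra]%classic; split=> //.
    apply: le_trans (_ : lebesgue_measure `]rb, ra]%classic <= _)%E.
      by apply: le_measure; rewrite ?inE //; exact: measurableI.
    rewrite lebesgue_measure_itv /= lte_fin; case: ifP => //= _.
    by rewrite lee_fin subr_ge0.
  move=> th /andP[th0 th1]; rewrite /circle_lift -/ra -/rb indicE mem_setE /= in_itv /=.
  case: (ltP ra th) => h1; case: (ltP rb th) => h2 /=; rewrite ler_norml; apply/andP; split; lra.
- exists (`]0%R, rb] `|` `]ra, 1%R])%classic; split.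
  + exact: measurableU.
  + apply: le_trans (_ : lebesgue_measure (`]0%R, rb] `|` `]ra, 1%R])%classic <= _)%E.
      by apply: le_measure; rewrite ?inE //; [apply: measurableI => //|]; exact: measurableU.
    apply: (@le_trans _ _ (lebesgue_measure `]0%R, rb]%classic +
      lebesgue_measure `]ra, 1%R]%classic)%E); first exact: measureU2.
    rewrite !lebesgue_measure_itv /= !lte_fin a1.
    case: ifP => _; rewrite -?EFinB -?EFinD ?add0e lee_fin; lra.
  + move=> th /andP[th0 th1]; rewrite /circle_lift -/ra -/rb indicE in_setU !mem_setE /= !in_itv /=.
    case: (ltP ra th) => h1; case: (ltP rb th) => h2 /=; rewrite ?th0 ?th1 ?orbT /= ler_norml; apply/andP; split; lra.
Qed.

Definition lift_cost th (D : seq (\bar R * (circle R * circle R))) : \bar R :=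
  (\sum_(p <- D) p.1 * `|circle_lift th p.2.1 - circle_lift th p.2.2|%:E)%E.

(** If every cut failed, the lower limit of the majorants built from [phi] would be +oo on all of
    []0, 1]], whereas Fatou's lemma bounds its integral by 2C. [M] and the good indices depend on
    the cut. *)
Lemma common_cut (D : nat -> seq (\bar R * (circle R * circle R))) (C : R) :
  (forall m p, p \in D m -> 0 <= p.1)%E ->
  (forall m, \sum_(p <- D m) p.1 * (circle_norm (p.2.1 - p.2.2))%:E <= C%:E)%E ->
  exists2 th, 0 < th <= 1 &
    exists M : R, forall N, exists2 m, (N <= m)%N & (lift_cost th (D m) <= M%:E)%E.
Proof.
move=> D0 DC.
have norm0 (g : circle R) : 0 <= circle_norm g.
  have /andP[h0 h1] := circle_repr_itv g.
  by rewrite circle_norm_repr le_min h0 subr_ge0 ltW.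
have /choice[I IP] : forall q : circle R * circle R, exists I : set R, [/\ measurable I,
  (lebesgue_measure (I `&` `]0%R, 1%R]) <= (circle_norm (q.1 - q.2))%:E)%E &
  forall th, 0 < th <= 1 ->
    `|circle_lift th q.1 - circle_lift th q.2| <= circle_norm (q.1 - q.2) + \1_I th].
  by move=> q; exact: lift_cut.
(* A majorant of one term of the cost, through the indicator of the bad cuts. The weight becomes a
   real number, with +oo sent to 0: by [finite_weight] an infinite weight occurs only between equal
   values, where the cost is 0. *)
pose phi (p : \bar R * (circle R * circle R)) (th : R) : \bar R :=
  ((Num.max 0 (fine p.1))%:E * ((circle_norm (p.2.1 - p.2.2))%:E + (\1_(I p.2) th)%:E))%E.
have mphi p : measurable_fun (`]0, 1]%classic : set R) (phi p).
  apply: measurable_funeM; apply: emeasurable_funD; first exact: measurable_cst.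
  apply/measurable_EFinP; apply: measurable_indic; by case: (IP p.2).
have phi0 p th : (0 <= phi p th)%E.
  apply: mule_ge0; first by rewrite lee_fin le_max lexx.
  by apply: adde_ge0; rewrite lee_fin.
have intphi p : (\int[lebesgue_measure]_(th in `]0%R, 1%R]) phi p th <=
    (Num.max 0 (fine p.1))%:E * (2 * circle_norm (p.2.1 - p.2.2))%:E)%E.
  have [mI hI _] := IP p.2.
  rewrite ge0_integralZl_EFin //; last 3 first.
  - by move=> th _; apply: adde_ge0; rewrite lee_fin.
  - apply: emeasurable_funD; first exact: measurable_cst.
    by apply/measurable_EFinP; apply: measurable_indic.
  - by rewrite le_max lexx.
  apply: lee_wpmul2l; first by rewrite lee_fin le_max lexx.
  rewrite ge0_integralD //; last 2 first.
  - by move=> th _; rewrite lee_fin.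
  - by apply/measurable_EFinP; apply: measurable_indic.
  have mu01 : lebesgue_measure (`]0, 1]%classic : set R) = 1%E.
    by rewrite lebesgue_measure_itv /= lte_fin ltr01 oppr0 adde0.
  rewrite integral_indic // integral_cst //= mu01.
  by rewrite mule1 mulr_natl mulr2n EFinD leeD2l.
have finite_weight m p : p \in D m -> p.1 != +oo%E \/ p.2.1 = p.2.2.
  move=> pD; have [->|ne] := eqVneq p.2.1 p.2.2; first by right.
  left; apply/eqP => poo; have := DC m; rewrite (big_rem p) //= poo gt0_mulye; last first.
    rewrite lte_fin lt_neqAle norm0 andbT eq_sym; apply: contra ne => /eqP /circle_norm_eq0.
    by move=> /eqP; rewrite subr_eq0.
  rewrite addye ?leye_eq // gt_eqF // (@lt_le_trans _ _ 0%E) ?ltNy0 //.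
  rewrite big_seq sume_ge0 // => q qD.
  by rewrite mule_ge0 ?lee_fin //; exact: D0 (mem_rem qD).
have costE m th : 0 < th <= 1 -> (lift_cost th (D m) <= \sum_(p <- D m) phi p th)%E.
  move=> th01; rewrite /lift_cost big_seq [leRHS]big_seq; apply: lee_sum => p pD.
  have [_ _ /(_ th th01) hp] := IP p.2.
  have p0 := D0 m p pD; have [pfin|->] := finite_weight m p pD; last first.
    by rewrite subrr normr0 mule0.
  rewrite /phi; case: (p.1) p0 pfin => //= w; rewrite lee_fin => w0 _.
  by rewrite (max_idPr w0) -EFinD -!EFinM lee_fin ler_wpM2l.
have intE m : (\int[lebesgue_measure]_(th in `]0%R, 1%R]) \sum_(p <- D m) phi p th <= (2 * C)%:E)%E.
  rewrite ge0_integral_sum //.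
  apply: (@le_trans _ _ (\sum_(p <- D m) 2%:E * (p.1 * (circle_norm (p.2.1 - p.2.2))%:E))%E).
    rewrite big_seq [leRHS]big_seq; apply: lee_sum => p pD; apply: le_trans (intphi p) _.
    have p0 := D0 m p pD; have [pfin|->] := finite_weight m p pD; last first.
      by rewrite subrr circle_norm0 mulr0 !mule0.
    case: (p.1) p0 pfin => //= w; rewrite lee_fin => w0 _.
    by rewrite (max_idPr w0) -!EFinM lee_fin mulrCA.
  have D0' p : p \in D m -> (0 <= p.1 * (circle_norm (p.2.1 - p.2.2))%:E)%E.
    by move=> pD; rewrite mule_ge0 ?lee_fin // (D0 m).
  rewrite big_seq -ge0_sume_distrr // -big_seq EFinM.
  by apply: lee_wpmul2l => //; rewrite lee_fin.
apply: contrapT => nth.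
have liminf_oo th : 0 < th <= 1 -> limn_einf (fun m => \sum_(p <- D m) phi p th)%E = +oo%E.
  move=> th01; apply/eqP; apply: contrapT => /negP; rewrite -ltey => fin; apply: nth.
  exists th => //.
  have l0 : (0 <= limn_einf (fun m => \sum_(p <- D m) phi p th))%E.
    rewrite leNgt; apply/negP => /limn_einf_lt/(_ 0%N)[m _]; apply/negP; rewrite -leNgt.
    exact: sume_ge0.
  exists (fine (limn_einf (fun m => \sum_(p <- D m) phi p th)%E) + 1) => N.
  have : (limn_einf (fun m => \sum_(p <- D m) phi p th) <
    (fine (limn_einf (fun m => \sum_(p <- D m) phi p th)) + 1)%:E)%E.
    by rewrite EFinD fineK ?ge0_fin_numE // lteDl ?ge0_fin_numE // lte_fin.
  move=> /limn_einf_lt/(_ N)[m Nm h]; exists m => //.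
  exact: le_trans (costE m th th01) (ltW h).
have : (\int[lebesgue_measure]_(th in `]0%R, 1%R])
    limn_einf (fun m => \sum_(p <- D m) phi p th) <= (2 * C)%:E)%E.
  apply: (@le_trans _ _ (limn_einf (fun m =>
    \int[lebesgue_measure]_(th in `]0%R, 1%R]) \sum_(p <- D m) phi p th)%E)).
    have mf m : measurable_fun (`]0, 1]%classic : set R)
      (fun th => \sum_(p <- D m) phi p th)%E by exact: emeasurable_sum.
    have f0 m th : (`]0, 1]%classic : set R) th -> (0 <= \sum_(p <- D m) phi p th)%E.
      by move=> _; exact: sume_ge0.
    exact: (fatou (@lebesgue_measure R) (measurable_itv `]0, 1]) mf f0).
  by apply: limn_einf_le => N; exists N.
rewrite (eq_integral (cst +oo%E)) => [|th]; last first.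
  by rewrite inE /= in_itv /= => th01; exact: liminf_oo.
rewrite integral_cst //= lebesgue_measure_itv /= lte_fin ltr01 oppr0 adde0 mule1.
by rewrite leye_eq.
Qed.

End CircleLift.

(** * Lifting top-dimensional chains *)

Section LiftedChain.
Context {R : realType} {d : nat} {K : set 'rV[R]_d.+1}.
Implicit Types (x : 'rV[R]_d.+1).

Lemma top_sub (M N : 'M[R]_(d.+2, 1 + d.+1)) : row_free N -> (M <= N)%MS.
Proof.
by move=> Nf; apply: submx_full; rewrite (row_full_unit (N : 'M[R]_(1 + d.+1))) -row_free_unit.
Qed.

(** A fixed orientation of the ambient space. With it a top-dimensional chain becomes one function
    with values in the group, [mult std_frame]. *)
Definition std_frame : 'M[R]_(d.+2, 1 + d.+1) := (1%:M : 'M[R]_(1 + d.+1)).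

Lemma std_frame_free : row_free std_frame.
Proof. by rewrite (row_free_unit (std_frame : 'M[R]_(1 + d.+1))) unitmx1. Qed.
#[local] Hint Resolve std_frame_free : core.

Section Groups.
Context {G H : zmodType}.

Lemma mult_frame (M N : 'M[R]_(d.+2, 1 + d.+1)) (P : formal_sum K G d.+1) x :
  row_free M -> row_free N -> mult N P x = mult M P x *~ orient M N.
Proof.
move=> Mf Nf; rewrite /mult; elim/big_rec2: _ => [|q a b _ ->]; first by rewrite mul0rz.
rewrite mulrzDl; congr (_ + _); case: ifP => _; last by rewrite mul0rz.
by rewrite (orient_trans (top_sub _ Mf) (top_sub _ Nf)) mulrzA.
Qed.

(** [L] need not be odd, so it cannot act on coefficients of arbitrarily oriented simplexes. Each
    coefficient is first expressed in the standard orientation, and the lifted value is returned to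
    the orientation of its cell. *)
Definition lift_chain (L : G -> H) (F : seq (simplex K d.+1))
    (P : formal_sum K G d.+1) : formal_sum K H d.+1 :=
  [seq (L (coef f P *~ orient (homog (vertices f)) std_frame) *~
        orient (homog (vertices f)) std_frame, f) | f <- F].

Lemma lift_chain_simplexes L F P : map snd (lift_chain L F P) = F.
Proof. by rewrite -map_comp map_id. Qed.

(** At a point in no cell of [F] both multiplicities vanish, which is where [L 0 = 0] is used;
    elsewhere a generic point lies in exactly one cell. *)
Lemma mult_lift_chain (L : G -> H) (F : seq (simplex K d.+1)) (P : formal_sum K G d.+1)
    (W : 'M[R]_(d.+2, d.+1)) x :
  L 0 = 0 -> nonoverlapping F -> (forall s, s \in map snd P -> refines F s) ->
  row_free (homog W) -> off_walls (walls F W) x ->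
  mult std_frame (lift_chain L F P) x = L (mult std_frame P x).
Proof.
move=> L0 nF FP Wf xW; rewrite {1}/mult /lift_chain big_map /=.
have Fx u : u \in F -> support u x -> relint u x.
  by move=> uF; apply: (off_walls_relint _ uF xW); exact: top_sub.
have [[t tF xt]|nt] := pselect (exists2 t, t \in F & support t x); last first.
  rewrite big_seq big1 => [|t tF]; last by case: asboolP => // xt; case: nt; exists t.
  rewrite /mult big_seq big1 ?L0 // => q qP; case: asboolP => // xq.
  have [t [tF _ xt]] := FP q.2 (map_f _ qP) x xq.
  by case: nt; exists t.
have oo : orient (homog (vertices t)) std_frame * orient (homog (vertices t)) std_frame = 1.
  by apply: (orient_sqr _ _).1; [exact: simplex_free|exact: top_sub].
pose o (u : simplex K d.+1) := orient (homog (vertices u)) std_frame.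
rewrite (sum_nonoverlapping (fun u : simplex K d.+1 => L (coef u P *~ o u) *~ o u *~ o u) nF tF (Fx t tF xt) Fx).
rewrite -mulrzA /o oo mulr1z; congr L.
rewrite (@mult_frame (homog (vertices t)) _ P x (simplex_free t)) //.
congr (_ *~ _); apply/esym; apply: (coef_mult nF FP tF); first exact: Fx.
move=> c ct; apply: xW; move: ct; rewrite !mem_filter => /andP[ct ->]; rewrite andbT.
apply: contraNneq ct => Wc.
have /submxP[D ->] : (homog (vertices t) <= homog W)%MS by exact: top_sub.
by rewrite -mulmxA Wc mulmx0.
Qed.

End Groups.

Lemma ngnorm_unit (G : normedAbGroup R) (g : G) (o : int) : o * o = 1 -> ngnorm (g *~ o) = ngnorm g.
Proof.
move=> /eqP; rewrite -expr2 sqrf_eq1 => /orP[]/eqP ->; first by rewrite mulr1z.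
by rewrite mulrN1z ngnormN.
Qed.

Hypothesis K_compact : compact K.
Local Notation csum := (formal_sum K (circleNG R)).
Local Notation rsum := (formal_sum K (realNG R)).

(* [D] lists, for a fixed subdivision, the measure of each cell and the two
   circle values whose lifts are compared on it; it does not depend on the lift. *)
Definition jump_bound (D : seq (\bar R * (circle R * circle R))) k (Y : csum k)
    (X : (circle R -> R) -> rsum k) : Prop :=
  [/\ forall p, p \in D -> (0 <= p.1)%E,
      (\sum_(p <- D) p.1 * (circle_norm (p.2.1 - p.2.2))%:E <= weight Y)%E &
      forall L : circle R -> R, L 0 = 0 ->
        (mass (X L) <= \sum_(p <- D) p.1 * `|L p.2.1 - L p.2.2|%:E)%E].

Lemma jump_bound_coef k (Y : csum k) (X : (circle R -> R) -> rsum k)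
    (F : seq (simplex K k)) (a b : simplex K k -> circle R) (o : simplex K k -> int) :
  nonoverlapping F -> (forall L s, s \in map snd (X L) -> refines F s) ->
  (forall f, f \in F -> o f * o f = 1) ->
  (forall f, f \in F -> coef f Y = (a f - b f) *~ o f :> circle R) ->
  (forall L f, L 0 = 0 -> f \in F -> coef f (X L) = (L (a f) - L (b f)) *~ o f :> R) ->
  jump_bound [seq (hausdorff k (support f), (a f, b f)) | f <- F] Y X.
Proof.
move=> nF FX oF YE XE; split.
- by move=> _ /mapP[f _ ->]; exact: hausdorff_ge0.
- rewrite big_map /=; apply: le_trans (coef_le_weight K_compact Y nF).
  rewrite big_seq [leRHS]big_seq; apply: lee_sum => f fF; rewrite YE //.
  by rewrite (@ngnorm_unit (circleNG R)) ?oF // muleC.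
- move=> L L0; apply: le_trans (mass_le_coef nF (FX L)) _.
  rewrite big_map /= big_seq [leRHS]big_seq; apply: lee_sum => f fF; rewrite XE //.
  by have /= -> := @ngnorm_unit (realNG R) (L (a f) - L (b f)) (o f) (oF f fF); rewrite muleC.
Qed.

Lemma map_snd_sub (G : zmodType) k (P Q : formal_sum K G k) :
  map snd (chain_sub P Q) = map snd P ++ map snd Q.
Proof. by rewrite /chain_sub map_cat -map_comp. Qed.

Lemma jump_top (F1 F2 : seq (simplex K d.+1)) (W1 W2 Y : csum d.+1) :
  nonoverlapping F1 -> (forall s, s \in map snd W1 -> refines F1 s) ->
  nonoverlapping F2 -> (forall s, s \in map snd W2 -> refines F2 s) ->
  chain_eq (chain_sub W1 W2) Y ->
  exists D, jump_bound D Y (fun L => chain_sub (lift_chain L F1 W1) (lift_chain L F2 W2)).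
Proof.
move=> nF1 FW1 nF2 FW2 WY.
have [F nF hF] := refinement (F1 ++ F2 ++ map snd Y).
have FY s : s \in map snd Y -> refines F s by move=> sY; apply: hF; rewrite !mem_cat sY !orbT.
have FX (L : circle R -> R) s :
    s \in map snd (chain_sub (lift_chain L F1 W1) (lift_chain L F2 W2) : rsum d.+1) -> refines F s.
  rewrite map_snd_sub !lift_chain_simplexes => h; apply: hF; move: h.
  by rewrite !mem_cat => /orP[->|->]; rewrite ?orbT.
(* One generic point per cell, off the walls of all families involved and chosen before [L]; the
   values of [W1] and [W2] there make up the list. *)
have /choice[x xP] : forall f : simplex K d.+1, exists x, [/\ relint f x,
    off_walls (walls F (vertices f)) x, off_walls (walls F1 (vertices f)) x,
    off_walls (walls F2 (vertices f)) x &
    mult (homog (vertices f)) (chain_sub W1 W2) x = mult (homog (vertices f)) Y x].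
  move=> f; have [A hA AE] := chain_eq_generic (simplex_free f) WY.
  have [c|x xf] := @open_hull_generic _ _ _ (vertices f) (walls F (vertices f) ++
     walls F1 (vertices f) ++ walls F2 (vertices f) ++ A).
    by rewrite !mem_cat => /or4P[/wallsP|/wallsP|/wallsP|/hA].
  move=> /off_walls_cat[x0 /off_walls_cat[x1 /off_walls_cat[x2 xA]]].
  by exists x; split=> //; apply: AE => //; have /relint_baryP[] := xf.
exists [seq (hausdorff d.+1 (support f), (mult std_frame W1 (x f), mult std_frame W2 (x f))) | f <- F].
apply: (jump_bound_coef (o := fun f => orient std_frame (homog (vertices f)))) => //.
- by move=> f _; apply: (orient_sqr _ _).1 => //; exact: top_sub (simplex_free f).
- move=> f fF; have [xf x0 _ _ e] := xP f; rewrite -(coef_mult nF FY fF xf x0) -e.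
  by rewrite (mult_frame _ _ std_frame_free) ?simplex_free // mult_sub.
- move=> L f L0 fF; have [xf x0 x1 x2 _] := xP f.
  rewrite -(coef_mult nF (FX L) fF xf x0) (mult_frame _ _ std_frame_free) ?simplex_free //.
  rewrite mult_sub (mult_lift_chain L0 nF1 FW1 (simplex_free f) x1).
  by rewrite (mult_lift_chain L0 nF2 FW2 (simplex_free f) x2).
Qed.

Lemma map_snd_boundary (G : zmodType) (P : formal_sum K G d.+1) :
  map snd (boundary P) = flatten [seq [seq face i s | i <- enum 'I_d.+2] | s <- map snd P].
Proof.
rewrite /boundary map_flatten -!map_comp; congr flatten.
by apply: eq_map => p /=; rewrite -map_comp.
Qed.

Lemma jump_boundary (F : seq (simplex K d.+1)) (W : csum d.+1) (Y : csum d) :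
  nonoverlapping F -> (forall s, s \in map snd W -> refines F s) ->
  chain_eq (boundary W) Y ->
  exists D, jump_bound D Y (fun L => boundary (lift_chain L F W)).
Proof.
move=> nF FW WY.
have [E nE hE] := refinement
  (flatten [seq [seq face i s | i <- enum 'I_d.+2] | s <- F] ++ map snd Y).
have EY s : s \in map snd Y -> refines E s by move=> sY; apply: hE; rewrite mem_cat sY orbT.
have EX (L : circle R -> R) s :
    s \in map snd (boundary (lift_chain L F W) : rsum d) -> refines E s.
  rewrite map_snd_boundary lift_chain_simplexes => h; apply: hE.
  by rewrite mem_cat h.
(* For each cell, and before [L]: a generic point, the values of [W] on the two sides of its
   hyperplane, and the sign that turns their difference into the multiplicity of the boundary. *)
have /choice[q qP] : forall f : simplex K d, exists q : 'rV[R]_d.+1 * circle R * circle R * int,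
    let: (x, a, b, o) := q in [/\ relint f x, off_walls (walls E (vertices f)) x,
      o * o = 1, mult (homog (vertices f)) Y x = (a - b) *~ o &
      forall L : circle R -> R, L 0 = 0 ->
      mult (homog (vertices f)) (boundary (lift_chain L F W) : rsum d) x = (L a - L b) *~ o].
  move=> f; set V := vertices f.
  have Vf : row_free (homog V) := simplex_free f.
  have [p pf] := exists_apex Vf.
  have [A hA AE] := chain_eq_generic Vf WY.
  have [c|x xf] := @open_hull_generic _ _ _ V (walls E V ++ walls F V ++ walls (map snd W) V ++
      A ++ [seq c <- walls F (col_mx p V) | homog V *m c != 0]).
    rewrite !mem_cat => /orP[/wallsP//|/or4P[/wallsP//|/wallsP//|/hA//|]].
    by rewrite mem_filter => /andP[].
  move=> /off_walls_cat[xE /off_walls_cat[xF /off_walls_cat[xW /off_walls_cat[xA xp]]]].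
  have xV : aff_span V x by have /relint_baryP[] := xf.
  pose v := p - row 0 V; pose N := homog (col_mx p V).
  have [e [eW eF [e1 e2]]] : exists e, [/\
      forall Q : csum d.+1, map snd Q = map snd W ->
        mult N Q (x + e *: v) - mult N Q (x + (- e) *: v) = mult (homog V) (boundary Q) x,
      forall Q : rsum d.+1, map snd Q = F ->
        mult N Q (x + e *: v) - mult N Q (x + (- e) *: v) = mult (homog V) (boundary Q) x &
      off_walls (walls F (col_mx p V)) (x + e *: v) /\
      off_walls (walls F (col_mx p V)) (x + (- e) *: v)].
    apply: (@filter_ex _ 0^'+); near=> e; split; near: e.
    - exact: mult_boundary.
    - exact: mult_boundary.
    - by apply: near_off_walls => // c /wallsP.
  exists (x, mult std_frame W (x + e *: v), mult std_frame W (x + (- e) *: v), orient std_frame N).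
  split=> //.
  - by apply: (orient_sqr _ _).1 => //; exact: top_sub.
  - rewrite -AE // -eW // !(@mult_frame _ std_frame N) //.
    exact: esym (mulrzBl _ _ _).
  - move=> L L0; rewrite -eF ?lift_chain_simplexes //.
    rewrite !(@mult_frame _ std_frame N) // -mulrzBl.
    by rewrite (mult_lift_chain L0 nF FW pf e1) (mult_lift_chain L0 nF FW pf e2).
exists [seq (hausdorff d (support f), ((q f).1.1.2, (q f).1.2)) | f <- E].
apply: (jump_bound_coef (o := fun f => (q f).2)) => //.
- by move=> f _; have := qP f; case: (q f) => -[[x a] b] o [].
- move=> f fE; have := qP f; case: (q f) => -[[x a] b] o /= [xf xE _ <- _].
  by rewrite (coef_mult nE EY fE xf xE).
- move=> L f L0 fE; have := qP f; case: (q f) => -[[x a] b] o /= [xf xE _ _ <- //].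
  by rewrite (coef_mult nE (EX L) fE xf xE).
Unshelve. all: by end_near. Qed.

End LiftedChain.

(** * Lifting flat chains of finite mass *)

Section FlatChains.
Context {R : realType} {n : nat} {K : set 'rV[R]_n}.
Local Open Scope ereal_scope.

Lemma limn_esup_ge0 (u : nat -> \bar R) : (forall i, 0 <= u i) -> 0 <= limn_esup u.
Proof.
move=> u0; rewrite leNgt; apply/negP => /limn_esup_lt[N /(_ N (leqnn N))].
by rewrite ltNge u0.
Qed.

Lemma flat_dist_ge0 (G : normedAbGroup R) k (S T : @flat_chain R n K G k) : 0 <= flat_dist S T.
Proof. by apply: limn_esup_ge0 => i; exact: flat_norm_ge0. Qed.

Lemma cvge0_le (u v : nat -> \bar R) : (forall i, 0 <= v i) -> (forall i, v i <= u i) ->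
  u i @[i --> \oo] --> 0 -> v i @[i --> \oo] --> 0.
Proof.
move=> v0 vu u0; apply: (@squeeze_cvge _ _ _ _ (cst 0) _ u) => //; last exact: cvg_cst.
by apply: nearW => i; rewrite /= v0 vu.
Qed.

Lemma flat_mass_proj k (S : @flat_chain R n K (realNG R) k) :
  flat_mass (flat_proj S) <= flat_mass S.
Proof.
apply: le_ereal_inf_tmp => _ [P /= PS <-].
apply: le_trans (_ : limn_einf (fun m => mass (proj_sum (P m))) <= _).
  apply: ereal_inf_lbound; exists (fun m => proj_sum (P m)) => //=.
  apply: cvge0_le PS => i; first exact: flat_dist_ge0.
  exact: (flat_dist_proj (flat_of_polyhedral (P i)) S).
rewrite !limn_einf_lim; apply: lee_lim; [exact: is_cvg_einfs..|].
apply: nearW => m; apply: le_ereal_inf_tmp => _ [i /= mi <-].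
apply: le_trans (mass_proj _); apply: ereal_inf_lbound; by exists i.
Qed.

(** Used for terms whose masses matter and not their boundaries, so each coefficient is lifted
    separately. The cut 1/2 gives the window [-1/2, 1/2), where the absolute value is the norm of
    the circle. *)
Definition lift_sum k (P : formal_sum K (circleNG R) k) : formal_sum K (realNG R) k :=
  [seq (circle_lift 2^-1%R q.1 : realNG R, q.2) | q <- P].

Lemma lift_sumK k (P : formal_sum K (circleNG R) k) : proj_sum (lift_sum P) = P.
Proof.
rewrite /proj_sum -map_comp map_id_in // => -[g s] _ /=; by rewrite circle_liftK.
Qed.

Lemma norm_lift_half (g : circle R) : (`|circle_lift 2^-1 g| = circle_norm g)%R.
Proof.
have /andP[g0 g1] := circle_repr_itv g.
rewrite circle_norm_repr /circle_lift minElt; have half := splitr (1 : R); rewrite mul1r in half.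
case: ltP => h1; case: ltP => h2; rewrite ?(ger0_norm g0) ?ler0_norm; lra.
Qed.

Lemma weight_lift_sum k (P : formal_sum K (circleNG R) k) : weight (lift_sum P) = weight P.
Proof.
by rewrite /weight big_map; apply: eq_bigr => q _ /=; rewrite norm_lift_half.
Qed.

Lemma lift_sum_cat k (P Q : formal_sum K (circleNG R) k) :
  lift_sum (P ++ Q) = lift_sum P ++ lift_sum Q.
Proof. exact: map_cat. Qed.

End FlatChains.

Section ZmodIdentities.
Context {V : zmodType}.
Implicit Types p q b c z r : V.

Lemma zmod_telescope p q q' z r : p - q - z + (q - q' - r) = p - q' - (z + r).
Proof. by rewrite addrACA subrKA opprD. Qed.

Lemma zmod_cancel p q z : p - (p - q - z) - z = q.
Proof. by rewrite opprB addrAC subrKA subKr. Qed.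

Lemma zmod_step p b c z r : p - b - z - (p - c - (z + r)) - (c - b) = r.
Proof.
have -> : p - b - z - (p - c - (z + r)) = (c - b) + r.
  rewrite opprD opprK addrACA addKr; congr (_ + _).
  by rewrite opprB addrC subrKA.
by rewrite addrAC subrr add0r.
Qed.

End ZmodIdentities.

(** * Polyhedral approximation of flat chains of finite mass *)

Section Approximation.
Context {R : realType} {n : nat} {K : set 'rV[R]_n} {G : normedAbGroup R}.
Local Open Scope ereal_scope.

Lemma ereal_lt_real (x : \bar R) : x < +oo -> exists r : R, x < r%:E.
Proof.
case: x => [x| |] //= _; last by exists 0%R; exact: ltNy0.
by exists (x + 1)%R; rewrite lte_fin ltrDl.
Qed.

(** The bound is on [weight] and not only on [mass]: [lift_sum] acts on the list itself, so each
    approximating chain is replaced by a representative of weight at most [C]. *)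
Lemma flat_chain_approximation k (T : @flat_chain R n K G k) (eps : nat -> R) :
  (forall m, 0 < eps m)%R -> flat_mass T < +oo ->
  exists (C : R) (P : nat -> formal_sum K G k), forall m, weight (P m) <= C%:E /\
    exists N, forall i, (N <= i)%N -> flat_norm (chain_sub (P m) (T i)) < (eps m)%:E.
Proof.
move=> eps0 /ereal_inf_lt[_ [P /= PT <-] /ereal_lt_real[C PC]]; exists C.
suff /choice[Q hQ] : forall m, exists Q, weight Q <= C%:E /\
    exists N, forall i, (N <= i)%N -> flat_norm (chain_sub Q (T i)) < (eps m)%:E.
  by exists Q.
move=> m; have /limn_esup_lt[N hN] :
    limn_esup (fun i => flat_dist (flat_of_polyhedral (P i)) T) < (eps m)%:E.
  by rewrite (cvg_limn_einf_sup PT).2 lte_fin.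
have [i Ni /mass_lt[Q [PQ _ QC]]] := limn_einf_lt PC N.
exists Q; split; first exact: ltW.
have /limn_esup_lt[N' hN'] := hN i Ni; exists N' => j /hN' /=.
by rewrite (flat_norm_eq (chain_eq_sub PQ (chain_eq_refl _))).
Qed.

Fixpoint concat_upto T (f : nat -> seq T) m : seq T :=
  if m is m'.+1 then concat_upto f m' ++ f m' else [::].

End Approximation.

Lemma flat_norm_decomposition (R : realType) d (K : set 'rV[R]_d.+1) (G : normedAbGroup R)
    (P : formal_sum K G d) r : (flat_norm P < r)%E ->
  exists Q S, [/\ chain_eq P (boundary Q ++ S), weight Q <= r & weight S <= r]%E.
Proof.
move=> /flat_norm_lt[Q0 Q0r].
have [|Q [Q0Q _ Qr]] := @mass_lt _ _ _ _ _ Q0 r.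
  by apply: le_lt_trans Q0r; rewrite leeDl // mass_ge0.
have [|S [PS _ Sr]] := @mass_lt _ _ _ _ _ (chain_sub P (boundary Q0)) r.
  by apply: le_lt_trans Q0r; rewrite leeDr // mass_ge0.
exists Q, S; split; [|exact: ltW..].
apply: (@chain_eq_trans _ _ _ _ _ _ (boundary Q0 ++ chain_sub P (boundary Q0))).
  by apply: chain_eq_mult => N x; rewrite mult_cat mult_sub addrC subrK.
by apply: chain_eq_cat PS; exact: boundary_eq.
Qed.

Section Geometric.
Context {R : realType}.

Definition half_pow (m : nat) : R := 2^-1 ^+ m.

Lemma half_pow_gt0 m : 0 < half_pow m.
Proof. by rewrite exprn_gt0 // invr_gt0. Qed.

Lemma half_powS m : half_pow m = half_pow m.+1 + half_pow m.+1.
Proof. by rewrite /half_pow exprS -mulrDl -[X in X + X]div1r -splitr mul1r. Qed.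

Lemma half_pow_le m p : (m <= p)%N -> half_pow p <= half_pow m.
Proof. by move=> mp; apply: ler_wiXn2l => //; rewrite ?invr_ge0 // invf_le1 // ler1n. Qed.

Lemma half_pow_le1 m : half_pow m <= 1.
Proof. by rewrite -[leRHS](expr0 (2^-1)) -/(half_pow 0) half_pow_le. Qed.

Lemma half_powK m : 2 ^+ m * half_pow m = 1.
Proof. by rewrite -exprMn divff ?expr1n. Qed.

Lemma half_pow_lt (e : R) : 0 < e -> exists N, forall m, (N <= m)%N -> half_pow m < e.
Proof.
move=> e0; exists (Num.bound e^-1) => m Nm.
have h := upper_nthrootP Nm.
by rewrite /half_pow exprVn -[e]invrK ltf_pV2 ?posrE ?invr_gt0 // exprn_gt0.
Qed.

Lemma sum_concat_upto (T : Type) (f : nat -> seq T) (w : T -> \bar R) m :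
  (forall l, \sum_(t <- f l) w t <= (half_pow l)%:E)%E ->
  (\sum_(t <- concat_upto f m) w t <= (2 - 2 * half_pow m)%:E)%E.
Proof.
move=> fw; elim: m => [|m IH] /=; first by rewrite big_nil lee_fin /half_pow expr0 mulr1 subrr.
rewrite big_cat /=; apply: le_trans (leeD IH (fw m)) _.
by rewrite -EFinD lee_fin (half_powS m); lra.
Qed.

End Geometric.

(** * Construction of the lift *)

Section Surjectivity.
Context {R : realType} {d : nat} {K : set 'rV[R]_d.+1}.
Hypothesis K_compact : compact K.
Local Notation csum := (formal_sum K (circleNG R)).
Local Notation rsum := (formal_sum K (realNG R)).
Local Notation e := (@half_pow R).
Local Open Scope ereal_scope.

Lemma lift_cost_ge0 th (D : seq (\bar R * (circle R * circle R))) :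
  (forall p, p \in D -> 0 <= p.1) -> 0 <= lift_cost th D.
Proof.
move=> D0; rewrite /lift_cost big_seq sume_ge0 // => p /D0 p0.
by rewrite mule_ge0 // lee_fin.
Qed.

Lemma lift_cost_cat th (D D' : seq (\bar R * (circle R * circle R))) :
  lift_cost th (D ++ D') = lift_cost th D + lift_cost th D'.
Proof. exact: big_cat. Qed.

Definition scale_weights (a : R) (D : seq (\bar R * (circle R * circle R))) :=
  [seq (a%:E * p.1, p.2) | p <- D].

Lemma scale_weights_ge0 a D : (0 <= a)%R -> (forall p, p \in D -> 0 <= p.1) ->
  forall p, p \in scale_weights a D -> 0 <= p.1.
Proof.
by move=> a0 D0 _ /mapP[p pD ->] /=; rewrite mule_ge0 ?lee_fin // D0.
Qed.

Lemma sum_scale_weights a D (w : circle R * circle R -> R) : (0 <= a)%R ->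
  (forall p, p \in D -> 0 <= p.1) -> (forall q, 0 <= w q)%R ->
  \sum_(p <- scale_weights a D) p.1 * (w p.2)%:E = a%:E * \sum_(p <- D) p.1 * (w p.2)%:E.
Proof.
move=> a0 D0 w0; rewrite big_map big_seq [in RHS]big_seq ge0_sume_distrr => [|p pD].
  by apply: eq_bigr => p _; rewrite muleA.
by rewrite mule_ge0 ?lee_fin // D0.
Qed.

Lemma proj_lift_chain th (F : seq (simplex K d.+1)) (W : csum d.+1) :
  nonoverlapping F -> (forall s, s \in map snd W -> refines F s) ->
  chain_eq (proj_sum (lift_chain (circle_lift th) F W : rsum d.+1)) W.
Proof.
move=> nF FW; apply: chain_eq_sym.
rewrite (_ : proj_sum _ = [seq (coef f W, f) | f <- F]); first exact: chain_eq_refines.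
rewrite /proj_sum /lift_chain -map_comp; apply: eq_map => f /=.
rewrite raddfMz circle_liftK -mulrzA (orient_sqr _ _).1 ?mulr1z //.
exact: top_sub (std_frame_free).
Qed.

Lemma finite_mass_lift (T : @flat_chain R d.+1 K (circleNG R) d) :
  flat_mass T < +oo ->
  exists S : @flat_chain R d.+1 K (realNG R) d,
    flat_mass S < +oo /\ flat_eq (flat_proj S) T.
Proof.
move=> Tfin.
have e0 m : (0 < e m)%R := half_pow_gt0 m.
have ee m : (e m * e m <= e m)%R by rewrite ler_piMr ?half_pow_le1 // ltW.
(* The square makes step [m] of order 4^-m, still summable after the weight 2^m that it receives
   below; the factor 1/2 leaves room for the triangle inequality through [T]. *)
have [m|C [P hP]] := flat_chain_approximation (eps := fun m => e m * e m / 2)%R _ Tfin.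
  by rewrite divr_gt0 // mulr_gt0.
have C0 : (0 <= C)%R by rewrite -lee_fin; apply: le_trans (hP 0%N).1; exact: weight_ge0.
have Pstep m : flat_norm (chain_sub (P m) (P m.+1)) < (e m * e m)%:E.
  have [_ [N1 h1]] := hP m; have [_ [N2 h2]] := hP m.+1.
  pose i := maxn N1 N2; apply: le_lt_trans (flat_norm_triangle K_compact (T i) _ _) _.
  rewrite [X in _ + X]flat_norm_sym.
  apply: lt_le_trans (lteD (h1 i (leq_maxl _ _)) (h2 i (leq_maxr _ _))) _.
  rewrite -EFinD lee_fin; rewrite (half_powS m); have := e0 m.+1; nra.
have /choice[QS hQS] : forall m, exists q : csum d.+1 * csum d,
    [/\ chain_eq (chain_sub (P m) (P m.+1)) (boundary q.1 ++ q.2),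
        weight q.1 <= (e m * e m)%:E & weight q.2 <= (e m * e m)%:E].
  by move=> m; have [Q [S ?]] := flat_norm_decomposition (Pstep m); exists (Q, S).
pose Q m := (QS m).1; pose S m := (QS m).2.
pose W : nat -> csum d.+1 := concat_upto Q; pose Z : nat -> csum d := concat_upto S.
pose Y m : csum d := chain_sub (chain_sub (P 0%N) (P m)) (Z m).
have hW m : chain_eq (boundary (W m)) (Y m).
  elim: m => [|m IH].
    by apply: chain_eq_mult => N x; rewrite !mult_sub subrr !mult_nil subrr.
  have [QSm _ _] := hQS m; rewrite /W /= boundary_cat.
  apply: (@chain_eq_trans _ _ _ _ _ _
    (Y m ++ chain_sub (chain_sub (P m) (P m.+1)) (S m))).
    apply: chain_eq_cat IH _; apply: chain_eq_sym.
    apply: chain_eq_trans (chain_eq_sub QSm (chain_eq_refl _)) _.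
    by apply: chain_eq_mult => N x; rewrite mult_sub mult_cat addrK.
  apply: chain_eq_mult => N x; rewrite /Y /Z /= !(mult_cat, mult_sub).
  exact: zmod_telescope.
have weightZ m : weight (Z m) <= 2%:E.
  apply: le_trans (sum_concat_upto (f := S) m _) _.
    by move=> l; have [_ _ h] := hQS l; apply: le_trans h _; rewrite lee_fin.
  by rewrite lee_fin gerBl mulr_ge0 // ltW.
have /choice[F hF] : forall m, exists F, nonoverlapping F /\
    forall s, s \in map snd (W m) -> refines F s.
  by move=> m; have [F ? ?] := refinement (map snd (W m)); exists F.
have /choice[Db hDb] : forall m, exists D,
    jump_bound D (Y m) (fun L => boundary (lift_chain L (F m) (W m))).
  by move=> m; have [nF FW] := hF m; exact: jump_boundary.
(* The difference of the lifts of [W m.+1] and [W m] is not the lift of [Q m]. But on each cell it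
   compares the lifts of two values whose difference is the value of [Q m], so the mass of [Q m]
   controls it once the cut is good. *)
have /choice[Dt hDt] : forall m, exists D, jump_bound D (Q m)
    (fun L => chain_sub (lift_chain L (F m.+1) (W m.+1)) (lift_chain L (F m) (W m))).
  move=> m; have [nF FW] := hF m; have [nF' FW'] := hF m.+1.
  apply: jump_top => //; apply: chain_eq_mult => N x.
  by rewrite mult_sub /W /= mult_cat addrC addKr.
(* The weight 2^l is absorbed by the bound 4^-l on [Q l], so before lifting the total stays below 2;
   after lifting, a bound [M] on the total gives M 2^-l on step [l]. *)
pose E := concat_upto (fun l => scale_weights (2 ^+ l) (Dt l)).
have E0 m p : p \in E m -> 0 <= p.1.
  elim: m => //= m IH; rewrite mem_cat => /orP[/IH //|]; apply: scale_weights_ge0.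
    by rewrite exprn_ge0.
  by have [] := hDt m.
have circle_norm_ge0 (g : circle R) : (0 <= circle_norm g)%R := @ngnorm_ge0 R (circleNG R) g.
(* In 2C + 4, the chain [Y m] contributes C + C + 2, for [P 0], [P m] and [Z m], and the weighted
   list [E m] contributes 2. *)
have [m p|m|th /andP[th0 th1] [M hM]] := @common_cut R (fun m => Db m ++ E m) (2 * C + 4)%R.
- rewrite mem_cat => /orP[|/E0 //]; by have [h _ _] := hDb m; exact: h.
- rewrite big_cat /=; have [_ hY _] := hDb m.
  apply: (@le_trans _ _ ((C + C + 2)%:E + 2%:E)); last by rewrite -EFinD lee_fin; lra.
  apply: leeD.
    apply: le_trans hY _; rewrite /Y /chain_sub !weight_cat !weight_opp !EFinD.
    by rewrite !leeD ?(hP _).1.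
  apply: le_trans (sum_concat_upto m _) _; last first.
    by rewrite lee_fin gerBl mulr_ge0 // ltW.
  move=> l; have [D0 hQ _] := hDt l.
  rewrite (sum_scale_weights (w := fun q => circle_norm (q.1 - q.2))) ?exprn_ge0 //.
  apply: (@le_trans _ _ ((2 ^+ l)%:E * (e l * e l)%:E)).
    apply: lee_wpmul2l; first by rewrite lee_fin exprn_ge0.
    by apply: le_trans hQ _; have [_ h _] := hQS l.
  by rewrite -EFinM lee_fin mulrA half_powK mul1r.
pose L := circle_lift th; have L0 : L 0%R = 0%R := circle_lift0 th0.
(* [E m] contains the list of step [l] as soon as m > l, so one good index beyond [l] gives the
   bound for that step. *)
have DtM l : lift_cost th (Dt l) <= (M * e l)%:E.
  have [m lm hm] := hM l.+1.
  have h : (2 ^+ l)%:E * lift_cost th (Dt l) <= M%:E.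
    apply: le_trans hm; rewrite lift_cost_cat -[leLHS]add0e; apply: leeD.
      by apply: lift_cost_ge0; have [] := hDb m.
    elim: m lm => // m IH; rewrite ltnS leq_eqVlt => /predU1P[->|/IH h] /=; rewrite lift_cost_cat.
      rewrite -[leLHS]add0e; apply: leeD; first by apply: lift_cost_ge0; exact: E0.
      have [D0 _ _] := hDt m.
      by rewrite /lift_cost (sum_scale_weights (w := fun q => `|L q.1 - L q.2|%R)) ?exprn_ge0.
    rewrite -[leLHS]adde0; apply: leeD => //; apply: lift_cost_ge0; apply: scale_weights_ge0.
      by rewrite exprn_ge0.
    by have [] := hDt m.
  rewrite (_ : (M * e l)%:E = (e l)%:E * M%:E); last by rewrite -EFinM mulrC.
  apply: le_trans (lee_wpmul2l _ h); last by rewrite lee_fin ltW.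
  by rewrite muleA -EFinM mulrC half_powK mul1e.
have M0 : (0 <= M)%R.
  have := le_trans (lift_cost_ge0 th (let: And3 D0 _ _ := hDt 0%N in D0)) (DtM 0%N).
  by rewrite lee_fin /half_pow expr0 mulr1.
pose Wl m : rsum d.+1 := lift_chain L (F m) (W m).
pose SS m : rsum d := chain_sub (chain_sub (lift_sum (P 0%N)) (boundary (Wl m))) (lift_sum (Z m)).
have step m : flat_norm (chain_sub (SS m) (SS m.+1)) <= ((M + 1) * e m)%:E.
  (* The filling is the difference of the two lifted top-dimensional chains; once its boundary is
     removed, only the lift of [S m] remains. *)
  apply: le_trans (flat_norm_le _ (chain_sub (Wl m.+1) (Wl m))) _.
  rewrite mulrDl mul1r EFinD; apply: leeD.
    by have [_ _ /(_ L L0) h] := hDt m; apply: le_trans h (DtM m).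
  apply: (@le_trans _ _ (weight (lift_sum (S m)))); last first.
    by rewrite weight_lift_sum; have [_ _ h] := hQS m; apply: le_trans h _; rewrite lee_fin.
  apply: le_trans (mass_le_weight K_compact _); apply: le_mass.
  apply: chain_eq_mult => N x; rewrite /SS /Z /= lift_sum_cat /chain_sub boundary_cat boundary_opp.
  rewrite -!/(chain_sub _ _) !(mult_sub, mult_cat).
  exact: zmod_step.
have tail m p : flat_norm (chain_sub (SS m) (SS (m + p)%N)) <=
    ((M + 1) * (2 * e m - 2 * e (m + p)%N))%:E.
  elim: p => [|p IH].
    by rewrite addn0 subrr mulr0; apply: flat_norm_null; exact: chain_sub_self.
  apply: le_trans (flat_norm_triangle K_compact (SS (m + p)%N) _ _) _.
  rewrite addnS; apply: le_trans (leeD IH (step _)) _.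
  by rewrite -EFinD -mulrDr lee_fin ler_wpM2l ?addr_ge0 // (half_powS (m + p)%N); lra.
have cauchy N i j : (N <= i)%N -> (N <= j)%N ->
    flat_norm (chain_sub (SS i) (SS j)) <= (2 * (M + 1) * e N)%:E.
  wlog ij : i j / (i <= j)%N => [H|] Ni Nj.
    by have [|/ltnW] := leqP i j => ij; [|rewrite flat_norm_sym]; exact: H.
  have := tail i (j - i)%N; rewrite subnKC // => h; apply: le_trans h _.
  rewrite lee_fin (_ : 2 * (M + 1) * e N = (M + 1) * (2 * e N))%R; last by ring.
  rewrite ler_wpM2l ?addr_ge0 //.
  by have := @half_pow_le R _ _ Ni; have := e0 j; lra.
have small (eps : R) : (0 < eps)%R -> exists N, (2 * (M + 1) * e N < eps)%R.
  move=> eps0; have M1 : (0 < 2 * (M + 1))%R by rewrite mulr_gt0 // ltr_wpDl.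
  have [|N /(_ N (leqnn N)) h] := @half_pow_lt R (eps / (2 * (M + 1)))%R.
    by rewrite divr_gt0.
  by exists N; rewrite mulrC -ltr_pdivlMr.
have SSc (eps : R) : (0 < eps)%R -> exists N : nat, forall i j : nat,
    (N <= i)%N -> (N <= j)%N -> flat_norm (chain_sub (SS i) (SS j)) < eps%:E.
  move=> /small[N hN]; exists N => i j Ni Nj; apply: le_lt_trans (cauchy N i j Ni Nj) _.
  by rewrite lte_fin.
exists (FlatChain SSc); split.
  (* The masses are bounded along the good indices only. This subsequence is enough, since the
     relaxed mass is an infimum over approximating sequences. *)
  have /choice[ms hms] : forall j, exists m, (j <= m)%N /\ lift_cost th (Db m ++ E m) <= M%:E.
    by move=> j; have [m ? ?] := hM j; exists m.
  apply: (@le_lt_trans _ _ (C + M + 2)%:E); last exact: ltry.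
  apply: (@le_trans _ _ (limn_einf (fun j => mass (SS (ms j))))).
    apply: ereal_inf_lbound; exists (fun j => SS (ms j)) => //=.
    apply: (@cvge0_le _ (fun j => (2 * (M + 1) * e j)%:E)) => [j|j|].
    - exact: flat_dist_ge0.
    - apply: (@limn_esup_le _ _ _ (ms j)) => i ji /=.
      apply: le_trans (cauchy (ms j) _ _ (leqnn _) ji) _.
      by rewrite lee_fin ler_wpM2l ?mulr_ge0 ?addr_ge0 // half_pow_le // (hms j).1.
    - apply: cvg_EFin; first exact: nearW.
      apply: (@cvg_geometric R (2 * (M + 1)) 2^-1)%R.
      by rewrite ger0_norm ?invr_ge0 // invf_lt1 // ltr1n.
  apply: limn_einf_le => j; exists j => //.
  apply: le_trans (mass_cat K_compact _ _) _; rewrite mass_opp !EFinD; apply: leeD.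
    apply: le_trans (mass_cat K_compact _ _) _; rewrite mass_opp; apply: leeD.
      by apply: le_trans (mass_le_weight K_compact _) _; rewrite weight_lift_sum (hP _).1.
    have [_ _ /(_ L L0) h] := hDb (ms j); apply: le_trans h _.
    apply: le_trans (hms j).2; rewrite lift_cost_cat leeDl //.
    by apply: lift_cost_ge0; exact: E0.
  by apply: le_trans (mass_le_weight K_compact _) _; rewrite weight_lift_sum.
(* Projection undoes every lift, and [boundary (W i)] equals P 0 - P i - Z i as a chain, so the
   projection of [SS i] is [P i]. *)
have projE i : chain_eq (proj_sum (SS i)) (P i).
  have [nF FW] := hF i.
  rewrite !proj_sub proj_boundary !lift_sumK.
  apply: (@chain_eq_trans _ _ _ _ _ _ (chain_sub (chain_sub (P 0%N) (Y i)) (Z i))).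
    apply: chain_eq_sub (chain_eq_refl _); apply: chain_eq_sub (chain_eq_refl _) _.
    apply: chain_eq_trans (hW i); apply: boundary_eq; exact: proj_lift_chain.
  apply: chain_eq_mult => N x; rewrite !mult_sub; exact: zmod_cancel.
apply/eqP; rewrite eq_le; apply/andP; split; last exact: flat_dist_ge0.
apply/lee_addgt0Pr => eps eps0; rewrite add0e.
have eps20 : (0 < eps / 2)%R by rewrite divr_gt0.
have [N1 hN1] := approx_cauchy T eps20.
have [N2 hN2] := half_pow_lt eps20.
apply: (@limn_esup_le _ _ _ (maxn N1 N2)) => i; rewrite geq_max => /andP[N1i N2i] /=.
rewrite (flat_norm_eq (chain_eq_sub (projE i) (chain_eq_refl _))).
have [_ [N3 hN3]] := hP i; pose j := maxn N1 N3.
apply: le_trans (flat_norm_triangle K_compact (T j) _ _) _.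
apply: le_trans (leeD (ltW (hN3 j (leq_maxr _ _))) (ltW (hN1 j i (leq_maxl _ _) N1i))) _.
rewrite -EFinD lee_fin; have := hN2 i N2i; have := ee i; have := e0 i.
have : (e i * e i / 2 <= e i * e i)%R by rewrite ler_pdivrMr // ler_peMr ?ler1n // mulr_ge0 // ltW.
lra.
Qed.

End Surjectivity.

Theorem theorem5p9 (R : realType) (d : nat) (K : set 'rV[R]_d.+1)
    (K_convex : convex_set K) (K_compact : compact K) (K_interior : K° !=set0) :
  (forall S : @flat_chain R d.+1 K (realNG R) d,
     (flat_mass S < +oo)%E -> (flat_mass (flat_proj S) < +oo)%E) /\
  (forall T : @flat_chain R d.+1 K (circleNG R) d,
     (flat_mass T < +oo)%E ->
     exists S : @flat_chain R d.+1 K (realNG R) d,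
       (flat_mass S < +oo)%E /\ flat_eq (flat_proj S) T).
Proof.
split=> [S|T Tfin]; first by apply: le_lt_trans; exact: flat_mass_proj.
exact: finite_mass_lift.
Qed.
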